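(* Let $\widetilde{T}$ be a complete theory in a language $\widetilde{\mathcal{L}}$ which eliminates quantifiers and imaginaries. Let $T$ be a complete theory in a language $\mathcal{L}\supseteq\widetilde{\mathcal{L}}$ containing the universal part of $\widetilde{T}$. Let $M$ be an $|\mathcal{L}|^{+}$-saturated and $|\mathcal{L}|^{+}$-homogeneous model of $T$ and let $\widetilde{M}\models\widetilde{T}$ be such that the reduct $M|_{\widetilde{\mathcal{L}}}$ is a substructure of $\widetilde{M}$ and such that any automorphism of $M$ extends to an automorphism of $\widetilde{M}$. Suppose that the following conditions (i)–(iv) hold for any $A=\mathrm{acl}_{\mathcal{L}}(A)\subseteq M$ and any $c\in\mathrm{dom}(M)$: (i) (Relative algebraic boundedness) For every $M'\prec M$, $\mathrm{dcl}_{\mathcal{L}}(M'c)\subseteq\mathrm{acl}_{\widetilde{\mathcal{L}}}(M'c)$. (ii) (Internalizing $\widetilde{\mathcal{L}}$-codes) For all $\epsilon\in\mathrm{dcl}_{\widetilde{\mathcal{L}}}(M)$, there exists a tuple $\eta$ of elements of $M$ such that an automorphism of $\widetilde{M}$ that stabilizes $M$ setwise fixes $\epsilon$ if and only if it fixes $\eta$. (iii) (Unary EI) Every $\mathcal{L}(M)$-definable unary subset of $\mathrm{dom}(M)$ is coded in $M$. (iv) (Invariant types) There exists an $\mathrm{Aut}(\widetilde{M}/A)$-invariant type $\widetilde{p}$ over $\widetilde{M}$ such that $\widetilde{p}|M$ is consistent with $\mathrm{tp}_{\mathcal{L}}(c/A)$. Moreover, for any $\widetilde{\mathcal{L}}(\widetilde{M})$-definable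 function $r$ whose domain contains $\widetilde{p}$, let $\partial_{\widetilde{p}}r$ be the $\widetilde{p}$-germ of $r$. Then there exist a directed order $I$ and a sequence $(\epsilon_i)_{i\in I}$, with $\epsilon_i\in\mathrm{dcl}_{\widetilde{\mathcal{L}}}(A,\ulcorner r\urcorner)$, such that $\sigma\in\mathrm{Aut}(\widetilde{M}/A)$ fixes $\partial_{\widetilde{p}}r$ if and only if $\sigma$ fixes almost every $\epsilon_i$, i.e. there is $i_0\in I$ such that $\sigma$ fixes $\epsilon_i$ for all $i\geq i_0$. Then $T$ admits elimination of imaginaries up to uniform finite imaginaries.
   Context: Theories are many-sorted, with a distinguished collection of sorts called dominant sorts, such that for any sort $S$ there is a $\emptyset$-definable partial function from a finite product of dominant sorts onto $S$. For a model $M$, $\mathrm{dom}(M)$ is the set of elements of $M$ of dominant sorts; a unary subset is a definable subset of a single dominant sort. A theory $T$ eliminates imaginaries up to uniform finite imaginaries (EI/UFI) if for all $N\models T$ and $e\in N^{\mathrm{eq}}$, there exists a tuple $d\in N$ such that $e\in\mathrm{acl}^{\mathrm{eq}}(d)$ and $d\in\mathrm{dcl}^{\mathrm{eq}}(e)$. $\mathrm{dcl}_{\mathcal{L}},\mathrm{acl}_{\mathcal{L}},\mathrm{tp}_{\mathcal{L}}$ denote definable closure, algebraic closure and type in the model $M$ of $T$ (closures restricted to elements of $M$, not of $M^{\mathrm{eq}}$); $\mathrm{dcl}_{\widetilde{\mathcal{L}}},\mathrm{acl}_{\widetilde{\mathcal{L}}}$ denote the closures in $\widetilde{M}\models\widetilde{T}$.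 $\mathcal{L}(M)$-definable means $\mathcal{L}$-definable with parameters in $M$. A definable set $X$ in $M$ is coded in $M$ if $X=R(M;b)$ for some formula $R$ without parameters and tuple $b$ of $M$ such that $b\neq b'$ implies $R(M;b)\neq R(M;b')$; then $b$ (or $\mathrm{dcl}(b)$) is called a code of $X$. $\ulcorner r\urcorner$ denotes a code in $\widetilde{M}$ of the (graph of the) function $r$. A theory eliminates imaginaries if every definable set in every model is coded. For a type $q$ over $N$ and $B\subseteq N$, $q|B$ is its restriction to $B$; it is $\mathrm{Aut}(N/B)$-invariant if it is fixed by all automorphisms of $N$ fixing $B$ pointwise. Two $\widetilde{\mathcal{L}}(\widetilde{M})$-definable functions $r,r'$ have the same $\widetilde{p}$-germ if they agree on a realization of $\widetilde{p}$ over $\widetilde{M}$. *)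

(* Defs.v *)
From mathcomp Require Import all_boot.
From mathcomp Require Import boolp classical_sets functions cardinality.

Set Implicit Arguments.
Unset Strict Implicit.
Unset Printing Implicit Defensive.

Local Open Scope classical_set_scope.
Local Open Scope card_scope.

(** * Typed variables and tuples *)

(* A context is a list of sorts; [var Gam s] are its positions of sort [s]. *)
Inductive var (S : Type) : seq S -> S -> Type :=
| vz s Gam : var (s :: Gam) s
| vs s t Gam : var Gam s -> var (t :: Gam) s.
Arguments vz {S s Gam}.
Arguments vs {S s t Gam} v.

(* A tuple of sort [Gam], i.e. an element of the product of the sorts in [Gam]. *)
Definition env (S : Type) (F : S -> Type) (Gam : seq S) : Type :=
  forall s, var Gam s -> F s.

Definition env_nil {S : Type} {F : S -> Type} : env F [::] :=
  fun s v => match v with end.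

Definition env_cons {S : Type} {F : S -> Type} {s : S} {Gam : seq S}
    (x : F s) (rho : env F Gam) : env F (s :: Gam) :=
  fun t v =>
    match v in var D t return
      match D with
      | [::] => unit
      | s' :: D' => F s' -> env F D' -> F t
      end
    with
    | vz _ _ => fun x _ => x
    | vs _ _ _ w => fun _ rho => rho _ w
    end x rho.

Definition env_sing {S : Type} {F : S -> Type} {s : S} (x : F s) : env F [:: s] :=
  env_cons x env_nil.

Fixpoint env_cat {S : Type} {F : S -> Type} {Gam Del : seq S} :
    env F Gam -> env F Del -> env F (Gam ++ Del) :=
  match Gam return env F Gam -> env F Del -> env F (Gam ++ Del) with
  | [::] => fun _ del => del
  | s :: Gam' => fun rho del =>
      env_cons (rho s vz) (env_cat (fun t v => rho t (vs v)) del)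
  end.

Definition env_map {S : Type} {F G : S -> Type} (f : forall s, F s -> G s)
    {Gam : seq S} (rho : env F Gam) : env G Gam :=
  fun s v => f s (rho s v).

Fixpoint var_map {S S' : Type} (h : S -> S') {Gam : seq S} {s : S} (v : var Gam s) :
    var (map h Gam) (h s) :=
  match v with
  | vz _ _ => vz
  | vs _ _ _ w => vs (var_map h w)
  end.

(** * Many-sorted first-order logic *)

Record language (S : Type) := Language {
  func : seq S -> S -> Type;
  rel : seq S -> Type }.

Inductive term (S : Type) (L : language S) (Gam : seq S) : S -> Type :=
| Var s : var Gam s -> term L Gam s
| App Del s : func L Del s -> (forall t, var Del t -> term L Gam t) -> term L Gam s.
Arguments Var {S L Gam s} v.
Arguments App {S L Gam Del s} f a.

Inductive formula (S : Type) (L : language S) : seq S -> Type :=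
| Bot Gam : formula L Gam
| Eq Gam s : term L Gam s -> term L Gam s -> formula L Gam
| Rel Gam Del : rel L Del -> env (term L Gam) Del -> formula L Gam
| Imp Gam : formula L Gam -> formula L Gam -> formula L Gam
| All Gam s : formula L (s :: Gam) -> formula L Gam.
Arguments Bot {S L Gam}.
Arguments Eq {S L Gam s} t u.
Arguments Rel {S L Gam Del} R a.
Arguments Imp {S L Gam} phi psi.
Arguments All {S L Gam} s phi.

Definition neg {S : Type} {L : language S} {Gam : seq S} (phi : formula L Gam) :=
  Imp phi Bot.

Fixpoint qfree {S : Type} {L : language S} {Gam : seq S} (phi : formula L Gam) : Prop :=
  match phi with
  | Imp _ phi psi => qfree phi /\ qfree psi
  | All _ _ _ => False
  | _ => True
  end.

Fixpoint universal {S : Type} {L : language S} {Gam : seq S} (phi : formula L Gam) : Prop :=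
  match phi with
  | All _ _ psi => universal psi
  | phi => qfree phi
  end.

(* As is customary, sorts are nonempty. *)
Record structure (S : Type) (L : language S) := Structure {
  carrier :> S -> Type;
  carrier_inhabited : forall s, inhabited (carrier s);
  fint : forall Gam s, func L Gam s -> env carrier Gam -> carrier s;
  rint : forall Gam, rel L Gam -> env carrier Gam -> Prop }.
Arguments fint {S L} M {Gam s} f rho : rename.
Arguments rint {S L} M {Gam} R rho : rename.

Fixpoint eval {S : Type} {L : language S} (M : structure L) {Gam : seq S}
    (rho : env M Gam) {s : S} (t : term L Gam s) : M s :=
  match t with
  | Var _ v => rho _ v
  | App _ _ f a => fint M f (fun u v => eval rho (a u v))
  end.

Fixpoint sat {S : Type} {L : language S} (M : structure L) {Gam : seq S}
    (phi : formula L Gam) : env M Gam -> Prop :=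
  match phi in formula _ Gam return env M Gam -> Prop with
  | Bot _ => fun _ => False
  | Eq _ _ t u => fun rho => eval rho t = eval rho u
  | Rel _ _ R a => fun rho => rint M R (fun s v => eval rho (a s v))
  | Imp _ phi psi => fun rho => sat phi rho -> sat psi rho
  | All _ s phi => fun rho => forall x : M s, sat phi (env_cons x rho)
  end.

(* |L| is the number of L-formulas. *)
Definition card_le_lang {S T : Type} (L : language S) (A : set T) : Prop :=
  A #<= [set: {Gam : seq S & formula L Gam}].

(** * Theories *)

Definition models {S : Type} {L : language S} (N : structure L)
    (Phi : set (formula L [::])) : Prop :=
  forall phi, Phi phi -> sat (M := N) phi env_nil.

Definition entails {S : Type} {L : language S} (Phi : set (formula L [::]))
    {Gam : seq S} (phi : formula L Gam) : Prop :=
  forall N : structure L, models N Phi -> forall rho : env N Gam, sat phi rho.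

(* The sort [s] is the image of a product of sorts in [D] under a partial
   function defined by a single formula without parameters in all models. *)
Definition covered_by {S : Type} {L : language S} (Phi : set (formula L [::]))
    (D : set S) (s : S) : Prop :=
  exists (Gam : seq S) (phi : formula L (s :: Gam)),
    (forall t, var Gam t -> D t) /\
    forall N : structure L, models N Phi ->
      (forall (a : env N Gam) (y y' : N s),
        sat phi (env_cons y a) -> sat phi (env_cons y' a) -> y = y') /\
      (forall y : N s, exists a : env N Gam, sat phi (env_cons y a)).

Record theory (S : Type) (L : language S) := Theory {
  axioms :> set (formula L [::]);
  dominant : set S;
  dominantP : forall s, covered_by axioms dominant s }.
Arguments dominant {S L} T : rename.

Definition complete {S : Type} {L : language S} (T : theory L) : Prop :=
  (exists N : structure L, models N T) /\
  forall phi : formula L [::], entails T phi \/ entails T (neg phi).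

Definition eliminates_quantifiers {S : Type} {L : language S} (T : theory L) : Prop :=
  forall (Gam : seq S) (phi : formula L Gam), exists psi : formula L Gam,
    qfree psi /\ entails T (Imp phi psi) /\ entails T (Imp psi phi).

(** * Elements, formulas with parameters, definable sets, closures *)

Definition elt {S : Type} (F : S -> Type) : Type := {s : S & F s}.

Definition elt_map {S : Type} {F G : S -> Type} (f : forall s, F s -> G s)
    (x : elt F) : elt G :=
  existT G (projT1 x) (f (projT1 x) (projT2 x)).

Definition rng {S : Type} {F : S -> Type} {Gam : seq S} (rho : env F Gam) : set (elt F) :=
  [set x | exists s (v : var Gam s), x = existT F s (rho s v)].

Record pformula {S : Type} {L : language S} (M : structure L) (Gam : seq S) := PFormula {
  pctx : seq S;
  pfor : formula L (Gam ++ pctx);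
  pval : env M pctx }.
Arguments PFormula {S L M Gam pctx} pfor pval.
Arguments pfor {S L M Gam} phi : rename.
Arguments pval {S L M Gam} phi : rename.

Definition over {S : Type} {L : language S} {M : structure L} {Gam : seq S}
    (A : set (elt M)) (phi : pformula M Gam) : Prop :=
  rng (pval phi) `<=` A.

Definition psat {S : Type} {L : language S} {M : structure L} {Gam : seq S}
    (phi : pformula M Gam) : set (env M Gam) :=
  [set rho | sat (pfor phi) (env_cat rho (pval phi))].

Definition pneg {S : Type} {L : language S} {M : structure L} {Gam : seq S}
    (phi : pformula M Gam) : pformula M Gam :=
  PFormula (neg (pfor phi)) (pval phi).

Definition pmap_params {S : Type} {L : language S} {M N : structure L}
    (f : forall s, M s -> N s) {Gam : seq S} (phi : pformula M Gam) : pformula N Gam :=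
  PFormula (pfor phi) (env_map f (pval phi)).

Definition definable {S : Type} {L : language S} {M : structure L} (A : set (elt M))
    {Gam : seq S} (X : set (env M Gam)) : Prop :=
  exists phi : pformula M Gam, over A phi /\ X = psat phi.

Definition dcl {S : Type} {L : language S} (M : structure L) (A : set (elt M)) :
    set (elt M) :=
  [set x | definable A [set env_sing (projT2 x)]].

Definition acl {S : Type} {L : language S} (M : structure L) (A : set (elt M)) :
    set (elt M) :=
  [set x | exists X : set (env M [:: projT1 x]),
    [/\ definable A X, finite_set X & X (env_sing (projT2 x))]].

Definition is_code {S : Type} {L : language S} {M : structure L} {Gam Del : seq S}
    (X : set (env M Gam)) (b : env M Del) : Prop :=
  exists R : formula L (Gam ++ Del),
    X = [set a | sat R (env_cat a b)] /\
    forall b' : env M Del, b <> b' ->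
      [set a : env M Gam | sat R (env_cat a b)]
      <> [set a : env M Gam | sat R (env_cat a b')].

Definition coded {S : Type} {L : language S} {M : structure L} {Gam : seq S}
    (X : set (env M Gam)) : Prop :=
  exists (Del : seq S) (b : env M Del), is_code X b.

Definition eliminates_imaginaries {S : Type} {L : language S} (T : theory L) : Prop :=
  forall N : structure L, models N T ->
  forall (Gam : seq S) (X : set (env N Gam)), definable setT X -> coded X.

(** * Maps between structures, saturation, homogeneity *)

Definition embedding {S : Type} {L : language S} {M N : structure L}
    (f : forall s, M s -> N s) : Prop :=
  [/\ forall s, injective (f s),
      forall Gam s (F : func L Gam s) (rho : env M Gam),
        f s (fint M F rho) = fint N F (env_map f rho) &
      forall Gam (R : rel L Gam) (rho : env M Gam),
        rint M R rho <-> rint N R (env_map f rho)].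

Definition automorphism {S : Type} {L : language S} (M : structure L)
    (f : forall s, M s -> M s) : Prop :=
  embedding f /\ forall s, bijective (f s).

Definition elementary {S : Type} {L : language S} {M N : structure L}
    (f : forall s, M s -> N s) : Prop :=
  forall (Gam : seq S) (phi : formula L Gam) (rho : env M Gam),
    sat phi rho <-> sat phi (env_map f rho).

Definition fixes {S : Type} {F : S -> Type} (f : forall s, F s -> F s) (x : elt F) : Prop :=
  elt_map f x = x.

Definition fin_sat {S : Type} {L : language S} {M : structure L} {Gam : seq S}
    (p : set (pformula M Gam)) : Prop :=
  forall F : set (pformula M Gam), finite_set F -> F `<=` p ->
    exists rho : env M Gam, forall phi, F phi -> psat phi rho.

(* Complete types over [A] in the variables [Gam]. *)
Definition is_type {S : Type} {L : language S} {M : structure L} {Gam : seq S}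
    (A : set (elt M)) (p : set (pformula M Gam)) : Prop :=
  [/\ p `<=` over A, fin_sat p &
      forall phi, over A phi -> p phi \/ p (pneg phi)].

Definition tp {S : Type} {L : language S} {M : structure L} {Gam : seq S}
    (A : set (elt M)) (a : env M Gam) : set (pformula M Gam) :=
  [set phi | over A phi /\ psat phi a].

Definition saturated {S : Type} {L : language S} (M : structure L) : Prop :=
  forall A : set (elt M), card_le_lang L A ->
  forall (Gam : seq S) (p : set (pformula M Gam)), is_type A p ->
    exists rho : env M Gam, forall phi, p phi -> psat phi rho.

(* Strong homogeneity: partial elementary maps with small domain extend to
   automorphisms.  The values of [f] outside [A] are irrelevant. *)
Definition homogeneous {S : Type} {L : language S} (M : structure L) : Prop :=
  forall A : set (elt M), card_le_lang L A ->
  forall f : (forall s, M s -> M s),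
    (forall (Gam : seq S) (phi : formula L Gam) (rho : env M Gam),
      rng rho `<=` A -> (sat phi rho <-> sat phi (env_map f rho))) ->
    exists2 sigma : (forall s, M s -> M s), automorphism sigma &
      forall x, A x -> elt_map sigma x = elt_map f x.

(** * Imaginaries *)

Definition is_equiv {S : Type} {L : language S} (N : structure L) {Gam : seq S}
    (E : formula L (Gam ++ Gam)) : Prop :=
  let R (a b : env N Gam) := sat E (env_cat a b) in
  [/\ forall a, R a a, forall a b, R a b -> R b a &
      forall a b c, R a b -> R b c -> R a c].

Inductive eq_sort (S : Type) (L : language S) (N : structure L) : Type :=
| Home of S
| Imag Gam (E : formula L (Gam ++ Gam)) of is_equiv N E.
Arguments Home {S L N} s.
Arguments Imag {S L N} Gam E HE.

Inductive eq_func (S : Type) (L : language S) (N : structure L) :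
    seq (eq_sort N) -> eq_sort N -> Type :=
| OldFunc Gam s : func L Gam s -> eq_func (map Home Gam) (Home s)
| Proj Gam E HE : eq_func (map Home Gam) (@Imag S L N Gam E HE).

Inductive eq_rel (S : Type) (L : language S) (N : structure L) :
    seq (eq_sort N) -> Type :=
| OldRel Gam : rel L Gam -> @eq_rel S L N (map Home Gam).

Definition eq_language {S : Type} {L : language S} (N : structure L) :
    language (eq_sort N) :=
  Language (@eq_func S L N) (@eq_rel S L N).

Definition eclass {S : Type} {L : language S} {N : structure L} {Gam : seq S}
    (E : formula L (Gam ++ Gam)) (a : env N Gam) : set (env N Gam) :=
  [set b | sat E (env_cat a b)].

Definition eq_carrier {S : Type} {L : language S} (N : structure L) (s : eq_sort N) : Type :=
  match s with
  | Home s => N s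
  | Imag Gam E _ => {P : set (env N Gam) | exists a, P = eclass E a}
  end.

Definition eq_point {S : Type} {L : language S} (N : structure L) (s : eq_sort N) :
  inhabited (eq_carrier s).
Proof.
case: s => [s|Gam E HE] /=; first exact: carrier_inhabited.
have [a] : inhabited (env N Gam).
  elim: Gam {E HE} => [|s Gam [a]]; first exact: (inhabits env_nil).
  by have [x] := carrier_inhabited N s; exact: (inhabits (env_cons x a)).
exact: (inhabits (exist _ (eclass E a) (ex_intro _ a erefl))).
Qed.

Definition home_env {S : Type} {L : language S} {N : structure L} {Gam : seq S}
    (rho : env (@eq_carrier S L N) (map Home Gam)) : env N Gam :=
  fun s v => rho (Home s) (var_map Home v).

(* The structure N^eq. *)
Definition eq_structure {S : Type} {L : language S} (N : structure L) :
    structure (eq_language N) :=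
  @Structure _ (eq_language N) (@eq_carrier S L N) (@eq_point S L N)
    (fun _ _ f =>
       match f in eq_func D s return env (@eq_carrier S L N) D -> eq_carrier s with
       | OldFunc _ _ f => fun rho => fint N f (home_env rho)
       | Proj _ E _ => fun rho =>
           exist _ (eclass E (home_env rho)) (ex_intro _ (home_env rho) erefl)
       end)
    (fun _ R =>
       match R in eq_rel D return env (@eq_carrier S L N) D -> Prop with
       | OldRel _ R => fun rho => rint N R (home_env rho)
       end).

Definition home {S : Type} {L : language S} {N : structure L} (x : elt N) :
    elt (eq_structure N) :=
  existT (eq_structure N) (Home (projT1 x)) (projT2 x).

Definition EI_UFI {S : Type} {L : language S} (T : theory L) : Prop :=
  forall N : structure L, models N T ->
  forall e : elt (eq_structure N),
  exists (Gam : seq S) (d : env N Gam),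
    acl (home @` rng d) e /\ home @` rng d `<=` dcl [set e].

(** * Sublanguages and reducts *)

(* Both languages have the same sorts. *)
Record sublanguage {S : Type} (L1 L2 : language S) := Sublanguage {
  sub_func : forall Gam s, func L1 Gam s -> func L2 Gam s;
  sub_rel : forall Gam, rel L1 Gam -> rel L2 Gam;
  sub_func_inj : forall Gam s, injective (@sub_func Gam s);
  sub_rel_inj : forall Gam, injective (@sub_rel Gam) }.
Arguments sub_func {S L1 L2} i {Gam s} f : rename.
Arguments sub_rel {S L1 L2} i {Gam} R : rename.

Fixpoint lift_term {S : Type} {L1 L2 : language S} (i : sublanguage L1 L2)
    {Gam : seq S} {s : S} (t : term L1 Gam s) : term L2 Gam s :=
  match t with
  | Var _ v => Var v
  | App _ _ f a => App (sub_func i f) (fun u v => lift_term i (a u v))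
  end.

Fixpoint lift {S : Type} {L1 L2 : language S} (i : sublanguage L1 L2)
    {Gam : seq S} (phi : formula L1 Gam) : formula L2 Gam :=
  match phi with
  | Bot _ => Bot
  | Eq _ _ t u => Eq (lift_term i t) (lift_term i u)
  | Rel _ _ R a => Rel (sub_rel i R) (fun s v => lift_term i (a s v))
  | Imp _ phi psi => Imp (lift i phi) (lift i psi)
  | All _ s phi => All s (lift i phi)
  end.

Definition reduct {S : Type} {L1 L2 : language S} (i : sublanguage L1 L2)
    (M : structure L2) : structure L1 :=
  @Structure S L1 M (carrier_inhabited M)
    (fun _ _ f => fint M (sub_func i f)) (fun _ R => rint M (sub_rel i R)).

Definition plift {S : Type} {L1 L2 : language S} (i : sublanguage L1 L2)
    {M : structure L2} {Gam : seq S} (phi : pformula (reduct i M) Gam) : pformula M Gam :=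
  @PFormula S L2 M Gam _ (lift i (pfor phi)) (pval phi).

Definition contains_universal_part {S : Type} {L1 L2 : language S}
    (i : sublanguage L1 L2) (T2 : theory L2) (T1 : theory L1) : Prop :=
  forall phi : formula L1 [::], universal phi -> entails T1 phi -> entails T2 (lift i phi).

(** * Germs of definable functions *)

Definition proves {S : Type} {L : language S} {M : structure L} {Gam : seq S}
    (p : set (pformula M Gam)) (X : set (env M Gam)) : Prop :=
  exists2 phi, p phi & psat phi `<=` X.

(* [r] is a formula defining the graph of a partial function [s -> Del]. *)
Definition is_function {S : Type} {L : language S} {M : structure L} {s : S} {Del : seq S}
    (r : pformula M (s :: Del)) : Prop :=
  forall (x : M s) (y y' : env M Del),
    psat r (env_cons x y) -> psat r (env_cons x y') -> y = y'.

Definition domain {S : Type} {L : language S} {M : structure L} {s : S} {Del : seq S}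
    (r : pformula M (s :: Del)) : set (env M [:: s]) :=
  [set a | exists y : env M Del, psat r (env_cons (a s vz) y)].

(* [r] and [r'] agree on a realization [a] of [p] in an elementary extension [N]. *)
Definition same_germ {S : Type} {L : language S} {M : structure L} {s : S} {Del : seq S}
    (p : set (pformula M [:: s])) (r r' : pformula M (s :: Del)) : Prop :=
  exists (N : structure L) (j : forall t, M t -> N t) (a : N s),
    [/\ elementary j,
        forall phi, p phi -> psat (pmap_params j phi) (env_sing a) &
        exists y : env N Del,
          psat (pmap_params j r) (env_cons a y) /\
          psat (pmap_params j r') (env_cons a y)].

Definition directed_order {I : Type} (le : I -> I -> Prop) : Prop :=
  [/\ forall i, le i i,
      forall i j k, le i j -> le j k -> le i k,
      forall i j, le i j -> le j i -> i = j,
      inhabited I &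
      forall i j, exists2 k, le i k & le j k].

(** * The four conditions *)

(* Below [iota] is the inclusion of the reduct of [M] in [Mt]. *)

Definition relative_algebraic_boundedness {S : Type} {Lt L : language S}
    (i : sublanguage Lt L) (M : structure L) (Mt : structure Lt)
    (iota : forall s, reduct i M s -> Mt s) (c : elt M) : Prop :=
  forall (M' : structure L) (j : forall s, M' s -> M s), elementary j ->
    forall x : elt M, dcl (range (elt_map j) `|` [set c]) x ->
      acl (elt_map iota @` (range (elt_map j) `|` [set c])) (elt_map iota x).

Definition internalizes_codes {S : Type} {Lt L : language S}
    (i : sublanguage Lt L) (M : structure L) (Mt : structure Lt)
    (iota : forall s, reduct i M s -> Mt s) : Prop :=
  forall eps : elt Mt, dcl (range (elt_map iota)) eps ->
  exists (Gam : seq S) (eta : env M Gam),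
    forall sigma : (forall s, Mt s -> Mt s), automorphism sigma ->
      elt_map sigma @` range (elt_map iota) = range (elt_map iota) ->
      (fixes sigma eps <->
       forall x, rng eta x -> fixes sigma (elt_map iota x)).

Definition unary_EI {S : Type} {L : language S} (T : theory L) (M : structure L) : Prop :=
  forall s, dominant T s ->
  forall X : set (env M [:: s]), definable setT X -> coded X.

(* [sigma] belongs to [Aut(M / A)]. *)
Definition aut_over {S : Type} {L : language S} {M : structure L} (A : set (elt M))
    (sigma : forall s, M s -> M s) : Prop :=
  automorphism sigma /\ forall x, A x -> fixes sigma x.

Definition invariant {S : Type} {L : language S} {M : structure L} {Gam : seq S}
    (A : set (elt M)) (p : set (pformula M Gam)) : Prop :=
  forall sigma, aut_over A sigma -> forall phi, p (pmap_params sigma phi) <-> p phi.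

(* The restriction to [M] of a type over [Mt], as a set of quantifier-free
   formulas: these determine the type when the theory of [Mt] eliminates
   quantifiers, and, unlike other formulas, they have the same meaning in [M]
   and in [Mt]. *)
Definition restrict {S : Type} {Lt L : language S}
    (i : sublanguage Lt L) (M : structure L) (Mt : structure Lt)
    (iota : forall s, reduct i M s -> Mt s) {Gam : seq S} (p : set (pformula Mt Gam)) :
    set (pformula (reduct i M) Gam) :=
  [set phi | qfree (pfor phi) /\ p (pmap_params iota phi)].

Definition invariant_types {S : Type} {Lt L : language S}
    (i : sublanguage Lt L) (M : structure L) (Mt : structure Lt)
    (iota : forall s, reduct i M s -> Mt s) (A : set (elt M)) {s : S} (c : M s) : Prop :=
  let At := elt_map iota @` A in
  exists p : set (pformula Mt [:: s]),
    [/\ is_type setT p,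
        invariant At p,
        fin_sat (@plift S Lt L i M [:: s] @` restrict iota p `|` tp A (env_sing c)) &
        forall (Del : seq S) (r : pformula Mt (s :: Del)),
          is_function r -> proves p (domain r) ->
        forall (Th : seq S) (b : env Mt Th), is_code (psat r) b ->
        exists (I : Type) (le : I -> I -> Prop) (eps : I -> elt Mt),
          [/\ directed_order le,
              forall k, dcl (At `|` rng b) (eps k) &
              forall sigma, aut_over At sigma ->
                (same_germ p r (pmap_params sigma r) <->
                 exists k0, forall k, le k0 k -> fixes sigma (eps k))]].

(* Main.v *)
From Stdlib Require List.
Require Import Defs.
From mathcomp Require Import all_boot.
From mathcomp Require Import boolp classical_sets functions cardinality filter.

Set Implicit Arguments.
Unset Strict Implicit.
Unset Printing Implicit Defensive.

Local Open Scope classical_set_scope.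

(** Let [a] represent the imaginary [e = a / E].  The aim is a tuple of real
    elements that is fixed by the automorphisms fixing [e] and over which [e] has
    finitely many conjugates ([orbit_ucoded]).  The existence of such a tuple is
    expressed by formulas without parameters, so it passes from the saturated
    homogeneous model [M] to every model of [T] ([ucoded_transfer]).  It passes
    along definable surjections as well, so [a] may be taken of dominant sorts.

    One argues by induction on the coordinates of [a] that the class does not
    determine.  Freezing one of them, of value [c], gives a finer imaginary, coded
    by a tuple [f c] by the induction hypothesis.  So [e] yields a partial function
    [f] of one variable of dominant sort ([fib]), and each value of [f] at a point
    leaves only finitely many possibilities for [e] ([fib_finite]).  Let [A] be the
    set of real elements algebraic over [e] ([racl]).  By unary elimination of
    imaginaries, the domain of [f] is definable over [A].

    The core of the proof is that [e] has finitely many conjugates over [A]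
    ([conjugates_finite]).  Let [p] be the invariant type attached to [A] and [c],
    and consider points [x] realizing [p] over small sets and the type of [c] over
    [A] ([gen]).  By relative algebraic boundedness and compactness, [f x] lies in
    a finite set [psi x] definable in the large structure [Mt] with parameters in [M]
    ([covers_exist]).  Choose [psi x] of least cardinality.  An automorphism over
    [A] fixing [e] maps it to another enclosing set of the same size, and by
    minimality the two agree on [p]: they cut out the same germ.  The code of
    [psi x] is a function of [x] whose germ is therefore fixed by all automorphisms
    over [A] fixing [e].  This germ is governed by elements which are internalized
    in [M].  If cofinally many of the resulting tuples were not in [A], a single
    automorphism over [A] fixing [e] would move them all ([move_all], which
    combines the finite lemma of Neumann with an ultrafilter limit) and would not
    fix the germ.  So almost all of them lie in [A], and every automorphism over
    [A] fixes the germ ([germ_fixed]).  Hence all conjugates of [f] over [A] take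
    at a generic point a value in the same finite set, and [f x] determines [e] up
    to finitely many choices.

    It follows that [e] is algebraic over a finite tuple of [A], which has finitely
    many conjugates over [e].  The finite set of these conjugates is coded in the
    large structure, and its code is internalized in [M] ([finite_code]): this is
    the tuple that was sought ([coordinate_step]). *)

(** * Contexts and tuples *)

Arguments env_cat {S F Gam Del} _ _ s _ : rename.
Arguments env_cons {S F s Gam} x rho s0 _ : rename.
Arguments env_map {S F G} f {Gam} rho s _ : rename.
Arguments env_sing {S F s} x s0 _ : rename.

Section Env.
Variables (S : Type).
Implicit Types (Gam Del Th : seq S).

Lemma var_nilP s (v : var (S := S) [::] s) : False.
Proof.
exact: (match v in var D _ return match D with [::] => False | _ => True end with
        | vz _ _ => I | vs _ _ _ _ => I end).
Qed.

Lemma var_cons_ind t Gam (P : forall s, var (t :: Gam) s -> Prop) :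
  P t vz -> (forall s (w : var Gam s), P s (vs w)) -> forall s v, P s v.
Proof.
move=> P0 PS s v.
refine (match v as v' in var D s' return
  match D as D' return var D' s' -> Prop with
  | [::] => fun _ => True
  | t' :: G' => fun v' => forall P : forall s, var (t' :: G') s -> Prop,
       P t' vz -> (forall s (w : var G' s), P s (vs w)) -> P s' v'
  end v' with vz _ _ => fun Q Q0 _ => Q0 | vs _ _ _ w => fun Q _ QS => QS _ w end P P0 PS).
Qed.

Fixpoint vl {Gam} Del {s} (v : var Gam s) : var (Gam ++ Del) s :=
  match v in var G s return var (G ++ Del) s with
  | vz _ _ => vz
  | vs _ _ _ w => vs (vl Del w)
  end.

Fixpoint vr Gam {Del s} (v : var Del s) : var (Gam ++ Del) s :=
  match Gam return var (Gam ++ Del) s with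
  | [::] => v
  | _ :: G => vs (vr G v)
  end.

Lemma var_cat_ind Gam Del (P : forall s, var (Gam ++ Del) s -> Prop) :
  (forall s (v : var Gam s), P s (vl Del v)) ->
  (forall s (v : var Del s), P s (vr Gam v)) -> forall s v, P s v.
Proof.
elim: Gam P => [|t Gam IH] P Pl Pr; first exact: Pr.
apply: var_cons_ind; first exact: (Pl t vz).
by move=> s w; apply: (IH (fun s w => P s (vs w))) => [s' v|s' v];
  [exact: (Pl s' (vs v))|exact: Pr].
Qed.

Variable F : S -> Type.

Lemma env_ext Gam (x y : env F Gam) : (forall s v, x s v = y s v) -> x = y.
Proof. by move=> xy; apply: functional_extensionality_dep => s; apply: funext => v. Qed.

Lemma env_nilP (x y : env F [::]) : x = y.
Proof. by apply: env_ext => s v; case: (var_nilP v). Qed.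

Definition envl {Gam Del} (rho : env F (Gam ++ Del)) : env F Gam :=
  fun s v => rho s (vl Del v).
Definition envr {Gam Del} (rho : env F (Gam ++ Del)) : env F Del :=
  fun s v => rho s (vr Gam v).

Arguments envl {Gam Del} rho s _ : rename.
Arguments envr {Gam Del} rho s _ : rename.

Lemma env_cat_vl Gam Del (x : env F Gam) (y : env F Del) s (v : var Gam s) :
  env_cat x y s (vl Del v) = x s v.
Proof.
elim: Gam x s v => [|t Gam IH] x s v; first by case: (var_nilP v).
move: s v; apply: var_cons_ind => [//|s w] /=; exact: (IH (fun t v => x t (vs v))).
Qed.

Lemma env_cat_vr Gam Del (x : env F Gam) (y : env F Del) s (v : var Del s) :
  env_cat x y s (vr Gam v) = y s v.
Proof. by elim: Gam x => [|t Gam IH] x //=; exact: (IH (fun t v => x t (vs v))). Qed.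

Lemma envlK Gam Del (x : env F Gam) (y : env F Del) : envl (env_cat x y) = x.
Proof. by apply: env_ext => s v; exact: env_cat_vl. Qed.

Lemma envrK Gam Del (x : env F Gam) (y : env F Del) : envr (env_cat x y) = y.
Proof. by apply: env_ext => s v; exact: env_cat_vr. Qed.

Lemma env_catK Gam Del (z : env F (Gam ++ Del)) : env_cat (envl z) (envr z) = z.
Proof.
apply: env_ext; apply: var_cat_ind => s v; first by rewrite env_cat_vl.
by rewrite env_cat_vr.
Qed.

Lemma env_singE s (x : env F [:: s]) : env_sing (x s vz) = x.
Proof.
apply: env_ext; apply: var_cons_ind => [//|t w]; by case: (var_nilP w).
Qed.

Lemma env_inhabited Gam : (forall s, inhabited (F s)) -> inhabited (env F Gam).
Proof.
move=> inh; elim: Gam => [|s Gam [a]]; first exact: (inhabits env_nil).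
by have [x] := inh s; exact: (inhabits (env_cons x a)).
Qed.

Lemma eq_existT s (x y : F s) : existT F s x = existT F s y -> x = y.
Proof.
move=> e; have: forall z : elt F, existT F s x = z -> forall h : s = projT1 z,
    eq_rect _ F x _ h = projT2 z.
  by move=> z <- /= h; rewrite (Prop_irrelevance h erefl).
by move=> /(_ _ e erefl).
Qed.

Lemma rng_cat Gam Del (x : env F Gam) (y : env F Del) C :
  (rng (env_cat x y) `<=` C) <-> (rng x `<=` C) /\ (rng y `<=` C).
Proof.
split=> [xyC|[xC yC] _ [s [v ->]]].
  split=> _ [s [v ->]]; apply: xyC; exists s.
    by exists (vl _ v); rewrite env_cat_vl.
  by exists (vr _ v); rewrite env_cat_vr.
move: s v; apply: var_cat_ind => s v; rewrite ?env_cat_vl ?env_cat_vr.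
  by apply: xC; exists s, v.
by apply: yC; exists s, v.
Qed.

Lemma rng_env Gam (x : env F Gam) s (v : var Gam s) : rng x (existT F s (x s v)).
Proof. by exists s, v. Qed.

End Env.

Arguments envl {S F Gam Del} rho s _ : rename.
Arguments envr {S F Gam Del} rho s _ : rename.

(** A renaming of variables is a tuple of variables, so that [env_cat] and
    [env_cons] also build renamings. *)
Definition vmap (S : Type) (Gam Del : seq S) := env (var Del) Gam.
Definition vlmap {S : Type} (Gam Del : seq S) : vmap Gam (Gam ++ Del) :=
  fun s v => vl Del v.
Definition vrmap {S : Type} (Gam Del : seq S) : vmap Del (Gam ++ Del) :=
  fun s v => vr Gam v.
Definition pull {S : Type} {F : S -> Type} {Gam Del : seq S} (h : vmap Gam Del)
  (rho : env F Del) : env F Gam := fun s v => rho s (h s v).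
Arguments pull {S F Gam Del} h rho s _ : rename.
Arguments vlmap {S} Gam Del s _ : rename.
Arguments vrmap {S} Gam Del s _ : rename.

Section Pull.
Variables (S : Type) (F : S -> Type).
Implicit Types (Gam Del Th : seq S).

Lemma pull_cat Gam Del Th (h : vmap Gam Th) (k : vmap Del Th) (rho : env F Th) :
  pull (env_cat h k) rho = env_cat (pull h rho) (pull k rho).
Proof.
apply: env_ext; apply: var_cat_ind => s v; rewrite /pull ?env_cat_vl //.
by rewrite !env_cat_vr.
Qed.

Lemma pull_vl Gam Del (rho : env F (Gam ++ Del)) : pull (vlmap Gam Del) rho = envl rho.
Proof. by []. Qed.
Lemma pull_vr Gam Del (rho : env F (Gam ++ Del)) : pull (vrmap Gam Del) rho = envr rho.
Proof. by []. Qed.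

(** Separates, in a list of parameters, those coming from [u] from those coming
    from [C], so that [u] can be moved while [C] stays fixed. *)
Lemma split_params Gam (u : env F Gam) (C : set (elt F)) Th (w : env F Th) :
  rng w `<=` C `|` rng u ->
  exists Th' (m : env F Th') (h : vmap Th (Gam ++ Th')),
    rng m `<=` C /\ w = pull h (env_cat u m).
Proof.
elim: Th w => [|t Th IH] w wC.
  exists [::], env_nil, (fun s v => match var_nilP v with end).
  by split=> [x [s [v _]]|]; [case: (var_nilP v)|exact: env_nilP].
have [|Th' [m [h [mC wE]]]] := IH (fun s v => w s (vs v)).
  by move=> _ [s [v ->]]; apply: wC; exists s, (vs v).
have wE' s v : w s (vs v) = env_cat u m s (h s v) by move: wE => /(congr1 (fun f => f s v)).
have [Cw|[s [v e]]] := wC _ (rng_env w vz); last first.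
  have ets : s = t := esym (congr1 (@projT1 _ _) e).
  subst s; exists Th', m, (env_cons (vl _ v) h); split=> //.
  apply: env_ext; apply: var_cons_ind => [|s v'] //=.
  by rewrite /pull /= env_cat_vl; exact: eq_existT.
pose k : vmap (Gam ++ Th') (Gam ++ t :: Th') :=
  env_cat (vlmap Gam (t :: Th')) (fun s v => vr Gam (vs v)).
have kE : pull k (env_cat u (env_cons (w t vz) m)) = env_cat u m.
  rewrite pull_cat; congr env_cat; first exact: envlK.
  by apply: env_ext => s v; rewrite /pull env_cat_vr.
exists (t :: Th'), (env_cons (w t vz) m), (env_cons (vr Gam vz) (fun s v => k s (h s v))).
split.
  by move=> _ [s [v ->]]; move: s v; apply: var_cons_ind => [//|s v] /=; apply: mC; exists s, v.
apply: env_ext; apply: var_cons_ind => [|s v]; rewrite /pull /=; first by rewrite env_cat_vr.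
by rewrite wE' -kE.
Qed.

Lemma env_map_cat (G : S -> Type) (f : forall s, F s -> G s) Gam Del
  (x : env F Gam) (y : env F Del) :
  env_map f (env_cat x y) = env_cat (env_map f x) (env_map f y).
Proof.
apply: env_ext; apply: var_cat_ind => s v; rewrite /env_map ?env_cat_vl //.
by rewrite !env_cat_vr.
Qed.

Lemma env_map_cons (G : S -> Type) (f : forall s, F s -> G s) t Gam
  (x : F t) (y : env F Gam) :
  env_map f (env_cons x y) = env_cons (f t x) (env_map f y).
Proof. by apply: env_ext; apply: var_cons_ind. Qed.

Lemma env_map_sing (G : S -> Type) (f : forall s, F s -> G s) t (x : F t) :
  env_map f (env_sing x) = env_sing (f t x).
Proof. by rewrite /env_sing env_map_cons; congr env_cons; exact: env_nilP. Qed.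

Lemma rng_sing t (x : F t) : rng (env_sing x) = [set existT F t x].
Proof.
apply/seteqP; split=> [_ [s [v ->]]|_ ->]; last by exists t, vz.
by move: s v; apply: var_cons_ind => // s v; case: (var_nilP v).
Qed.

Lemma rng_map (G : S -> Type) (f : forall s, F s -> G s) Gam (x : env F Gam) :
  rng (env_map f x) = elt_map f @` rng x.
Proof.
rewrite eqEsubset; split=> [_ [s [v ->]]|_ [_ [s [v ->]] <-]].
  by exists (existT F s (x s v)) => //; exists s, v.
by exists s, v.
Qed.

End Pull.

(** * Counting classes *)

(** Counting classes of an equivalence relation by a covering family makes sense
    in every type, and [atmostS] turns it into a first-order condition. *)
Definition atmost {T : Type} (E : T -> T -> Prop) (k : nat) (P : T -> Prop) : Prop :=
  exists z : nat -> T, forall x, P x -> exists2 i, i < k & E x (z i).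

Section Atmost.
Variables (T : Type) (E : T -> T -> Prop).
Implicit Types P Q : T -> Prop.

Lemma atmost_sub k P Q : (forall x, P x -> Q x) -> atmost E k Q -> atmost E k P.
Proof. by move=> PQ [z zP]; exists z => x /PQ/zP. Qed.

Lemma atmost0 P : inhabited T -> atmost E 0 P <-> forall x, ~ P x.
Proof.
move=> [t]; split=> [[z zP] x /zP[]//|nP].
by exists (fun=> t) => x /nP.
Qed.

Lemma atmostS k P : atmost E k.+1 P <-> exists x0, atmost E k (fun x => P x /\ ~ E x x0).
Proof.
split=> [[z zP]|[x0 [z zP]]].
  exists (z k), z => x [/zP[i]]; rewrite ltnS leq_eqVlt => /predU1P[->//|ik Ei _].
  by exists i.
exists (fun i => if i is i'.+1 then z i' else x0) => x Px.
have [Ex|nEx] := pselect (E x x0); first by exists 0.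
by have [//|i ik Ei] := zP x; exists i.+1.
Qed.

Lemma atmost_or k l P Q : atmost E k P -> atmost E l Q ->
  atmost E (k + l) (fun x => P x \/ Q x).
Proof.
move=> [z zP] [y yQ]; exists (fun i => if i < k then z i else y (i - k)) => x [/zP[i ik Ei]|/yQ[i il Ei]].
  by exists i; rewrite ?ik // ltn_addr.
by exists (k + i); rewrite ?ltn_add2l // ltnNge leq_addr /= addKn.
Qed.

Lemma atmost_bind (U : Type) (E' : U -> U -> Prop) k l (P : U -> Prop) (Q : U -> T -> Prop) :
  inhabited T ->
  atmost E' k P -> (forall u u' , E' u u' -> forall t, Q u t -> Q u' t) ->
  (forall u, atmost E l (Q u)) ->
  atmost E (k * l) (fun t => exists2 u, P u & Q u t).
Proof.
move=> [t0] [z zP] QE Ql; pose y u := projT1 (cid (Ql u)).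
have yP u t : Q u t -> exists2 i, i < l & E t (y u i) by rewrite /y; case: cid => w /=; apply.
exists (fun i => y (z (i %/ l)) (i %% l)) => t [u /zP[i ik /QE Eu] /Eu/yP[j jl Ej]].
exists (i * l + j).
  by rewrite (leq_trans (n := i.+1 * l)) // ?leq_pmul2r ?(leq_ltn_trans _ jl) // mulSn addnC ltn_add2r.
have l0 : 0 < l by exact: leq_ltn_trans jl.
by rewrite divnMDl // modnMDl divn_small // addn0 modn_small.
Qed.

(** The converse of [pigeonhole]; the covering family is chosen greedily. *)
Lemma atmost_pairwise k P : inhabited T -> (forall x, E x x) ->
  (forall x y, E x y -> E y x) ->
  (forall a : nat -> T, (forall i, i <= k -> P (a i)) ->
     exists i j, [/\ i < j, j <= k & E (a i) (a j)]) ->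
  atmost E k P.
Proof.
move=> [t0] Er Es; elim: k P => [|k IH] P Pk.
  apply/atmost0; first exact: (inhabits t0).
  by move=> x Px; have [//|i [j [ij]]] := Pk (fun=> x); rewrite leqn0 => /eqP j0; rewrite j0 in ij.
have [[x0 Px0]|nP] := pselect (exists x, P x); last first.
  by exists (fun=> t0) => x Px; case: nP; exists x.
apply/atmostS; exists x0; apply: IH => a aP.
have [|i [j [ij jk Eij]]] := Pk (fun i => if i is i'.+1 then a i' else x0).
  by case=> // i ik; apply (aP i ik).1.
case: i j ij jk Eij => [|i] [|j] // ij jk Eij.
  by have [_ []] := aP j jk; exact: Es.
by exists i, j.
Qed.

Lemma pigeonhole k P (a : nat -> T) : (forall x y z, E x z -> E y z -> E x y) ->
  atmost E k P -> (forall i, i <= k -> P (a i)) ->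
  exists i j, [/\ i < j, j <= k & E (a i) (a j)].
Proof.
move=> Et [z zP] aP.
have /choice[f fP] (i : 'I_k.+1) : exists j : 'I_k, E (a i) (z j).
  by have [j jk Ej] := zP _ (aP i (ltn_ord i)); exists (Ordinal jk).
have [/injectiveP/leq_card|/injectivePn[i [j ij fij]]] := boolP (injectiveb f).
  by rewrite !card_ord ltnn.
wlog lij : i j ij fij / i < j => [H|]; last first.
  exists i, j; split=> //; first by rewrite -ltnS ltn_ord.
  by apply: (Et _ _ _ (fP i)); rewrite fij; exact: fP.
have := ij; rewrite neq_ltn => /orP[|ji]; first exact: H.
by apply: (H j i) => //; rewrite eq_sym.
Qed.

End Atmost.

Lemma finite_atmost T (P : set T) : inhabited T -> finite_set P -> exists k, atmost eq k P.
Proof.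
case; elim/Peq: T => T in P *; move=> t /finite_seqP[s ->].
exists (size s), (nth t s) => x /= xs; exists (index x s); first by rewrite index_mem.
by rewrite nth_index.
Qed.
(** * Definability of predicates *)

Section Rename.
Variables (S : Type) (L : language S).
Implicit Types (Gam Del Th : seq S).

Fixpoint ren_term {Gam Del s} (h : vmap Gam Del) (t : term L Gam s) : term L Del s :=
  match t with
  | Var _ v => Var (h _ v)
  | App _ _ f a => App f (fun u w => ren_term h (a u w))
  end.

Definition liftv {Gam Del} t (h : vmap Gam Del) : vmap (t :: Gam) (t :: Del) :=
  env_cons vz (fun s v => vs (h s v)).

Arguments liftv {Gam Del} t h s _ : rename.

Fixpoint ren {Gam} (phi : formula L Gam) : forall Del, vmap Gam Del -> formula L Del :=
  match phi with
  | Bot _ => fun _ _ => Bot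
  | Eq _ _ t u => fun _ h => Eq (ren_term h t) (ren_term h u)
  | Rel _ _ R a => fun _ h => Rel R (fun s v => ren_term h (a s v))
  | Imp _ phi psi => fun _ h => Imp (ren phi h) (ren psi h)
  | All _ s phi => fun _ h => All s (ren phi (liftv s h))
  end.

Lemma eval_ren (M : structure L) Gam Del (h : vmap Gam Del) s (t : term L Gam s)
  (rho : env M Del) : eval rho (ren_term h t) = eval (pull h rho) t.
Proof.
elim: t => [//|D u f a IH] /=; congr (fint M f).
by apply: env_ext => x v; exact: IH.
Qed.

Lemma sat_ren (M : structure L) Gam (phi : formula L Gam) :
  forall Del (h : vmap Gam Del) (rho : env M Del),
    sat (ren phi h) rho <-> sat phi (pull h rho).
Proof.
elim: phi => {Gam} [Gam|Gam s t u|Gam D R a|Gam phi IH1 psi IH2|Gam s phi IH] Del h rho //=.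
- by rewrite !eval_ren.
- by have -> : (fun s v => eval rho (ren_term h (a s v))) =
    (fun s v => eval (pull h rho) (a s v)) by apply: env_ext => s v; exact: eval_ren.
- by rewrite IH1 IH2.
- have E x : pull (liftv s h) (env_cons x rho) = env_cons x (pull h rho).
    by apply: env_ext; apply: var_cons_ind.
  by split=> H x; have := H x; rewrite IH E.
Qed.

(* Quantifies over a whole tuple: contexts grow at the front, and the head of
   [Del] is the innermost variable. *)
Fixpoint alls {Del} : forall Gam, formula L (Del ++ Gam) -> formula L Gam :=
  match Del with
  | [::] => fun _ phi => phi
  | s :: D => fun _ phi => alls (Del := D) (All s phi)
  end.

Lemma sat_alls (M : structure L) Del Gam (phi : formula L (Del ++ Gam)) (rho : env M Gam) :
  sat (alls phi) rho <-> forall z : env M Del, sat phi (env_cat z rho).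
Proof.
elim: Del phi => [|s D IH] phi /=.
  by split=> [H z //|H]; exact: (H env_nil).
rewrite IH; split=> [H z|H z x]; first exact: H.
exact: (H (env_cons x z)).
Qed.

End Rename.
Arguments liftv {S Gam Del} t h s _ : rename.

(** [dprop C P]: a single formula, with parameters from [C i], defines [P i] in
    each structure [Ms i].  The family of all structures without parameters
    ([udef]) and a single structure with parameters ([definable]) are both
    instances, so that the closure properties need one proof. *)
Section Dprop.
Variables (S : Type) (L : language S) (I : Type) (Ms : I -> structure L).
Variable C : forall i, set (elt (Ms i)).
Arguments C : clear implicits.
Implicit Types (Gam Del Th : seq S).

Definition dprop Gam (P : forall i, env (Ms i) Gam -> Prop) : Prop :=
  exists Th (phi : formula L (Gam ++ Th)) (m : forall i, env (Ms i) Th),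
    (forall i, rng (m i) `<=` C i) /\
    forall i rho, sat phi (env_cat rho (m i)) <-> P i rho.

Definition dtup Gam Del (t : forall i, env (Ms i) Gam -> env (Ms i) Del) : Prop :=
  exists Th (h : vmap Del (Gam ++ Th)) (m : forall i, env (Ms i) Th),
    (forall i, rng (m i) `<=` C i) /\
    forall i rho, t i rho = pull h (env_cat rho (m i)).

Lemma dprop_ext Gam (P Q : forall i, env (Ms i) Gam -> Prop) :
  (forall i rho, P i rho <-> Q i rho) -> dprop P -> dprop Q.
Proof.
move=> PQ [Th [phi [m [mC E]]]]; exists Th, phi, m; split=> // i rho.
by rewrite E.
Qed.

Lemma dprop_False Gam : dprop (fun i (rho : env (Ms i) Gam) => False).
Proof. by exists [::], Bot, (fun i => env_nil); split=> // i x [s [v]]; case: (var_nilP v). Qed.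

Lemma dprop_imp Gam (P Q : forall i, env (Ms i) Gam -> Prop) :
  dprop P -> dprop Q -> dprop (fun i rho => P i rho -> Q i rho).
Proof.
move=> [T1 [p1 [m1 [C1 E1]]]] [T2 [p2 [m2 [C2 E2]]]].
pose h1 : vmap (Gam ++ T1) (Gam ++ (T1 ++ T2)) :=
  env_cat (vlmap Gam (T1 ++ T2)) (fun s v => vr Gam (vl T2 v)).
pose h2 : vmap (Gam ++ T2) (Gam ++ (T1 ++ T2)) :=
  env_cat (vlmap Gam (T1 ++ T2)) (fun s v => vr Gam (vr T1 v)).
exists (T1 ++ T2), (Imp (ren p1 h1) (ren p2 h2)), (fun i => env_cat (m1 i) (m2 i)).
split=> [i|i rho /=]; first by apply/rng_cat.
rewrite !sat_ren -E1 -E2 !pull_cat !pull_vl !envlK.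
have -> : pull (fun s (v : var T1 s) => vr Gam (vl T2 v)) (env_cat rho (env_cat (m1 i) (m2 i))) = m1 i.
  by apply: env_ext => s v; rewrite /pull env_cat_vr env_cat_vl.
have -> // : pull (fun s (v : var T2 s) => vr Gam (vr T1 v)) (env_cat rho (env_cat (m1 i) (m2 i))) = m2 i.
by apply: env_ext => s v; rewrite /pull !env_cat_vr.
Qed.

Lemma dprop_all Gam Del (P : forall i, env (Ms i) Gam -> env (Ms i) Del -> Prop) :
  dprop (fun i (rho : env (Ms i) (Del ++ Gam)) => P i (envr rho) (envl rho)) ->
  dprop (fun i rho => forall z, P i rho z).
Proof.
move=> [Th [phi [m [mC E]]]].
pose h : vmap ((Del ++ Gam) ++ Th) (Del ++ (Gam ++ Th)) :=
  env_cat (env_cat (vlmap Del (Gam ++ Th)) (fun s v => vr Del (vl Th v)))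
    (fun s v => vr Del (vr Gam v)).
exists Th, (alls (ren phi h)), m; split=> // i rho; rewrite sat_alls.
have hE z : pull h (env_cat z (env_cat rho (m i))) = env_cat (env_cat z rho) (m i).
  rewrite !pull_cat pull_vl envlK; congr (env_cat (env_cat _ _) _).
    by apply: env_ext => s v; rewrite /pull env_cat_vr env_cat_vl.
  by apply: env_ext => s v; rewrite /pull !env_cat_vr.
by split=> H z; have := H z; rewrite sat_ren hE E envlK envrK.
Qed.

Lemma dprop_sub Gam Del (P : forall i, env (Ms i) Del -> Prop)
  (t : forall i, env (Ms i) Gam -> env (Ms i) Del) :
  dprop P -> dtup t -> dprop (fun i rho => P i (t i rho)).
Proof.
move=> [T1 [phi [m1 [C1 E1]]]] [T2 [h [m2 [C2 E2]]]].
pose h2 : vmap (Gam ++ T2) (Gam ++ (T1 ++ T2)) :=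
  env_cat (vlmap Gam (T1 ++ T2)) (fun s v => vr Gam (vr T1 v)).
pose k : vmap (Del ++ T1) (Gam ++ (T1 ++ T2)) :=
  env_cat (fun s v => h2 s (h s v)) (fun s v => vr Gam (vl T2 v)).
exists (T1 ++ T2), (ren phi k), (fun i => env_cat (m1 i) (m2 i)); split=> [i|i rho].
  by apply/rng_cat.
rewrite sat_ren -E1 E2 pull_cat.
have h2E : pull h2 (env_cat rho (env_cat (m1 i) (m2 i))) = env_cat rho (m2 i).
  rewrite pull_cat pull_vl envlK; congr env_cat.
  by apply: env_ext => s v; rewrite /pull !env_cat_vr.
have -> : pull (fun s (v : var T1 s) => vr Gam (vl T2 v)) (env_cat rho (env_cat (m1 i) (m2 i))) = m1 i.
  by apply: env_ext => s v; rewrite /pull env_cat_vr env_cat_vl.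
by rewrite -h2E.
Qed.

Lemma dtup_id Gam : dtup (fun i (rho : env (Ms i) Gam) => rho).
Proof.
exists [::], (vlmap Gam [::]), (fun i => env_nil); split=> [i x [s [v]]|i rho].
  by case: (var_nilP v).
by rewrite pull_vl envlK.
Qed.

Lemma dtup_const Gam Del (m : forall i, env (Ms i) Del) :
  (forall i, rng (m i) `<=` C i) -> dtup (fun i (_ : env (Ms i) Gam) => m i).
Proof.
move=> mC; exists Del, (vrmap Gam Del), m; split=> // i rho.
by rewrite pull_vr envrK.
Qed.

Lemma dtup_pull Gam Del Th (h : vmap Th Del) (t : forall i, env (Ms i) Gam -> env (Ms i) Del) :
  dtup t -> dtup (fun i rho => pull h (t i rho)).
Proof.
move=> [T [k [m [mC E]]]]; exists T, (pull h k), m; split=> // i rho.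
by rewrite E.
Qed.

Lemma dtup_envl Gam Del Th (t : forall i, env (Ms i) Gam -> env (Ms i) (Del ++ Th)) :
  dtup t -> dtup (fun i rho => envl (t i rho)).
Proof. exact: (dtup_pull (vlmap Del Th)). Qed.

Lemma dtup_envr Gam Del Th (t : forall i, env (Ms i) Gam -> env (Ms i) (Del ++ Th)) :
  dtup t -> dtup (fun i rho => envr (t i rho)).
Proof. exact: (dtup_pull (vrmap Del Th)). Qed.

Lemma dtup_cat Gam Del Th (t : forall i, env (Ms i) Gam -> env (Ms i) Del)
  (u : forall i, env (Ms i) Gam -> env (Ms i) Th) :
  dtup t -> dtup u -> dtup (fun i rho => env_cat (t i rho) (u i rho)).
Proof.
move=> [T1 [h1 [m1 [C1 E1]]]] [T2 [h2 [m2 [C2 E2]]]].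
pose k1 : vmap (Gam ++ T1) (Gam ++ (T1 ++ T2)) :=
  env_cat (vlmap Gam (T1 ++ T2)) (fun s v => vr Gam (vl T2 v)).
pose k2 : vmap (Gam ++ T2) (Gam ++ (T1 ++ T2)) :=
  env_cat (vlmap Gam (T1 ++ T2)) (fun s v => vr Gam (vr T1 v)).
exists (T1 ++ T2), (env_cat (pull h1 k1) (pull h2 k2)), (fun i => env_cat (m1 i) (m2 i)).
split=> [i|i rho]; first by apply/rng_cat.
rewrite pull_cat E1 E2; set w := env_cat rho (env_cat _ _).
have e1 : pull k1 w = env_cat rho (m1 i).
  rewrite pull_cat pull_vl envlK; congr env_cat.
  by apply: env_ext => s v; rewrite /w /pull env_cat_vr env_cat_vl.
have e2 : pull k2 w = env_cat rho (m2 i).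
  rewrite pull_cat pull_vl envlK; congr env_cat.
  by apply: env_ext => s v; rewrite /w /pull !env_cat_vr.
by rewrite -e1 -e2.
Qed.

Lemma dprop_eqv Gam D1 D2 (t : forall i, env (Ms i) Gam -> env (Ms i) D1)
  (u : forall i, env (Ms i) Gam -> env (Ms i) D2) s (v : var D1 s) (w : var D2 s) :
  dtup t -> dtup u -> dprop (fun i rho => t i rho s v = u i rho s w).
Proof.
move=> dt du.
have dv : dprop (fun i (z : env (Ms i) (D1 ++ D2)) => envl z s v = envr z s w).
  exists [::], (Eq (Var (vl [::] (vl D2 v))) (Var (vl [::] (vr D1 w)))), (fun i => env_nil).
  by split=> [i x [? [v']]|i rho /=]; [case: (var_nilP v')|rewrite !env_cat_vl].
have := dprop_sub dv (dtup_cat dt du).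
by apply: dprop_ext => i rho; rewrite envlK envrK.
Qed.

Lemma dprop_not Gam (P : forall i, env (Ms i) Gam -> Prop) :
  dprop P -> dprop (fun i rho => ~ P i rho).
Proof. by move=> dP; apply: dprop_imp => //; exact: dprop_False. Qed.

Lemma dprop_and Gam (P Q : forall i, env (Ms i) Gam -> Prop) :
  dprop P -> dprop Q -> dprop (fun i rho => P i rho /\ Q i rho).
Proof.
move=> dP dQ; apply: (@dprop_ext _ (fun i rho => ~ (P i rho -> ~ Q i rho))).
  by move=> i rho; split=> [/not_implyP[p /contrapT]|[p q]]; [split|apply].
by apply: dprop_not; apply: dprop_imp => //; exact: dprop_not.
Qed.

Lemma dprop_or Gam (P Q : forall i, env (Ms i) Gam -> Prop) :
  dprop P -> dprop Q -> dprop (fun i rho => P i rho \/ Q i rho).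
Proof.
move=> dP dQ; apply: (@dprop_ext _ (fun i rho => ~ P i rho -> Q i rho)).
  by move=> i rho; split=> [H|[]//]; have [|/H] := pselect (P i rho); [left|right].
by apply: dprop_imp => //; exact: dprop_not.
Qed.

Lemma dprop_iff Gam (P Q : forall i, env (Ms i) Gam -> Prop) :
  dprop P -> dprop Q -> dprop (fun i rho => P i rho <-> Q i rho).
Proof. by move=> dP dQ; apply: dprop_and; exact: dprop_imp. Qed.

Lemma dprop_ex Gam Del (P : forall i, env (Ms i) Gam -> env (Ms i) Del -> Prop) :
  dprop (fun i (rho : env (Ms i) (Del ++ Gam)) => P i (envr rho) (envl rho)) ->
  dprop (fun i rho => exists z, P i rho z).
Proof.
move=> dP; apply: (@dprop_ext _ (fun i rho => ~ forall z, ~ P i rho z)).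
  by move=> i rho; split=> [/existsNP[z /contrapT]|[z Pz] /(_ z)//]; exists z.
by apply: dprop_not; apply: dprop_all; exact: dprop_not.
Qed.

Lemma dprop_eq Gam Del (t u : forall i, env (Ms i) Gam -> env (Ms i) Del) :
  dtup t -> dtup u -> dprop (fun i rho => t i rho = u i rho).
Proof.
elim: Del t u => [|s D IH] t u dt du.
  apply: (@dprop_ext _ (fun i rho => ~ False)) => [i rho|]; last first.
    by apply: dprop_not; exact: dprop_False.
  by split=> _; [exact: env_nilP|case].
pose tl i (z : env (Ms i) (s :: D)) : env (Ms i) D := pull (fun s v => vs v) z.
apply: (@dprop_ext _ (fun i rho => t i rho s vz = u i rho s vz /\
                                   tl i (t i rho) = tl i (u i rho))).
  move=> i rho; split=> [[e0 e1]|->//]; apply: env_ext; apply: var_cons_ind => // s' v.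
  by move: e1 => /(congr1 (fun f => f s' v)).
apply: dprop_and; first exact: dprop_eqv.
by apply: IH; apply: dtup_pull.
Qed.

Lemma dprop_app2 Gam D1 D2 (R : forall i, env (Ms i) D1 -> env (Ms i) D2 -> Prop)
  (t : forall i, env (Ms i) Gam -> env (Ms i) D1) (u : forall i, env (Ms i) Gam -> env (Ms i) D2) :
  dprop (fun i (rho : env (Ms i) (D1 ++ D2)) => R i (envl rho) (envr rho)) ->
  dtup t -> dtup u -> dprop (fun i rho => R i (t i rho) (u i rho)).
Proof.
move=> dR dt du; have := dprop_sub dR (dtup_cat dt du).
by apply: dprop_ext => i rho; rewrite envlK envrK.
Qed.

Lemma dprop_atmost Gam Del (E : forall i, env (Ms i) Del -> env (Ms i) Del -> Prop) k
  (Q : forall i, env (Ms i) Gam -> env (Ms i) Del -> Prop) :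
  (forall i, inhabited (env (Ms i) Del)) ->
  dprop (fun i (rho : env (Ms i) (Del ++ Del)) => E i (envl rho) (envr rho)) ->
  dprop (fun i (rho : env (Ms i) (Del ++ Gam)) => Q i (envr rho) (envl rho)) ->
  dprop (fun i rho => atmost (E i) k (Q i rho)).
Proof.
move=> inh dE; elim: k Gam Q => [|k IH] Gam Q dQ.
  apply: (@dprop_ext _ (fun i rho => forall z, ~ Q i rho z)).
    by move=> i rho; rewrite atmost0.
  by apply: dprop_all; exact: dprop_not.
apply: (@dprop_ext _ (fun i rho => exists x0, atmost (E i) k (fun x => Q i rho x /\ ~ E i x x0))).
  by move=> i rho; rewrite atmostS.
apply: dprop_ex; apply: (IH _ (fun i rho x => Q i (envr rho) x /\ ~ E i x (envl rho))).
apply: dprop_and.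
  apply: (dprop_app2 (R := fun i x r => Q i r x)) => //; first exact/dtup_envl/dtup_id.
  exact/dtup_envr/dtup_envr/dtup_id.
apply: dprop_not; apply: dprop_app2 => //; first exact/dtup_envl/dtup_id.
exact/dtup_envl/dtup_envr/dtup_id.
Qed.

End Dprop.

Section Udef.
Variables (S : Type) (L : language S).
Implicit Types (Gam Del Th : seq S).

Definition udef Gam (P : forall N : structure L, env N Gam -> Prop) : Prop :=
  dprop (Ms := id) (fun N => set0) P.
Definition udef2 G1 G2 (P : forall N : structure L, env N G1 -> env N G2 -> Prop) : Prop :=
  udef (fun N (r : env N (G1 ++ G2)) => P N (envl r) (envr r)).
Definition udef3 G1 G2 G3
  (P : forall N : structure L, env N G1 -> env N G2 -> env N G3 -> Prop) : Prop :=
  udef2 (fun N (x : env N G1) (r : env N (G2 ++ G3)) => P N x (envl r) (envr r)).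

Section Instance.
Variables (I : Type) (Ms : I -> structure L) (C : forall i, set (elt (Ms i))).

Lemma udef_inst Gam (P : forall N : structure L, env N Gam -> Prop) :
  udef P -> dprop C (fun i => P (Ms i)).
Proof.
move=> [Th [phi [m [mC E]]]]; exists Th, phi, (fun i => m (Ms i)); split=> [i|i rho].
  by move=> x /mC.
exact: E.
Qed.

Lemma udef_app Gam Del (P : forall N : structure L, env N Del -> Prop)
  (t : forall i, env (Ms i) Gam -> env (Ms i) Del) :
  udef P -> dtup C t -> dprop C (fun i rho => P (Ms i) (t i rho)).
Proof. by move=> /udef_inst; exact: dprop_sub. Qed.

Lemma udef2_app Gam D1 D2 (P : forall N : structure L, env N D1 -> env N D2 -> Prop)
  (t : forall i, env (Ms i) Gam -> env (Ms i) D1) (u : forall i, env (Ms i) Gam -> env (Ms i) D2) :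
  udef2 P -> dtup C t -> dtup C u -> dprop C (fun i rho => P (Ms i) (t i rho) (u i rho)).
Proof. by move=> dP; apply: (dprop_app2 (R := fun i => P (Ms i))); exact: (udef_inst dP). Qed.

Lemma udef3_app Gam D1 D2 D3
  (P : forall N : structure L, env N D1 -> env N D2 -> env N D3 -> Prop)
  (t : forall i, env (Ms i) Gam -> env (Ms i) D1) (u : forall i, env (Ms i) Gam -> env (Ms i) D2)
  (w : forall i, env (Ms i) Gam -> env (Ms i) D3) :
  udef3 P -> dtup C t -> dtup C u -> dtup C w ->
  dprop C (fun i rho => P (Ms i) (t i rho) (u i rho) (w i rho)).
Proof.
move=> dP dt du dw; have := udef2_app (P := fun N x (r : env N (D2 ++ D3)) => P N x (envl r) (envr r))
  dP dt (dtup_cat du dw).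
by apply: dprop_ext => i rho; rewrite envlK envrK.
Qed.

End Instance.

Lemma udef_form Gam (P : forall N : structure L, env N Gam -> Prop) :
  inhabited (structure L) -> udef P ->
  exists phi : formula L Gam, forall N rho, sat (M := N) phi rho <-> P N rho.
Proof.
move=> [N0] [Th [phi [m [mC E]]]].
case: Th phi m mC E => [|t Th] phi m mC E; last by case: (mC N0 _ (rng_env _ vz)).
pose h : vmap (Gam ++ [::]) Gam := env_cat (fun s v => v) (fun s v => match var_nilP v with end).
exists (ren phi h) => N rho; rewrite sat_ren -E.
have -> // : pull h rho = env_cat rho (m N).
by rewrite pull_cat; congr env_cat; exact: env_nilP.
Qed.

Lemma form_udef Gam (phi : formula L Gam) : udef (fun N rho => sat (M := N) phi rho).
Proof.
exists [::], (ren phi (vlmap Gam [::])), (fun N => env_nil); split=> [N x [s [v]]|N rho].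
  by case: (var_nilP v).
by rewrite sat_ren pull_vl envlK.
Qed.

Lemma form_udef2 G1 G2 (phi : formula L (G1 ++ G2)) :
  udef2 (fun N x y => sat (M := N) phi (env_cat x y)).
Proof.
by apply: dprop_ext (form_udef phi) => N rho; rewrite env_catK.
Qed.

Lemma definableP (M : structure L) (C : set (elt M)) Gam (X : set (env M Gam)) :
  definable C X <-> dprop (Ms := fun _ : unit => M) (fun _ => C) (fun _ => X).
Proof.
split=> [[[Th phi m] [mC ->]]|[Th [phi [m [mC E]]]]].
  by exists Th, phi, (fun _ => m).
exists (PFormula phi (m tt)); split; first exact: mC.
by apply/seteqP; split=> rho; rewrite /psat /= E.
Qed.

(** Exposes the parameters of a definable set: automorphisms and elementary maps
    move them, while the relation stays the same. *)
Lemma definable_fibre (M : structure L) (C : set (elt M)) Gam (X : set (env M Gam)) :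
  definable C X <-> exists Th (P : forall N : structure L, env N Gam -> env N Th -> Prop) m,
    [/\ udef2 P, rng m `<=` C & X = [set x | P M x m]].
Proof.
split=> [[[Th phi m] [mC ->]]|[Th [P [m [dP mC ->]]]]].
  by exists Th, (fun N x y => sat (M := N) phi (env_cat x y)), m; split=> //; exact: form_udef2.
apply/definableP; apply: (udef2_app dP); first exact: dtup_id.
exact: (dtup_const (C := fun=> C)).
Qed.

Lemma udef2_definable (M : structure L) (C : set (elt M)) Gam Th
  (Q : forall N : structure L, env N Gam -> env N Th -> Prop) (w : env M Th) :
  udef2 Q -> rng w `<=` C -> definable C [set x | Q M x w].
Proof. by move=> dQ wC; apply/definable_fibre; exists Th, Q, w. Qed.

End Udef.


(** Solves [dtup] goals by following the structure of the tuple. *)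
Ltac dt := repeat first
  [ exact: dtup_id
  | lazymatch goal with
    | |- dtup _ (fun _ _ => envl _) => refine (dtup_envl _)
    | |- dtup _ (fun _ _ => envr _) => refine (dtup_envr _)
    | |- dtup _ (fun _ => envl) => refine (dtup_envl (dtup_id _ _))
    | |- dtup _ (fun _ => envr) => refine (dtup_envr (dtup_id _ _))
    end
  | apply: dtup_cat | apply: dtup_pull
  | apply: (@dtup_cat _ _ _ _ _ _ [:: _] _) | solve [apply: dtup_const => // ] ].
(** * Automorphisms *)

Section Maps.
Variables (S : Type) (L : language S).
Implicit Types (M N : structure L) (Gam Del : seq S).

Lemma eval_embedding M N (f : forall s, M s -> N s) Gam s (t : term L Gam s) (rho : env M Gam) :
  embedding f -> eval (env_map f rho) t = f s (eval rho t).
Proof.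
move=> [_ fF _]; elim: t => [//|D u g a IH] /=; rewrite fF; congr (fint N g).
by apply: env_ext => x v; exact: IH.
Qed.

Lemma sat_qfree M N (f : forall s, M s -> N s) Gam (phi : formula L Gam) (rho : env M Gam) :
  embedding f -> qfree phi -> sat phi rho <-> sat phi (env_map f rho).
Proof.
move=> fe; elim: phi rho => {Gam} [Gam|Gam s t u|Gam D R a|Gam phi IH1 psi IH2|//] rho //=.
- by rewrite !eval_embedding //; split=> [->//|]; case: fe => fi _ _; exact: fi.
- move=> _; have [_ _ fR] := fe; rewrite fR.
  have -> // : env_map f (fun s v => eval rho (a s v)) = fun s v => eval (env_map f rho) (a s v).
  by apply: env_ext => s v; rewrite eval_embedding.
- by move=> [q1 q2]; rewrite IH1 // IH2.
Qed.

Lemma aut_elementary M (f : forall s, M s -> M s) : automorphism f -> elementary f.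
Proof.
move=> [fe fb] Gam phi; elim: phi => {Gam} [Gam|Gam s t u|Gam D R a|Gam phi IH1 psi IH2|Gam s phi IH] rho.
- by [].
- exact: (sat_qfree (phi := Eq t u)).
- exact: (sat_qfree (phi := Rel R a)).
- by rewrite /= IH1 IH2.
- split=> /= H x; last by apply/IH; rewrite env_map_cons.
  have [g _ fg] := fb s.
  by have := H (g x); rewrite IH env_map_cons fg.
Qed.

Lemma sat_lift (L1 : language S) (i : sublanguage L1 L) M Gam (phi : formula L1 Gam) (rho : env M Gam) :
  sat (M := M) (Defs.lift i phi) rho <-> sat (M := reduct i M) phi rho.
Proof.
have ev Gam' (r : env M Gam') s (t : term L1 Gam' s) :
    eval (M := M) r (lift_term i t) = eval (M := reduct i M) r t.
  elim: t => [//|D u g a IH] /=; congr (fint M _).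
  by apply: env_ext => x v; exact: IH.
elim: phi rho => {Gam} [Gam|Gam s t u|Gam D R a|Gam phi IH1 psi IH2|Gam s phi IH] rho //=.
- by rewrite !ev.
- by have -> : (fun s v => eval (M := M) rho (lift_term i (a s v))) =
    (fun s v => eval (M := reduct i M) rho (a s v)) by apply: env_ext => s v; exact: ev.
- by rewrite IH1 IH2.
- by split=> H x; apply/IH; exact: H.
Qed.

Lemma env_map_comp (F G H : S -> Type) (g : forall s, G s -> H s) (f : forall s, F s -> G s)
  Gam (x : env F Gam) : env_map g (env_map f x) = env_map (fun s y => g s (f s y)) x.
Proof. by []. Qed.

Lemma aut_id M : automorphism (fun s (x : M s) => x).
Proof. by split; [split=> // Gam R rho|move=> s; exists id]. Qed.

Lemma aut_comp M (f g : forall s, M s -> M s) : automorphism f -> automorphism g ->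
  automorphism (fun s x => f s (g s x)).
Proof.
move=> [[fi ff fr] fb] [[gi gf gr] gb]; split; first split.
- by move=> s x y /fi/gi.
- by move=> Gam s F rho; rewrite gf ff env_map_comp.
- by move=> Gam R rho; rewrite gr fr env_map_comp.
- by move=> s; exact: (bij_comp (fb s) (gb s)).
Qed.

Lemma aut_inv M (f : forall s, M s -> M s) : automorphism f ->
  exists g : forall s, M s -> M s,
    [/\ automorphism g, forall s x, g s (f s x) = x & forall s x, f s (g s x) = x].
Proof.
move=> [[fi ff fr] fb].
have fb' s : exists g, cancel (f s) g /\ cancel g (f s) by have [g fg gf] := fb s; exists g.
pose g s := projT1 (cid (fb' s)).
have fg s : cancel (f s) (g s) by rewrite /g; case: cid => ? [].
have gf s : cancel (g s) (f s) by rewrite /g; case: cid => ? [].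
have gfm Gam (rho : env M Gam) : env_map f (env_map g rho) = rho.
  by apply: env_ext => s v; exact: gf.
exists g; split=> //; split; first split.
- by move=> s; exact: (can_inj (gf s)).
- by move=> Gam s F rho; apply: (fi s); rewrite gf ff gfm.
- by move=> Gam R rho; rewrite [X in _ <-> X]fr gfm.
- by move=> s; exists (f s).
Qed.

Lemma udef_elementary Gam (P : forall N : structure L, env N Gam -> Prop) M N
  (f : forall s, M s -> N s) (x : env M Gam) :
  udef P -> elementary f -> P M x <-> P N (env_map f x).
Proof.
by move=> /(udef_form (inhabits M))[phi E] fe; rewrite -!E; exact: fe.
Qed.

Lemma udef2_elementary G1 G2 (P : forall N : structure L, env N G1 -> env N G2 -> Prop) M N
  (f : forall s, M s -> N s) (x : env M G1) (y : env M G2) :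
  udef2 P -> elementary f -> P M x y <-> P N (env_map f x) (env_map f y).
Proof.
move=> dP fe; have := udef_elementary (env_cat x y) dP fe.
by rewrite env_map_cat !envlK !envrK.
Qed.

Lemma udef3_elementary G1 G2 G3
  (P : forall N : structure L, env N G1 -> env N G2 -> env N G3 -> Prop) M N
  (f : forall s, M s -> N s) (x : env M G1) (y : env M G2) (z : env M G3) :
  udef3 P -> elementary f -> P M x y z <-> P N (env_map f x) (env_map f y) (env_map f z).
Proof.
move=> dP fe; have := udef2_elementary (P := fun N x (r : env N (G2 ++ G3)) => P N x (envl r) (envr r))
  x (env_cat y z) dP fe.
by rewrite env_map_cat !envlK !envrK.
Qed.

Lemma fixesE M (f : forall s, M s -> M s) s (x : M s) : fixes f (existT M s x) <-> f s x = x.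
Proof. by rewrite /fixes /elt_map /=; split=> [e|->//]; exact: (eq_existT e). Qed.

Lemma fixes_env M (f : forall s, M s -> M s) Gam (x : env M Gam) :
  (forall y, rng x y -> fixes f y) <-> env_map f x = x.
Proof.
split=> [H|H _ [s [v ->]]].
  by apply: env_ext => s v; apply/fixesE/H/rng_env.
by apply/fixesE; rewrite -[in RHS]H.
Qed.

Lemma aut_over_env M C (f : forall s, M s -> M s) Gam (x : env M Gam) :
  aut_over C f -> rng x `<=` C -> env_map f x = x.
Proof. by move=> [_ fC] xC; apply/fixes_env => y /xC/fC. Qed.

Lemma aut_over_comp M C (f g : forall s, M s -> M s) : aut_over C f -> aut_over C g ->
  aut_over C (fun s x => f s (g s x)).
Proof.
move=> [fa fC] [ga gC]; split=> [|[s x] Cx]; first exact: aut_comp.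
apply/fixesE; have /fixesE-> := gC _ Cx; exact/fixesE/fC.
Qed.

Lemma aut_over_inv M C (f : forall s, M s -> M s) : aut_over C f ->
  exists g : forall s, M s -> M s,
    [/\ aut_over C g, forall s x, g s (f s x) = x & forall s x, f s (g s x) = x].
Proof.
move=> [/aut_inv[g [ga gf fg]] fC]; exists g; split=> //; split=> // -[s x] Cx.
by apply/fixesE; rewrite -[in LHS](proj1 (fixesE _ _) (fC _ Cx)).
Qed.

Lemma definable_aut M C (f : forall s, M s -> M s) Gam (X : set (env M Gam)) x :
  definable C X -> aut_over C f -> X (env_map f x) <-> X x.
Proof.
move=> /definable_fibre[Th [P [m [dP mC ->]]]] fC /=.
rewrite (udef2_elementary x m dP (aut_elementary fC.1)).
by rewrite (aut_over_env fC mC).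
Qed.

Lemma definable_sub M (C D : set (elt M)) Gam (X : set (env M Gam)) :
  C `<=` D -> definable C X -> definable D X.
Proof. by move=> CD [phi [pC ->]]; exists phi; split=> // x /pC/CD. Qed.

End Maps.

(** * Sets of cardinality at most that of the language *)

Section Small.
Variables (S : Type) (L : language S).
Implicit Types (Gam Del : seq S).

Definition codes := {Gam : seq S & formula L Gam}.

Fixpoint clo Gam : formula L Gam -> formula L [::] :=
  match Gam with
  | [::] => id
  | s :: D => fun phi => clo (All s phi)
  end.

(** Removing as many quantifiers as [Gam] is long recovers both [Gam] and the
    formula from its universal closure. *)
Fixpoint strip (n : nat) Gam (phi : formula L Gam) : codes :=
  match n with
  | 0 => existT _ Gam phi
  | n'.+1 => match phi with
      | All G s psi => strip n' psi
      | psi => existT _ Gam phi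
      end
  end.

Lemma strip_clo Gam (phi : formula L Gam) k : strip (size Gam + k) (clo phi) = strip k phi.
Proof.
elim: Gam phi k => [//|s D IH] phi k.
by rewrite [size _]/= addSnnS IH.
Qed.

Fixpoint tag (n : nat) : formula L [::] := if n is n'.+1 then Imp Bot (tag n') else Bot.
Fixpoint untag Gam (phi : formula L Gam) : nat :=
  if phi is Imp _ _ psi then (untag psi).+1 else 0.

Lemma tagK n : untag (tag n) = n.
Proof. by elim: n => //= n ->. Qed.

Definition code_pair (a b : codes) : codes :=
  existT _ [::] (Imp (tag (size (projT1 a))) (Imp (clo (projT2 a))
    (Imp (tag (size (projT1 b))) (clo (projT2 b))))).

Definition decode_pair (k : codes) : option (codes * codes) :=
  match projT2 k with
  | Imp _ n p => match p with
    | Imp _ a q => match q with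
      | Imp _ m b => Some (strip (untag n) a, strip (untag m) b)
      | _ => None end
    | _ => None end
  | _ => None end.

Lemma code_pairK a b : decode_pair (code_pair a b) = Some (a, b).
Proof.
case: a b => [G p] [H q]; rewrite /decode_pair /= !tagK.
by rewrite -[size G]addn0 -[size H]addn0 !strip_clo.
Qed.

(** Enumeration by formulas replaces cardinal arithmetic: since [code_pair] codes
    two formulas by one, small sets are closed under small unions and under
    finite tuples. *)
Definition small T (A : set T) : Prop :=
  exists g : codes -> option T, forall x, A x -> exists k, g k = Some x.

Lemma small_card_le T (A : set T) : small A -> card_le_lang L A.
Proof.
move=> [g gP]; have [[x0 Ax0]|nA] := pselect (exists x, A x); last first.
  have -> : A = set0 by apply/seteqP; split=> // x Ax; case: nA; exists x.
  exact: card_ge0.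
apply: (@card_le_trans _ _ _ ((fun k => odflt x0 (g k)) @` [set: codes])); last exact: card_image_le.
by apply: subset_card_le => x /gP[k gk]; exists k => //; rewrite gk.
Qed.

Lemma small_sub T (A B : set T) : A `<=` B -> small B -> small A.
Proof. by move=> AB [g gP]; exists g => x /AB/gP. Qed.

Lemma small_codes : small [set: codes].
Proof. by exists Some => x _; exists x. Qed.

Lemma small_image T U (f : T -> U) (A : set T) : small A -> small (f @` A).
Proof.
move=> [g gP]; exists (fun k => omap f (g k)) => _ [x /gP[k gk] <-].
by exists k; rewrite gk.
Qed.

Lemma small_preimage T U (f : T -> U) (A : set U) : injective f -> small A -> small (f @^-1` A).
Proof.
move=> fi [g gP].
exists (fun k => if pselect (exists x, g k = Some (f x)) is left e then Some (projT1 (cid e)) else None).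
move=> x /gP[k gk]; exists k; case: pselect => [e|[]]; last by exists x.
by congr Some; case: cid => y /= ; rewrite gk => -[/fi].
Qed.

Lemma small_bigcup T U (D : set T) (F : T -> set U) :
  small D -> (forall x, D x -> small (F x)) -> small (\bigcup_(x in D) F x).
Proof.
move=> [d dP] FS.
have /choice[g gP] (x : T) : exists g : codes -> option U,
    D x -> forall y, F x y -> exists k, g k = Some y.
  have [Dx|nDx] := pselect (D x); last by exists (fun=> None).
  by have [g gP] := FS _ Dx; exists g.
exists (fun k => if decode_pair k is Some (a, b) then
   if d a is Some x then g x b else None else None).
move=> y [x Dx Fxy]; have [a da] := dP _ Dx; have [b gb] := gP _ Dx _ Fxy.
by exists (code_pair a b); rewrite code_pairK da.
Qed.

Lemma small_nat : small [set: nat].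
Proof.
exists (fun k => Some (untag (projT2 k))) => n _; exists (existT _ [::] (tag n)).
by rewrite /= tagK.
Qed.

Lemma small_finite T (A : set T) : finite_set A -> small A.
Proof.
move=> Af; have [[x0 Ax0]|nA] := pselect (exists x, A x); last first.
  by exists (fun=> None) => x Ax; case: nA; exists x.
have [k [z zP]] := finite_atmost (inhabits x0) Af.
by apply: small_sub (small_image z small_nat) => x /zP[i _ ->]; exists i.
Qed.

Lemma smallU T (A B : set T) : small A -> small B -> small (A `|` B).
Proof.
move=> sA sB; have : small (\bigcup_(n in [set: nat]) if n is 0 then A else B).
  by apply: small_bigcup => [|[]]; first exact: small_nat.
by apply: small_sub => x [Ax|Bx]; [exists 0|exists 1].
Qed.

Lemma small_env (F : S -> Type) (C : set (elt F)) Gam : small C ->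
  small [set m : env F Gam | rng m `<=` C].
Proof.
move=> sC; elim: Gam => [|s D IH].
  by exists (fun=> Some env_nil) => x _; exists (existT _ [::] Bot); congr Some; exact: env_nilP.
have sCs : small [set x : F s | C (existT F s x)].
  by apply: (small_preimage (f := fun x => existT F s x)) => // x y e; exact: (eq_existT e).
have : small (\bigcup_(x in [set x : F s | C (existT F s x)])
    ((fun m => env_cons x m) @` [set m : env F D | rng m `<=` C])).
  by apply: small_bigcup => // x _; exact: small_image.
apply: small_sub => m mC; exists (m s vz); first exact/mC/rng_env.
exists (fun s v => m s (vs v)).
  by move=> _ [t [v ->]]; exact/mC/rng_env.
by apply: env_ext; apply: var_cons_ind.
Qed.

Lemma small_rng (F : S -> Type) Gam (m : env F Gam) : small (rng m).
Proof.
elim: Gam m => [|s D IH] m; first by exists (fun=> None) => x [s [v]]; case: (var_nilP v).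
have : small ([set existT F s (m s vz)] `|` rng (fun t (v : var D t) => m t (vs v))).
  by apply: smallU; [exact/small_finite/finite_set1|exact: IH].
apply: small_sub => _ [t [v ->]]; move: t v.
by apply: var_cons_ind => [|t v]; [left|right; exists t, v].
Qed.

(** An algebraic element is found from a formula, a tuple of parameters, and its
    place in a finite set. *)
Lemma small_acl (M : structure L) (C : set (elt M)) : small C -> small (acl C).
Proof.
move=> sC.
pose fib (k : codes) : set (elt M) :=
  match k with
  | existT (s :: Th) phi => \bigcup_(m in [set m : env M Th | rng m `<=` C])
      [set x | finite_set [set y | sat phi (env_cons y m)] /\
               exists2 y, x = existT M s y & sat phi (env_cons y m)]
  | _ => set0
  end.
have : small (\bigcup_(k in [set: codes]) fib k).
  apply: small_bigcup => [|[[|s Th] phi] _]; first exact: small_codes.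
    exact/small_finite/finite_set0.
  apply: small_bigcup => [|m _]; first exact: small_env.
  have [fin|nfin] := pselect (finite_set [set y | sat phi (env_cons y m)]); last first.
    by apply: (@small_sub _ _ set0) => [x []//|]; exact/small_finite/finite_set0.
  apply: small_finite; apply: sub_finite_set (finite_image (existT M s) fin).
  by move=> x [_ [y -> yP]]; exists y.
apply: small_sub => -[s x] [X [[[Th phi m] [mC XE]] Xf Xx]].
exists (existT _ (s :: Th) phi) => //=; exists m => //; split; last first.
  by exists x => //; move: Xx; rewrite XE.
apply: sub_finite_set (finite_image (fun z : env M [:: s] => z s vz) Xf).
by move=> y yP; exists (env_sing y); rewrite ?XE.
Qed.

End Small.
Arguments small {S} L {T} A.

(** * Saturation and homogeneity *)

(** Inductive, so that compactness arguments combine formulas one at a time. *)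
Inductive finmeet {T : Type} (F : set (set T)) : set T -> Prop :=
| finmeet0 : finmeet F setT
| finmeetS X Y : F X -> finmeet F Y -> finmeet F (X `&` Y).

Lemma finmeet_setI T (F : set (set T)) X Y : finmeet F X -> finmeet F Y -> finmeet F (X `&` Y).
Proof.
elim=> [|A B FA _ IH] FY; first by rewrite setTI.
by rewrite -setIA; apply: finmeetS => //; exact: IH.
Qed.

Lemma finmeet1 T (F : set (set T)) X : F X -> finmeet F X.
Proof. by move=> FX; rewrite -[X]setIT; apply: finmeetS => //; exact: finmeet0. Qed.

Lemma finmeet_ultra T (F : set (set T)) : (forall Y, finmeet F Y -> Y !=set0) ->
  exists U : set_system T, UltraFilter U /\ F `<=` U.
Proof.
move=> F0; have : ProperFilter [set Z | exists2 Y, finmeet F Y & Y `<=` Z].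
  split=> [[Y /F0[x Yx] /(_ x)]|]; first exact.
  split=> [|P Q [Y FY YP] [Z FZ ZQ]|P Q PQ [Y FY YP]].
  - by exists setT => //; exact: finmeet0.
  - by exists (Y `&` Z); [exact: finmeet_setI|move=> x [/YP ? /ZQ]].
  - by exists Y => // x /YP/PQ.
move=> /ultraFilterLemma[U [UU FU]]; exists U; split=> // X FX.
by apply: FU; exists X => //; exact: finmeet1.
Qed.

Lemma filter_finite T J (U : set_system T) (D : set J) (F : J -> set T) :
  Filter U -> finite_set D -> (forall j, D j -> U (F j)) -> U (\bigcap_(j in D) F j).
Proof.
move=> UF Dfin DU; have [[j0 Dj0]|nD] := pselect (exists j, D j); last first.
  by apply: filterS filterT => x _ j Dj; case: nD; exists j.
have [k [z zP]] := finite_atmost (inhabits j0) Dfin.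
suff : U [set x | forall i, i < k -> D (z i) -> F (z i) x].
  by apply: filterS => x H j Dj; have [i ik e] := zP _ Dj; rewrite e; apply: H; rewrite -?e.
elim: k {zP} => [|k IH]; first by apply: filterS filterT.
have [Dk|nDk] := pselect (D (z k)).
  apply: filterS (filterI IH (DU _ Dk)) => x [H Fx] i.
  by rewrite ltnS leq_eqVlt => /predU1P[->|/H].
by apply: filterS IH => x H i; rewrite ltnS leq_eqVlt => /predU1P[->|/H].
Qed.

Section Saturation.
Variables (S : Type) (L : language S) (M : structure L).
Hypotheses (M_sat : saturated M) (M_hom : homogeneous M).
Implicit Types (Gam Del : seq S) (C : set (elt M)).

Lemma definable_not C Gam (X : set (env M Gam)) : definable C X -> definable C (~` X).
Proof. by move=> /definableP dX; apply/definableP; exact: dprop_not. Qed.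

Lemma definable_and C Gam (X Y : set (env M Gam)) :
  definable C X -> definable C Y -> definable C (X `&` Y).
Proof. by move=> /definableP dX /definableP dY; apply/definableP; exact: dprop_and. Qed.

(** A family of definable sets with the finite intersection property is
    completed to a type by means of an ultrafilter. *)
Lemma saturation C Gam (F : set (set (env M Gam))) : small L C ->
  (forall X, F X -> definable C X) -> (forall Y, finmeet F Y -> Y !=set0) ->
  exists x, forall X, F X -> X x.
Proof.
move=> sC Fdef /finmeet_ultra[U [UU FU]].
pose p := [set phi : pformula M Gam | Defs.over C phi /\ U (psat phi)].
have tp : is_type C p.
  split=> [phi []//|G Gf Gp|phi Cphi].
    have : U (\bigcap_(phi in G) psat phi).
      by apply: filter_finite => // phi /Gp[].
    by move=> /filter_ex[x xP]; exists x.
  have [Up|Unp] := in_ultra_setVsetC (psat phi) UU; first by left.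
  by right; split.
have [x xp] := M_sat (small_card_le sC) tp.
exists x => X FX; have [phi [Cphi XE]] := Fdef _ FX.
by rewrite XE; apply: xp; split=> //; rewrite -XE; exact: FU.
Qed.

(** The map fixing [C] and sending [u] to [u'] is well defined and elementary
    because the two tuples have the same type over [C]. *)
Lemma conjugate C Th (u u' : env M Th) : small L C ->
  (forall X, definable C X -> X u -> X u') ->
  exists2 f : forall s, M s -> M s, aut_over C f & env_map f u = u'.
Proof.
move=> sC uu'.
have ex s (x : M s) : exists y : M s,
   (forall (v : var Th s), x = u s v -> y = u' s v) /\ (C (existT M s x) -> y = x).
  have [[v xv]|nv] := pselect (exists v : var Th s, x = u s v); last first.
    by exists x; split=> // v xv; case: nv; exists v.
  exists (u' s v); split=> [w xw|Cx].
    have := uu' [set z | z s v = z s w]; apply=> /=; last by rewrite -xv.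
    apply/definableP; apply: (dprop_eqv (t := fun=> id) (u := fun=> id)); exact: dtup_id.
  have := uu' [set z | z s v = env_sing x s vz]; apply=> //.
  apply/definableP; apply: (dprop_eqv (t := fun=> id) (u := fun _ _ => env_sing x)).
    exact: dtup_id.
  apply: (dtup_const (C := fun=> C)) => _ _ [t [w ->]].
  by move: t w; apply: var_cons_ind => // t w; case: (var_nilP w).
pose f s x := projT1 (cid (ex s x)).
have fu : env_map f u = u'.
  by apply: env_ext => s v; rewrite /env_map /f; case: cid => y [yP _] /=; exact: yP.
have fC x : C x -> elt_map f x = x.
  case: x => s x Cx; rewrite /elt_map /=; congr existT.
  by rewrite /f; case: cid => y [_] /=; exact.
have fCe Gam (m : env M Gam) : rng m `<=` C -> env_map f m = m.
  move=> mC; apply: env_ext => s v; have := fC _ (mC _ (rng_env m v)); exact: eq_existT.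
have sCu : small L (C `|` rng u) by apply: smallU => //; exact: small_rng.
have [|g ga gf] := M_hom (small_card_le sCu) (f := f).
- move=> Gam phi rho /split_params[Th' [m [h [mC ->]]]].
  have -> : env_map f (pull h (env_cat u m)) = pull h (env_cat u' m).
    by rewrite -[LHS]/(pull h (env_map f _)) env_map_cat fu fCe.
  have imp (psi : formula L Gam) : sat psi (pull h (env_cat u m)) -> sat psi (pull h (env_cat u' m)).
    apply: (uu' [set z | sat psi (pull h (env_cat z m))]).
    apply/definableP; apply: (udef_app (form_udef psi)).
    apply: dtup_pull; apply: dtup_cat; first exact: dtup_id.
    exact: (dtup_const (C := fun=> C)).
  split; first exact: imp.
  by apply: contraPP => /(imp (neg phi)).
have gE Gam (m : env M Gam) : rng m `<=` C `|` rng u -> env_map g m = env_map f m.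
  move=> mC; apply: env_ext => s v; have := gf _ (mC _ (rng_env m v)); exact: eq_existT.
exists g; last by rewrite gE // => x; right.
by split=> // x Cx; rewrite /fixes gf ?fC //; left.
Qed.

(** Otherwise the type of [u] over [C] would be consistent with the complement of
    [Psi], and a realization would be a conjugate of [u] outside [Psi].  This is
    how statements about automorphisms are turned into formulas. *)
Lemma isolate C Th (u : env M Th) (Psi : set (env M Th)) : small L C ->
  definable setT Psi ->
  (forall f, aut_over C f -> Psi (env_map f u)) ->
  exists chi, [/\ definable C chi, chi u & chi `<=` Psi].
Proof.
move=> sC [psi [_ PE]] conj.
pose F := [set X | (definable C X /\ X u) \/ X = ~` Psi].
have [//|nchi] := pselect (exists chi, [/\ definable C chi, chi u & chi `<=` Psi]).
have FI Y : finmeet F Y -> exists chi, [/\ definable C chi, chi u & chi `&` ~` Psi `<=` Y].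
  elim=> [|X Z FX _ [chi [dchi chiu chiZ]]].
    exists setT; split=> //; apply/definableP; apply: dprop_ext (dprop_not (dprop_False _ Th)).
    by move=> i rho; split=> // _ [].
  case: FX => [[dX Xu]|->].
    exists (X `&` chi); split=> //; first exact: definable_and.
    by move=> x [[Xx chix] Px]; split=> //; exact: chiZ.
  by exists chi; split=> // x [chix Px]; split=> //; exact: chiZ.
have [|||x xF] := @saturation (C `|` rng (pval psi)) _ F.
- by apply: smallU => //; exact: small_rng.
- move=> X [[dX _]|->].
    by apply: definable_sub dX => y; left.
  apply: definable_not; rewrite PE; exists psi; split=> // y yp; by right.
- move=> Y /FI[chi [dchi chiu chiY]].
  have [x [chix nPx]] : exists x, chi x /\ ~ Psi x.
    apply: contrapT => nx; apply: nchi; exists chi; split=> // x chix.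
    by apply: contrapT => nPx; apply: nx; exists x.
  by exists x; apply: chiY; split.
have [X dX Xu|f fC fu] := @conjugate C _ u x sC; first by apply: xF; left.
by have := xF _ (or_intror erefl); rewrite -fu; case; exact: conj.
Qed.

Lemma finite_orbit_acl C s (x : M s) k : small L C ->
  atmost eq k [set y | exists2 f, aut_over C f & y = f s x] -> acl C (existT M s x).
Proof.
move=> sC [z zP].
pose Psi := [set y : env M [:: s] | exists2 i, i < k & y = env_sing (z i)].
have [|f fC|chi [dchi chix chiP]] := @isolate C _ (env_sing x) Psi sC.
- apply/definableP; rewrite /Psi; elim: k {zP Psi} => [|k IH].
    by apply: dprop_ext (dprop_False _ _) => i y; split=> // -[].
  apply: (@dprop_ext _ _ _ _ _ _ (fun _ y => (exists2 i, i < k & y = env_sing (z i)) \/ y = env_sing (z k))).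
    move=> _ y; split=> [[[i ik yi]|yk]|[i]]; first by exists i => //; exact: ltnW.
      by exists k.
    by rewrite ltnS leq_eqVlt => /predU1P[->|ik yi]; [right|left; exists i].
  apply: dprop_or => //; apply: dprop_eq; first exact: dtup_id.
  exact: dtup_const.
- have [|i ik e] := zP (f s x); first by exists f.
  exists i => //; rewrite -e; apply: env_ext; apply: var_cons_ind => // t w.
  by case: (var_nilP w).
- exists chi; split=> //=.
  apply: (@sub_finite_set _ _ ((fun i => env_sing (z i)) @` `I_k)).
    by move=> y /chiP[i ik ->]; exists i.
  exact/finite_image/finite_II.
Qed.

End Saturation.
(** * Small elementary submodels *)

Section LowenheimSkolem.
Variables (S : Type) (L : language S) (M : structure L).
Implicit Types (Gam Del : seq S) (C : set (elt M)).

Lemma witness_exists s Gam (phi : formula L (s :: Gam)) (rho : env M Gam) :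
  exists x : M s, (exists y, sat phi (env_cons y rho)) -> sat phi (env_cons x rho).
Proof.
have [[y yP]|ny] := pselect (exists y, sat phi (env_cons y rho)); first by exists y.
by have [x] := carrier_inhabited M s; exists x.
Qed.

Definition witness s Gam (phi : formula L (s :: Gam)) (rho : env M Gam) : M s :=
  projT1 (cid (witness_exists phi rho)).

Lemma witnessP s Gam (phi : formula L (s :: Gam)) (rho : env M Gam) y :
  sat phi (env_cons y rho) -> sat phi (env_cons (witness phi rho) rho).
Proof. by move=> yP; rewrite /witness; case: cid => x /=; apply; exists y. Qed.

Definition witnesses (B : set (elt M)) (k : codes L) : set (elt M) :=
  match k with
  | existT (s :: Gam) phi =>
      (fun rho => existT M s (witness phi rho)) @` [set rho : env M Gam | rng rho `<=` B]
  | _ => set0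
  end.

(** Closing under witnesses of existential formulas makes the union of the stages
    an elementary substructure (Tarski-Vaught). *)
Fixpoint hull C (n : nat) : set (elt M) :=
  if n is n'.+1 then hull C n' `|` \bigcup_(k in [set: codes L]) witnesses (hull C n') k else C.

Lemma small_hull C n : small L C -> small L (hull C n).
Proof.
move=> sC; elim: n => //= n IH; apply: smallU => //.
apply: small_bigcup => [|[[|s Gam] phi] _]; first exact: small_codes.
  exact/small_finite/finite_set0.
by apply: small_image; exact: small_env.
Qed.

Lemma hull_tuple C Gam (rho : env M Gam) :
  rng rho `<=` \bigcup_(n in [set: nat]) hull C n -> exists n, rng rho `<=` hull C n.
Proof.
have mono m n : m <= n -> hull C m `<=` hull C n.
  by move=> /subnKC <-; elim: (n - m) => [|k IH]; rewrite ?addn0 // addnS => x /IH; left.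
elim: Gam rho => [|s Gam IH] rho rC; first by exists 0 => x [s [v]]; case: (var_nilP v).
have [|m mP] := IH (fun s v => rho s (vs v)).
  by move=> _ [t [v ->]]; exact/rC/rng_env.
have [n _ nP] := rC _ (rng_env rho vz).
exists (maxn m n) => _ [t [v ->]]; move: t v; apply: var_cons_ind => [|t v].
  exact: mono (leq_maxr m n) _ nP.
by apply: (mono _ _ (leq_maxl m n)); apply: mP; exists t, v.
Qed.

Theorem lowenheim_skolem C : small L C ->
  exists (M' : structure L) (j : forall s, M' s -> M s),
    [/\ elementary j, C `<=` range (elt_map j) & small L (range (elt_map j))].
Proof.
move=> sC; pose B := \bigcup_(n in [set: nat]) hull C n.
have BW s Gam (phi : formula L (s :: Gam)) rho : rng rho `<=` B -> B (existT M s (witness phi rho)).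
  move=> /hull_tuple[n rn]; exists n.+1 => //; right; exists (existT _ (s :: Gam) phi) => //.
  by exists rho.
have sB : small L B by apply: small_bigcup => [|n _]; [exact: small_nat|exact: small_hull].
pose car s := {x : M s | B (existT M s x)}.
pose j s (x : car s) : M s := sval x.
have jB Gam (rho : env car Gam) : rng (env_map j rho) `<=` B.
  by move=> _ [s [v ->]]; rewrite /env_map /j; case: (rho s v).
have inh s : inhabited (car s).
  have : B (existT M s (witness (Imp Bot Bot) (env_nil (F := M)))).
    by apply: BW => x [t [v]]; case: (var_nilP v).
  by move=> Bw; apply: (inhabits (exist (fun x => B (existT M s x)) _ Bw)).
have Bf Gam s (F : func L Gam s) rho : rng rho `<=` B -> B (existT M s (fint M F rho)).
  move=> rB; have := BW _ _ (Eq (Var vz) (App F (fun t v => Var (vs v)))) _ rB.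
  by have /= -> := @witnessP _ _ (Eq (Var vz) (App F (fun t v => Var (vs v)))) rho (fint M F rho) erefl.
pose M' := @Structure S L car inh
  (fun Gam s F rho => exist (fun x => B (existT M s x)) (fint M F (env_map j rho)) (Bf _ _ F _ (jB _ rho)))
  (fun Gam R rho => rint M R (env_map j rho)).
have je : @embedding S L M' M j.
  split=> // s [x Bx] [y By]; rewrite /j /= => xy; subst y.
  by rewrite (Prop_irrelevance Bx By).
exists M', j; split.
- move=> Gam phi; elim: phi => {Gam} [Gam|Gam s t u|Gam D R a|Gam phi IH1 psi IH2|Gam s phi IH] rho.
  + by [].
  + exact: (sat_qfree (phi := Eq t u)).
  + exact: (sat_qfree (phi := Rel R a)).
  + by rewrite /= IH1 IH2.
  split=> /= H x; last by apply/IH; rewrite env_map_cons.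
  apply: contrapT => nx.
  have /= := @witnessP _ _ (neg phi) (env_map j rho) x nx; apply.
  pose y : M' s := exist (fun x => B (existT M s x)) _ (BW _ _ (neg phi) _ (jB _ rho)).
  by have := H y; rewrite IH env_map_cons.
- move=> [s x] Cx; have Bx : B (existT M s x) by exists 0.
  by exists (existT M' s (exist _ x Bx)).
- by apply: small_sub sB => _ [[s [x Bx]] _ <-].
Qed.

End LowenheimSkolem.

(** * Moving many elements at once *)

(** Neumann's lemma.  Suppose that every element of the group sends some [b i]
    into [D i].  The elements with a given value [c] at [b n] are a translate of
    those with a given value outside [D n], and these send another [b i] into
    [D i].  So [b n] can be dropped at the price of enlarging the other [D i]. *)
Lemma neumann T (G : set (T -> T)) :
  (forall f g, G f -> G g -> G (f \o g)) ->
  (forall f, G f -> exists2 g, G g & cancel f g /\ cancel g f) ->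
  G id -> forall n (b : nat -> T) (D : nat -> set T),
  (forall i, i < n -> ~ finite_set [set y | exists2 f, G f & y = f (b i)]) ->
  (forall i, i < n -> finite_set (D i)) ->
  exists2 f, G f & forall i, i < n -> ~ D i (f (b i)).
Proof.
move=> Gc Gi G1; elim=> [|n IH] b D binf Dfin; first by exists id.
have [g Gg gD] : exists2 g, G g & ~ D n (g (b n)).
  apply: contrapT => ng; apply: (binf n) => //; apply: sub_finite_set (Dfin n _) => //.
  by move=> _ [f Gf ->]; apply: contrapT => nD; apply: ng; exists f.
have [g' Gg' [gg' g'g]] := Gi _ Gg.
apply: contrapT => nf.
have /choice[h hP] (c : T) : exists h, (exists2 f, G f & c = f (b n)) -> G h /\ c = h (b n).
  by have [[f Gf cf]|nc] := pselect (exists2 f, G f & c = f (b n)); [exists f|exists id].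
pose D' i := D i `|` \bigcup_(c in D n) ((h c \o g') @` D i).
have [||f Gf fD] := IH b D'.
- by move=> i ?; apply: binf; exact: ltnW.
- move=> i iln; have Di := Dfin i (ltnW iln); rewrite finite_setU; split=> //.
  by apply: bigcup_finite => [|c _]; [exact: Dfin|exact: finite_image].
apply: (nf); exists f => // i; rewrite ltnS leq_eqVlt => /predU1P[->{i}|iln Df]; last first.
  by apply: (fD i iln); left.
move=> Dfn; have [Gh hE] : G (h (f (b n))) /\ f (b n) = h (f (b n)) (b n).
  by apply: hP; exists f.
have [h' Gh' [hh' h'h]] := Gi _ Gh.
apply: nf; exists (g \o (h' \o f)); first by apply: (Gc) => //; exact: Gc.
move=> i; rewrite ltnS leq_eqVlt => /predU1P[->|iln] /=; first by rewrite hE hh'.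
move=> Dy; apply: (fD i iln); right; exists (f (b n)) => //.
by exists (g (h' (f (b i)))) => //=; rewrite gg' h'h.
Qed.

Section MoveAll.
Variables (S : Type) (L : language S) (M : structure L).
Hypotheses (M_sat : saturated M) (M_hom : homogeneous M).
Implicit Types (Gam Del : seq S) (C : set (elt M)).

Let W := forall s, M s -> M s.

(** Tuples are finite, hence contained in one member of a chain. *)
Lemma rng_bigcup (F : S -> Type) Gam (z : env F Gam) (G : set (set (elt F))) :
  total_on G subset -> rng z `<=` \bigcup_(X in G) X ->
  Gam = [::] \/ exists2 X, G X & rng z `<=` X.
Proof.
move=> Gtot; elim: Gam z => [|s Gam IH] z zG; first by left.
right; have [X GX Xz] := zG _ (rng_env z vz).
have [|G0|[Y GY Yz]] := IH (fun s v => z s (vs v)).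
- by move=> _ [t [v ->]]; exact/zG/rng_env.
- subst Gam; exists X => // _ [t [v ->]]; move: t v; apply: var_cons_ind => // t v.
  by case: (var_nilP v).
have [XY|YX] := Gtot _ _ GX GY; [exists Y|exists X] => // _ [t [v ->]]; move: t v;
  apply: var_cons_ind => [|t v] //.
- exact: XY.
- by apply: Yz; exists t, v.
- by apply: YX; apply: Yz; exists t, v.
Qed.

(** The limit of a family of automorphisms along an ultrafilter, on a small
    set: the values are chosen one at a time, each realizing the limit of the
    types of its images. *)
Lemma ultra_limit (U : set_system W) (C : set (elt M)) : UltraFilter U ->
  U (@automorphism S L M) -> small L C ->
  exists2 tau : W, automorphism tau &
    forall G1 G2 (m : env M G1) (w : env M G2) (P : forall N : structure L, env N G1 -> env N G2 -> Prop),
      rng m `<=` C -> rng w `<=` C -> udef2 P ->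
      U [set f : W | P M (env_map f m) w] -> P M (env_map tau m) w.
Proof.
move=> UU Uaut sC.
pose MM s : Type := (M s * M s)%type.
pose p1 s (x : MM s) := x.1; pose p2 s (x : MM s) := x.2.
(* Partial solutions are sets of pairs (element, value), so that unions of chains
   are unions of sets. *)
pose good (G : set (elt MM)) := (forall s x, G (existT MM s x) -> C (existT M s x.1)) /\
  forall G1 G2 (z : env MM G1) (w : env M G2) (P : forall N : structure L, env N G1 -> env N G2 -> Prop),
    rng z `<=` G -> rng w `<=` C -> udef2 P ->
    U [set f : W | P M (env_map f (env_map p1 z)) w] -> P M (env_map p2 z) w.
have [G [[GC GP] Gmax]] : exists G, good G /\ forall G', G `<` G' -> ~ good G'.
  apply: Zorn_bigcup => F Fgood Ftot; split=> [s x [X FX Xx]|G1 G2 z w P zF wC dP UP].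
    exact: (Fgood _ FX).1 Xx.
  have [G10|[X FX Xz]] := rng_bigcup Ftot zF; last exact: (Fgood _ FX).2 UP.
  subst G1; have /filter_ex[f] := UP.
  by congr (P M _ w); exact: env_nilP.
have Gfun s x y y' : G (existT MM s (x, y)) -> G (existT MM s (x, y')) -> y = y'.
  move=> Gy Gy'; pose z : env MM [:: s; s] := env_cons (x, y) (env_cons (x, y') env_nil).
  have := GP _ _ z (env_nil (F := M)) (fun N u _ => u s vz = u s (vs vz)); apply.
  - move=> _ [t [v ->]]; move: t v; apply: var_cons_ind => //; apply: var_cons_ind => // t v.
    by case: (var_nilP v).
  - by move=> x' [t [v]]; case: (var_nilP v).
  - by apply: (dprop_eqv (t := fun _ r => envl r) (u := fun _ r => envl r)); dt.
  - by apply: filterS filterT => f.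
have Gtot s x : C (existT M s x) -> exists y, G (existT MM s (x, y)).
  move=> Cx; apply: contrapT => nG.
  pose R := [set y | exists s (x y' : M s), G (existT MM s (x, y')) /\ y = existT M s y'].
  have sR : small L R.
    pose f (x : elt M) := existT M (projT1 x)
      (if pselect (exists y, G (existT MM (projT1 x) (projT2 x, y))) is left e
       then projT1 (cid e) else projT2 x).
    apply: small_sub (small_image f sC) => _ [t [u [u' [Gu ->]]]].
    exists (existT M t u); first exact: GC Gu.
    rewrite /f /=; case: pselect => [e|[]]; last by exists u'.
    by congr existT; case: cid => v /= Gv; exact: Gfun Gv Gu.
  pose F := [set X | exists G1 G2 (z : env MM G1) (w : env M G2)
     (P : forall N : structure L, env N [:: s] -> env N G1 -> env N G2 -> Prop),
     [/\ rng z `<=` G, rng w `<=` C, udef3 P,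
       U [set f : W | P M (env_map f (env_sing x)) (env_map f (env_map p1 z)) w] &
       X = [set y | P M y (env_map p2 z) w]]].
  have FI (Y : set (env M [:: s])) : finmeet F Y -> exists2 X, F X & X `<=` Y.
    elim=> [|X Z FX _ [X' FX' XZ]].
      exists setT => //; exists [::], [::], env_nil, env_nil, (fun _ _ _ _ => ~ False); split.
      - by move=> ? [t [v]]; case: (var_nilP v).
      - by move=> ? [t [v]]; case: (var_nilP v).
      - by apply: dprop_not; exact: dprop_False.
      - by apply: filterS filterT => f _ [].
      - by apply/seteqP; split=> // y _ [].
    have [G1 [G2 [z [w [P [zG wC dP UP XE]]]]]] := FX.
    have [G1' [G2' [z' [w' [P' [zG' wC' dP' UP' XE']]]]]] := FX'.
    exists (X `&` X'); last by move=> y [Xy /XZ].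
    exists (G1 ++ G1'), (G2 ++ G2'), (env_cat z z'), (env_cat w w'),
      (fun N y u v => P N y (envl u) (envl v) /\ P' N y (envr u) (envr v)); split.
    - exact/rng_cat.
    - exact/rng_cat.
    - by apply: dprop_and; apply: udef3_app => //; dt.
    - rewrite !env_map_cat !envlK !envrK; apply: filterS (filterI UP UP') => f.
      by rewrite /= env_map_cat envlK envrK.
    - by rewrite !env_map_cat !envlK !envrK XE XE'.
  have [|||y yF] := @saturation _ _ M M_sat (R `|` C) _ F.
  - exact: smallU.
  - move=> X [G1 [G2 [z [w [P [zG wC dP _ ->]]]]]]; apply/definableP.
    have zR : rng (env_map p2 z) `<=` R.
      move=> _ [t [v ->]]; exists t, (z t v).1, (z t v).2; split=> //.
      by rewrite -surjective_pairing; exact/zG/rng_env.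
    apply: (udef3_app dP); first exact: dtup_id.
      by apply: (dtup_const (C := fun=> R `|` C)) => _ y /zR; left.
    by apply: (dtup_const (C := fun=> R `|` C)) => _ y /wC; right.
  - move=> Y /FI[X [G1 [G2 [z [w [P [zG wC dP UP ->]]]]]] XY].
    have [y yP] : exists y, P M y (env_map p2 z) w.
      apply: (GP _ _ z w (fun N u v => exists y, P N y u v)) => //.
        by apply: dprop_ex; apply: (udef3_app dP); dt.
      by apply: filterS UP => f fP; exists (env_map f (env_sing x)).
    by exists y; exact: XY.
  pose G' := G `|` [set existT MM s (x, y s vz)].
  apply: (Gmax G'); first split.
  - by move=> z Gz; left.
  - move=> G'G; apply: nG; exists (y s vz); apply: G'G; by right.
  split=> [t u [/GC//|e]|G1 G2 z w P zG' wC dP UP].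
    have ets := congr1 (@projT1 _ _) e; simpl in ets; subst t.
    by rewrite (eq_existT e).
  have [|Th [z0 [h [z0G zE]]]] := @split_params _ MM [:: s] (env_sing (x, y s vz)) G _ z.
    move=> u /zG'[|->]; first by left.
    right; exact: (rng_env (env_sing (F := MM) (x, y s vz)) vz).
  have zE1 : env_map p1 z = pull h (env_cat (env_sing x) (env_map p1 z0)).
    by rewrite zE -[LHS]/(pull h (env_map p1 _)) env_map_cat env_map_sing.
  have zE2 : env_map p2 z = pull h (env_cat y (env_map p2 z0)).
    by rewrite zE -[LHS]/(pull h (env_map p2 _)) env_map_cat env_map_sing env_singE.
  rewrite zE2; apply: (yF [set y | P M (pull h (env_cat y (env_map p2 z0))) w]).
  exists Th, G2, z0, w, (fun N y u v => P N (pull h (env_cat y u)) v); split=> //.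
    by apply: (udef2_app dP); dt.
  apply: filterS UP => f /=.
  by rewrite zE1 -[env_map f (pull h _)]/(pull h (env_map f _)) env_map_cat.
pose f0 s x := if pselect (exists y, G (existT MM s (x, y))) is left e then projT1 (cid e) else x.
have f0G s x : C (existT M s x) -> G (existT MM s (x, f0 s x)).
  by move=> /Gtot e; rewrite /f0; case: pselect => // e'; case: cid.
have f0P G1 G2 (m : env M G1) (w : env M G2) (P : forall N : structure L, env N G1 -> env N G2 -> Prop) :
    rng m `<=` C -> rng w `<=` C -> udef2 P ->
    U [set f : W | P M (env_map f m) w] -> P M (env_map f0 m) w.
  move=> mC wC dP UP; apply: (GP _ _ (fun s v => (m s v, f0 s (m s v))) w P) => //.
  by move=> _ [s [v ->]]; exact/f0G/mC/rng_env.
have f0sat Gam (phi : formula L Gam) (rho : env M Gam) : rng rho `<=` C ->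
    sat phi rho -> sat phi (env_map f0 rho).
  move=> rC phir; apply: (f0P _ [::] rho env_nil (fun N u _ => sat phi u)) => //.
  - by move=> x [s [v]]; case: (var_nilP v).
  - by apply: (udef_app (form_udef phi)); dt.
  - by apply: filterS Uaut => f fa; apply/(aut_elementary fa phi rho).
have [|tau ta tf] := M_hom (small_card_le sC) (f := f0).
  move=> Gam phi rho rC; split; first exact: f0sat.
  by apply: contraPP => /(f0sat _ (neg phi) _ rC).
exists tau => // G1 G2 m w P mC wC dP UP.
have -> : env_map tau m = env_map f0 m; last exact: f0P UP.
by apply: env_ext => s v; have := tf _ (mC _ (rng_env m v)) => e; exact: (eq_existT e).
Qed.

(** In a group of automorphisms, compactness turns Neumann's lemma for finitely
    many points into one for a small set of points with infinite orbits. *)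
Theorem move_all (H : set W) (C D : set (elt M)) :
  H `<=` @automorphism S L M -> H (fun s x => x) ->
  (forall f g : W, H f -> H g -> H (fun s x => f s (g s x))) ->
  (forall f : W, H f -> exists2 g : W, H g &
     forall s x, g s (f s x) = x /\ f s (g s x) = x) ->
  small L C -> D `<=` C ->
  (forall d, D d -> ~ finite_set [set elt_map f d | f in H]) ->
  exists tau : W, [/\ automorphism tau,
    forall G1 G2 (m : env M G1) (w : env M G2) (P : forall N : structure L, env N G1 -> env N G2 -> Prop),
      rng m `<=` C -> rng w `<=` C -> udef2 P ->
      (forall f, H f -> P M (env_map f m) w) -> P M (env_map tau m) w &
    forall d, D d -> ~ fixes tau d].
Proof.
move=> Haut H1 Hc Hi sC DC Dinf.
have [[d0 Dd0]|nD] := pselect (exists d, D d); last first.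
  exists (fun s x => x); split=> [|G1 G2 m w P _ _ _ /(_ _ H1)//|d Dd]; first exact: aut_id.
  by case: nD; exists d.
pose F := [set X : set W | X = H \/ exists2 d, D d & X = [set f | ~ fixes f d]].
have FI (Y : set W) : finmeet F Y -> exists n (b : nat -> elt M), (forall i, i < n -> D (b i)) /\
    forall f, H f -> (forall i, i < n -> ~ fixes f (b i)) -> Y f.
  elim=> [|X Z [->|[d Dd ->]] _ [n [b [bD bZ]]]].
  - by exists 0, (fun=> d0).
  - by exists n, b; split=> // f Hf fb; split=> //; exact: bZ.
  exists n.+1, (fun i => if i == n then d else b i); split=> [i|f Hf fb].
    by rewrite ltnS leq_eqVlt; case: eqP => //= _; exact: bD.
  split; first by have := fb n (ltnSn n); rewrite eqxx.
  by apply: bZ => // i iln; have := fb i (ltnW iln); rewrite ltn_eqF.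
have [|U [UU FU]] := @finmeet_ultra _ F.
  move=> Y /FI[n [b [bD bY]]].
  have [|||i iln|i _|_ [f Hf <-] fb] := @neumann _ [set elt_map f | f in H] _ _ _ n b (fun i => [set b i]).
  - by move=> _ _ [f Hf <-] [g Hg <-]; exists (fun s x => f s (g s x)); first exact: Hc.
  - move=> _ [f Hf <-]; have [g Hg gf] := Hi _ Hf; exists (elt_map g); first by exists g.
    by split=> -[s x]; rewrite /elt_map /=; congr existT; have [] := gf s x.
  - by exists (fun s x => x) => //; apply: funext => -[s x].
  - move=> fin; apply: (Dinf _ (bD _ iln)); apply: sub_finite_set fin.
    by move=> _ [f Hf <-]; exists (elt_map f) => //; exists f.
  - exact: finite_set1.
  - by exists f; exact: bY.
have UH : U H by apply: FU; left.
have [tau ta tauP] := ultra_limit UU (filterS Haut UH) sC.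
exists tau; split=> // [G1 G2 m w P mC wC dP HP|[s x] Dd].
  by apply: tauP => //; exact: filterS UH.
have dC : rng (env_sing (F := M) x) `<=` C by rewrite rng_sing => _ ->; exact: DC.
move/fixesE => fx.
have := tauP _ _ (env_sing x) (env_sing x) (fun N u v => u s vz <> v s vz); apply=> //.
  by apply: dprop_not; apply: (dprop_eqv (t := fun _ r => envl r) (u := fun _ r => envr r)); dt.
apply: filterS (FU _ (or_intror (ex_intro2 _ _ _ Dd erefl))) => f fd e; apply: fd.
exact/fixesE.
Qed.

End MoveAll.
(** * Types and germs *)

Section Ultrapower.
Variables (S : Type) (L : language S) (M : structure L) (X : Type) (U : set_system X).
Hypothesis UU : UltraFilter U.
Implicit Types (Gam Del : seq S).

Definition ucar s : Type := {P : set (X -> M s) | exists f, P = [set g | U [set x | f x = g x]]}.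
Definition ucls s (f : X -> M s) : ucar s := exist _ _ (ex_intro _ f erefl).

Lemma uclsP s (f g : X -> M s) : ucls f = ucls g <-> U [set x | f x = g x].
Proof.
split=> [e|Ufg].
  by have : sval (ucls f) g by rewrite e /=; apply: filterS filterT.
rewrite /ucls; apply: eq_exist => /=; apply/seteqP; split=> h /= Uh.
  by apply: filterS (filterI Ufg Uh) => x [/= <- <-].
by apply: filterS (filterI Ufg Uh) => x [/= -> <-].
Qed.

Lemma urep_exists s (a : ucar s) : exists f, ucls f = a.
Proof. by case: a => P [f e]; exists f; exact: eq_exist. Qed.
Definition urep s (a : ucar s) : X -> M s := projT1 (cid (urep_exists a)).
Lemma urepK s (a : ucar s) : ucls (urep a) = a.
Proof. by rewrite /urep; case: cid. Qed.

Lemma ucar_inhabited s : inhabited (ucar s).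
Proof. by have [m] := carrier_inhabited M s; exact: (inhabits (ucls (fun=> m))). Qed.

Definition at_ Gam (F : env (fun s => X -> M s) Gam) (x : X) : env M Gam := fun s v => F s v x.

Definition ultrapower : structure L :=
  @Structure S L ucar ucar_inhabited
    (fun Gam s F rho => ucls (fun x => fint M F (at_ (fun s v => urep (rho s v)) x)))
    (fun Gam R rho => U [set x | rint M R (at_ (fun s v => urep (rho s v)) x)]).

Lemma filter_env Gam (A : forall s, var Gam s -> set X) :
  (forall s v, U (A s v)) -> U [set x | forall s v, A s v x].
Proof.
elim: Gam A => [|t Gam IH] A UA.
  by apply: filterS filterT => x _ s v; case: (var_nilP v).
apply: filterS (filterI (UA _ vz) (IH (fun s v => A s (vs v)) (fun s v => UA s (vs v)))).
by move=> x [A0 A1]; apply: var_cons_ind.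
Qed.

Lemma urep_at Gam (F : env (fun s => X -> M s) Gam) :
  U [set x | at_ (fun s v => urep (ucls (F s v))) x = at_ F x].
Proof.
have := @filter_env Gam (fun s v => [set x | urep (ucls (F s v)) x = F s v x]).
have UF s v : U [set x | urep (ucls (F s v)) x = F s v x] by apply/uclsP; exact: urepK.
by move=> /(_ UF); apply: filterS => x H; apply: env_ext => s v; exact: H.
Qed.

Definition ucls_env Gam (F : env (fun s => X -> M s) Gam) : env ultrapower Gam :=
  fun s v => ucls (F s v).

Lemma eval_ultrapower Gam s (t : term L Gam s) (F : env (fun s => X -> M s) Gam) :
  eval (M := ultrapower) (ucls_env F) t = ucls (fun x => eval (at_ F x) t).
Proof.
elim: t => [//|D u f a IH] /=; apply/uclsP.
apply: filterS (urep_at (fun s v => fun x => eval (at_ F x) (a s v))) => x /= E.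
congr (fint M f _); apply: etrans E; by apply: env_ext => s0 v; rewrite /at_ IH.
Qed.

Theorem los Gam (phi : formula L Gam) (F : env (fun s => X -> M s) Gam) :
  sat (M := ultrapower) phi (ucls_env F) <-> U [set x | sat phi (at_ F x)].
Proof.
elim: phi F => {Gam} [Gam|Gam s t u|Gam D R a|Gam phi IH1 psi IH2|Gam s phi IH] F /=.
- by split=> // /filter_ex[].
- by rewrite !eval_ultrapower; exact: uclsP.
- have E : U [set x | at_ (fun s v => urep (eval (M := ultrapower) (ucls_env F) (a s v))) x =
      (fun s v => eval (at_ F x) (a s v))].
    apply: filterS (urep_at (fun s v => fun x => eval (at_ F x) (a s v))) => x /= E.
    by apply: etrans E; apply: env_ext => s v; rewrite /at_ eval_ultrapower.
  by split=> H; apply: filterS (filterI E H) => x [/= ->].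
- rewrite IH1 IH2; split=> [H|H Up]; last first.
    by apply: filterS (filterI H Up) => x [/= ? ?]; auto.
  have [/H|] := in_ultra_setVsetC [set x | sat phi (at_ F x)] UU.
    by apply: filterS => x px _.
  by apply: filterS => x np /np.
- have cE (f : X -> M s) : env_cons (F := ultrapower) (ucls f) (ucls_env F) =
      ucls_env (env_cons (F := fun s => X -> M s) f F).
    by apply: env_ext; apply: var_cons_ind.
  have aE (f : X -> M s) x : at_ (env_cons (F := fun s => X -> M s) f F) x = env_cons (f x) (at_ F x).
    by apply: env_ext; apply: var_cons_ind.
  split=> H; last first.
    move=> b; rewrite -[b]urepK cE IH; apply: filterS H => x /=.
    by rewrite aE.
  have /choice[f fP] (x : X) : exists y, sat phi (env_cons y (at_ F x)) ->
      forall z, sat phi (env_cons z (at_ F x)).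
    have [[y ny]|ny] := pselect (exists y, ~ sat phi (env_cons y (at_ F x))); first by exists y => /ny.
    have [y] := carrier_inhabited M s; exists y => _ z.
    by apply: contrapT => nz; apply: ny; exists z.
  have := H (ucls f); rewrite cE IH; apply: filterS => x /=.
  by rewrite aE; exact: fP.
Qed.

Definition diagonal s (m : M s) : ultrapower s := ucls (fun=> m).

Lemma diagonal_elementary : elementary diagonal.
Proof.
move=> Gam phi rho.
have -> : env_map diagonal rho = ucls_env (fun s v => fun=> rho s v) by [].
rewrite los; split=> [p|/filter_ex[]//]; exact: filterS filterT.
Qed.

End Ultrapower.

Section Types.
Variables (S : Type) (L : language S) (M : structure L) (Gam0 : seq S).
Variable p : set (pformula M Gam0).
Hypothesis pT : is_type setT p.
Implicit Types (Gam Del : seq S) (X Y : set (env M Gam0)).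

Lemma proves_sub X Y : X `<=` Y -> proves p X -> proves p Y.
Proof. by move=> XY [phi pphi sub]; exists phi => // x /sub/XY. Qed.

Lemma type_complete (phi : pformula M Gam0) : p phi \/ p (pneg phi).
Proof. by have [_ _] := pT; apply. Qed.

Lemma proves_setT : proves p setT.
Proof. by have [q|q] := type_complete (PFormula Bot env_nil); eexists; eauto. Qed.

Lemma type_proves (phi : pformula M Gam0) : proves p (psat phi) -> p phi.
Proof.
move=> [psi ppsi sub]; have [//|pn] := type_complete phi.
have [_ fs _] := pT; have [| |x xP] := fs [set psi; pneg phi].
- exact: finite_set2.
- by move=> q [->|->].
have := xP (pneg phi) (or_intror erefl); case.
by apply: sub; apply: xP; left.
Qed.

Lemma proves_dec X : definable setT X -> proves p X \/ proves p (~` X).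
Proof.
move=> [phi [_ ->]]; have [pp|pn] := type_complete phi; [left; exists phi|right; exists (pneg phi)] => //.
Qed.

Lemma proves_and X Y : definable setT X -> definable setT Y ->
  proves p X -> proves p Y -> proves p (X `&` Y).
Proof.
move=> dX dY [phi pphi phX] [psi ppsi psY].
have [//|[chi pchi chn]] := proves_dec (definable_and dX dY).
have [_ fs _] := pT; have [| |x xP] := fs [set phi; psi; chi].
- by rewrite !finite_setU; do !split; exact: finite_set1.
- by move=> q [[->|->]|->].
case: (chn x); first by apply: xP; right.
by split; [apply: phX|apply: psY]; apply: xP; left; [left|right].
Qed.

(** For an ultrafilter on the tuples of [M] that contains every set of the type,
    the class of the identity realizes the type in the ultrapower. *)
Lemma type_realized :
  exists (N : structure L) (j : forall t, M t -> N t) (a : env N Gam0),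
    elementary j /\ forall phi, p phi -> psat (pmap_params j phi) a.
Proof.
pose F := [set psat phi | phi in p].
have FI Y : finmeet F Y -> exists G, [/\ finite_set G, G `<=` p & \bigcap_(phi in G) psat phi `<=` Y].
  elim=> [|_ Z [phi pphi <-] _ [G [Gf Gp GZ]]]; first by exists set0; split.
  exists ([set phi] `|` G); split.
  - by rewrite finite_setU; split=> //; exact: finite_set1.
  - by move=> q [->|/Gp].
  by move=> x xG; split; [apply: xG; left|apply: GZ => psi Gpsi; apply: xG; right].
have [|U [UU FU]] := @finmeet_ultra _ F.
  move=> Y /FI[G [Gf Gp GY]]; have [_ fs _] := pT.
  by have [x xP] := fs G Gf Gp; exists x; apply: GY => phi /xP.
exists (ultrapower M U), (@diagonal _ _ M _ U), (@ucls_env _ _ M _ U Gam0 (fun s v => fun x => x s v)).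
split=> [|phi pphi]; first exact: diagonal_elementary.
rewrite /psat /pmap_params /=.
pose G : env (fun s => env M Gam0 -> M s) (Gam0 ++ pctx phi) :=
  env_cat (fun s v => fun x => x s v) (fun s v => fun=> pval phi s v).
have -> : env_cat (ucls_env U (fun s v => fun x => x s v)) (env_map (@diagonal _ _ M _ U) (pval phi)) = ucls_env U G.
  by apply: env_ext; apply: var_cat_ind => s' v; rewrite /ucls_env /G ?env_cat_vl // !env_cat_vr.
apply/los; apply: filterS (FU _ (ex_intro2 _ _ phi pphi erefl)) => x /= xphi.
have -> // : at_ G x = env_cat x (pval phi).
by apply: env_ext; apply: var_cat_ind => s' v; rewrite /at_ /G ?env_cat_vl // !env_cat_vr.
Qed.

Lemma proves_transfer Th (Q : forall N : structure L, env N Gam0 -> env N Th -> Prop) (w : env M Th)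
  (N : structure L) (j : forall t, M t -> N t) (a : env N Gam0) :
  udef2 Q -> elementary j -> (forall phi, p phi -> psat (pmap_params j phi) a) ->
  proves p [set x | Q M x w] -> Q N a (env_map j w).
Proof.
move=> dQ je ja [phi pphi phQ].
pose P (N' : structure L) (u : env N' (pctx phi)) (v : env N' Th) :=
  forall x, sat (pfor phi) (env_cat x u) -> Q N' x v.
have dP : udef2 P.
  apply: dprop_all; apply: dprop_imp; last by apply: (udef2_app dQ); dt.
  by apply: (udef2_app (form_udef2 (pfor phi))); dt.
have PM : P M (pval phi) w by move=> x /phQ.
have := proj1 (udef2_elementary (pval phi) w dP je) PM.
by apply; exact: ja.
Qed.

End Types.

(** The type is complete, so the two functions agree at every realization as soon
    as they agree at one; an ultrapower provides a realization. *)
Lemma same_germP S (L : language S) (M : structure L) s Del (p : set (pformula M [:: s]))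
  (r r' : pformula M (s :: Del)) : is_type setT p ->
  same_germ p r r' <->
  proves p [set x : env M [:: s] | exists y : env M Del, psat r (env_cat x y) /\ psat r' (env_cat x y)].
Proof.
move=> pT.
pose Q (N : structure L) (x : env N [:: s]) (w : env N (pctx r ++ pctx r')) :=
  exists y : env N Del, sat (pfor r) (env_cat (env_cat x y) (envl w)) /\
                        sat (pfor r') (env_cat (env_cat x y) (envr w)).
pose w := env_cat (pval r) (pval r').
have dQ : udef2 Q.
  apply: dprop_ex; apply: dprop_and.
    by apply: (udef2_app (form_udef2 (pfor r))); dt.
  by apply: (udef2_app (form_udef2 (pfor r'))); dt.
have QE : [set x : env M [:: s] | exists y : env M Del, psat r (env_cat x y) /\ psat r' (env_cat x y)] =
    [set x | Q M x w].
  by apply/seteqP; split=> x; rewrite /Q /w /= ?envlK ?envrK.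
rewrite QE; split=> [[N [j [a [je ja [y [ry ry']]]]]]|pQ].
  have dX : definable setT [set x | Q M x w].
    by apply/definable_fibre; exists _, Q, w; split.
  have [//|pn] := proves_dec pT dX.
  have := @proves_transfer _ _ _ _ p _ (fun N x w => ~ Q N x w) w N j (env_sing a) (dprop_not dQ) je ja pn.
  by case; exists y; rewrite /w env_map_cat envlK envrK.
have [N [j [a [je ja]]]] := type_realized pT.
have [y [ry ry']] := proves_transfer dQ je ja pQ.
exists N, j, (a s vz); split; [exact: je|by move=> phi /ja; rewrite env_singE|].
move: ry ry'; rewrite /w env_map_cat envlK envrK => ry ry'.
by exists y; split; [exact: ry|exact: ry'].
Qed.
(** * Coding imaginaries uniformly *)

Section Coded.
Variables (S : Type) (L : language S).
Implicit Types (M N : structure L) (Gam Del : seq S).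

Definition equivalence M Gam (E : env M Gam -> env M Gam -> Prop) : Prop :=
  [/\ forall x, E x x, forall x y, E x y -> E y x & forall x y z, E x y -> E y z -> E x z].

(** [phi] attaches to some classes of [E] a real tuple over which the class is
    algebraic of degree at most [k].  Being first order, this transfers between
    models of a complete theory. *)
Definition coding M Gam Del (E : env M Gam -> env M Gam -> Prop) (k : nat)
    (phi : env M Gam -> env M Del -> Prop) : Prop :=
  [/\ forall x y y', phi x y -> phi x y' -> y = y',
      forall x x' y, E x x' -> phi x y -> phi x' y &
      forall y, atmost E k (fun x => phi x y)].

Definition ucoded M Gam (E : forall N, env N Gam -> env N Gam -> Prop) (a : env M Gam) : Prop :=
  exists Del k (phi : forall N, env N Gam -> env N Del -> Prop),
    [/\ udef2 phi, coding (E M) k (phi M) & exists d, phi M a d].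

Lemma dprop_and3 (I : Type) (Ms : I -> structure L) (C : forall i, set (elt (Ms i))) Gam
  (P Q R : forall i, env (Ms i) Gam -> Prop) :
  dprop C P -> dprop C Q -> dprop C R -> dprop C (fun i rho => [/\ P i rho, Q i rho & R i rho]).
Proof.
move=> dP dQ dR; have := dprop_and dP (dprop_and dQ dR).
by apply: dprop_ext => i rho; split=> [[p [q r]]|[p q r]].
Qed.

Lemma tuple_inhabited M Gam : inhabited (env M Gam).
Proof. exact: env_inhabited (carrier_inhabited M). Qed.

Lemma coding_udef Gam Del (E : forall N, env N Gam -> env N Gam -> Prop) k
  (phi : forall N, env N Gam -> env N Del -> Prop) : udef2 E -> udef2 phi ->
  udef (fun N (_ : env N [::]) => coding (E N) k (phi N)).
Proof.
move=> dE dphi; apply: dprop_and3.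
- do 3! apply: dprop_all; apply: dprop_imp; first by apply: (udef2_app dphi); dt.
  apply: dprop_imp; first by apply: (udef2_app dphi); dt.
  by apply: dprop_eq; dt.
- do 3! apply: dprop_all; apply: dprop_imp; first by apply: (udef2_app dE); dt.
  by apply: dprop_imp; apply: (udef2_app dphi); dt.
- apply: dprop_all.
  apply: dprop_atmost => //.
  + by move=> N; exact: tuple_inhabited.
  + by apply: (udef2_app dphi); dt.
Qed.

Lemma equivalence_udef Gam (E : forall N, env N Gam -> env N Gam -> Prop) : udef2 E ->
  udef (fun N (_ : env N [::]) => equivalence (E N)).
Proof.
move=> dE; apply: dprop_and3.
- by apply: dprop_all; apply: (udef2_app dE); dt.
- by do 2! apply: dprop_all; apply: dprop_imp; apply: (udef2_app dE); dt.
- by do 3! apply: dprop_all; apply: dprop_imp; [|apply: dprop_imp]; apply: (udef2_app dE); dt.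
Qed.

Section Transfer.
Variables (T : theory L) (M N : structure L).
Hypotheses (T_complete : complete T) (M_T : models M T) (N_T : models N T).

Lemma sentence_transfer (P : forall N, env N [::] -> Prop) :
  udef P -> P N env_nil -> P M env_nil.
Proof.
move=> /(udef_form (inhabits M))[phi E]; rewrite -!E => Nphi.
have [_ /(_ phi)[H|H]] := T_complete; first exact: H.
by case: (H N N_T env_nil).
Qed.

Hypothesis M_sat : saturated M.

(** Saturation realizes in [M] the type of [a]; that a formula codes the class of
    [a] is part of this type. *)
Lemma ucoded_transfer Gam (E : forall N, env N Gam -> env N Gam -> Prop) (a : env N Gam) :
  udef2 E -> (forall a' : env M Gam, ucoded E a') -> ucoded E a.
Proof.
move=> dE codM.
pose F := [set X | exists P : forall N, env N Gam -> Prop, [/\ udef P, P N a & X = P M]].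
have FI (Y : set (env M Gam)) : finmeet F Y -> exists P : forall N, env N Gam -> Prop,
    [/\ udef P, P N a & forall x, P M x -> Y x].
  elim=> [|_ Z [P [dP Pa ->]] _ [Q [dQ Qa QZ]]].
    exists (fun _ _ => ~ False); split=> //; by apply: dprop_not; exact: dprop_False.
  exists (fun N x => P N x /\ Q N x); split=> // [|x [Px /QZ]//]; exact: dprop_and.
have [||Y|a' a'P] := @saturation _ _ M M_sat set0 _ F.
- by apply: small_finite.
- move=> _ [P [dP _ ->]]; apply/definableP; exact: udef_inst.
- move=> /FI[P [dP Pa PY]].
  have : exists x, P M x.
    apply: (sentence_transfer (P := fun N _ => exists x, P N x)); last by exists a.
    by apply: dprop_ex; apply: (udef_app dP); dt.
  by move=> [x /PY]; exists x.
have [Del [k [phi [dphi cod [d phid]]]]] := codM a'.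
exists Del, k, phi; split=> //.
  apply: contrapT => nc.
  have := @sentence_transfer (fun N _ => ~ coding (E N) k (phi N)) (dprop_not (coding_udef k dE dphi)) nc.
  exact.
apply: contrapT => nd.
have := a'P (fun x => ~ exists d, phi M x d); apply; last by exists d.
exists (fun N x => ~ exists d, phi N x d); split=> //.
by apply: dprop_not; apply: dprop_ex; apply: (udef2_app dphi); dt.
Qed.

End Transfer.
End Coded.

(** * Definability in the structure of imaginaries *)

Section Imaginaries.
Variables (S : Type) (L : language S) (N : structure L).
Implicit Types (Gam Del : seq S).
Let HS := @Home S L N.
Let Neq := eq_structure N.

Fixpoint henv (F : eq_sort N -> Type) Gam :
    env (fun s => F (HS s)) Gam -> env F (map HS Gam) :=
  match Gam return env (fun s => F (HS s)) Gam -> env F (map HS Gam) with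
  | [::] => fun _ => env_nil
  | s :: D => fun rho =>
      @env_cons _ F (HS s) (map HS D) (rho s vz) (henv (fun t v => rho t (vs v)))
  end.
Arguments henv {F Gam} rho s _ : rename.

Lemma henvE (F : eq_sort N -> Type) Gam (rho : env (fun s => F (HS s)) Gam) s (v : var Gam s) :
  henv rho (HS s) (var_map HS v) = rho s v.
Proof.
elim: Gam rho s v => [|t Gam IH] rho s v; first by case: (var_nilP v).
by move: s v; apply: var_cons_ind => [//|s v] /=; rewrite IH.
Qed.

Lemma henvK Gam (rho : env N Gam) : home_env (henv rho : env Neq _) = rho.
Proof. by apply: env_ext => s v; rewrite /home_env henvE. Qed.

Lemma rng_henv Gam (rho : env N Gam) : rng (henv rho : env Neq _) `<=` @home S L N @` rng rho.
Proof.
elim: Gam rho => [|t Gam IH] rho _ [s [v ->]]; first by case: (var_nilP v).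
move: s v; apply: var_cons_ind => [|s v] /=; first by exists (existT N t (rho t vz)) => //; exists t, vz.
have [_ [s' [v' ->]] e] := IH (fun t v => rho t (vs v)) _ (rng_env _ v).
by rewrite -e; exists (existT N s' (rho s' (vs v'))) => //; exists s', (vs v').
Qed.

(* Terms and formulas read in the home sorts of the structure of imaginaries. *)
Fixpoint tr_term Gam s (t : term L Gam s) : term (eq_language N) (map HS Gam) (HS s) :=
  match t with
  | Var _ v => Var (var_map HS v)
  | App _ _ f a => App (L := eq_language N) (OldFunc N f) (henv (fun s v => tr_term (a s v)))
  end.

Fixpoint tr Gam (phi : formula L Gam) : formula (eq_language N) (map HS Gam) :=
  match phi with
  | Bot _ => Bot
  | Eq _ _ t u => Eq (tr_term t) (tr_term u)
  | Rel _ _ R a => Rel (L := eq_language N) (OldRel N R) (henv (fun s v => tr_term (a s v)))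
  | Imp _ phi psi => Imp (tr phi) (tr psi)
  | All _ s phi => All (HS s) (tr phi)
  end.

Lemma eval_tr Gam s (t : term L Gam s) (rho : env Neq (map HS Gam)) :
  eval rho (tr_term t) = eval (home_env rho) t.
Proof.
elim: t => [//|D u f a IH] /=; congr (fint N f _).
by apply: env_ext => x v; rewrite /home_env henvE; exact: IH.
Qed.

Lemma sat_tr Gam (phi : formula L Gam) (rho : env Neq (map HS Gam)) :
  sat (tr phi) rho <-> sat phi (home_env rho).
Proof.
elim: phi rho => {Gam} [Gam|Gam s t u|Gam D R a|Gam phi IH1 psi IH2|Gam s phi IH] rho //=.
- by rewrite !eval_tr.
- have -> // : home_env (fun s v => eval rho (henv (fun s v => tr_term (a s v)) s v)) =
    fun s v => eval (home_env rho) (a s v).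
  by apply: env_ext => s v; rewrite /home_env henvE; exact: eval_tr.
- by rewrite IH1 IH2.
- have E x : home_env (Gam := s :: Gam) (env_cons (x : Neq (HS s)) rho) = env_cons (x : N s) (home_env rho).
    by apply: env_ext; apply: var_cons_ind.
  by split=> H x; have := H x; rewrite IH E.
Qed.

Let eqdef (C : set (elt Neq)) (Th : seq (eq_sort N)) (X : set (env Neq Th)) := dprop (Ms := fun _ : unit => Neq) (fun _ => C) (fun _ => X).

Lemma home_app (C : set (elt Neq)) G1 G2 (Th : seq (eq_sort N)) (P : forall N : structure L, env N G1 -> env N G2 -> Prop)
  (t : env Neq Th -> env Neq (map HS G1)) (u : env Neq Th -> env Neq (map HS G2)) :
  udef2 P -> dtup (Ms := fun _ : unit => Neq) (fun _ => C) (fun _ => t) ->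
  dtup (Ms := fun _ : unit => Neq) (fun _ => C) (fun _ => u) ->
  eqdef C (fun rho => P N (home_env (t rho)) (home_env (u rho))).
Proof.
move=> /(udef_form (inhabits N))[phi E] dtt du.
pose h : vmap (map HS (G1 ++ G2)) (map HS G1 ++ map HS G2) :=
  henv (env_cat (fun s v => vl (map HS G2) (var_map HS v)) (fun s v => vr (map HS G1) (var_map HS v))).
have hE (z : env Neq (map HS G1 ++ map HS G2)) :
    home_env (pull h z) = env_cat (home_env (envl z)) (home_env (envr z)).
  apply: env_ext => s v; rewrite /home_env /pull /h henvE; move: s v.
  by apply: var_cat_ind => s v; rewrite ?env_cat_vl // !env_cat_vr.
have := @udef_app _ _ _ (fun _ : unit => Neq) (fun _ => C) _ _ _
  (fun _ rho => pull h (env_cat (t rho) (u rho))) (form_udef (tr phi)) (dtup_pull h (dtup_cat dtt du)).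
apply: dprop_ext => _ rho.
by rewrite sat_tr E hE !envlK !envrK.
Qed.

Section Sort.
Variables (Gam : seq S) (E : formula L (Gam ++ Gam)) (HE : is_equiv N E).
Let s0 := Imag Gam E HE.

Definition cls (x : env N Gam) : Neq s0 := exist _ (eclass E x) (ex_intro _ x erefl).

Lemma clsP x y : cls x = cls y <-> sat E (env_cat x y).
Proof.
have [Er Es Et] := HE; split=> [e|Exy].
  by have : sval (cls x) y by rewrite e /= /eclass /=; exact: Er.
apply: eq_exist; apply/seteqP; split=> z; rewrite /eclass /= => H; last exact: Et H.
by apply: Et H; exact: Es.
Qed.

Lemma cls_app (C : set (elt Neq)) (Th : seq (eq_sort N))
  (t : env Neq Th -> env Neq (map HS Gam)) (u : env Neq Th -> env Neq [:: s0]) :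
  dtup (Ms := fun _ : unit => Neq) (fun _ => C) (fun _ => t) ->
  dtup (Ms := fun _ : unit => Neq) (fun _ => C) (fun _ => u) ->
  eqdef C (fun rho => cls (home_env (t rho)) = u rho s0 vz).
Proof.
move=> dtt du.
pose f : formula (eq_language N) (map HS Gam ++ [:: s0]) :=
  Eq (App (L := eq_language N) (Proj HE) (fun s v => Var (vl [:: s0] v))) (Var (vr (map HS Gam) vz)).
have := @udef2_app _ _ _ (fun _ : unit => Neq) (fun _ => C) _ _ _ _ (fun _ => t) (fun _ => u)
  (form_udef2 f) dtt du.
apply: dprop_ext => _ rho; rewrite /f /= env_cat_vr.
by have -> : (fun s v => env_cat (t rho) (u rho) s (vl [:: s0] v)) = t rho
  by apply: env_ext => s v; rewrite env_cat_vl.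
Qed.

Theorem ucoded_imaginary (a : env N Gam) :
  ucoded (fun N x y => sat (M := N) E (env_cat x y)) a ->
  exists (Del : seq S) (d : env N Del),
    acl (M := Neq) (@home S L N @` rng d) (existT Neq s0 (cls a)) /\
    @home S L N @` rng d `<=` dcl (M := Neq) [set existT Neq s0 (cls a)].
Proof.
move=> [Del [k [phi [dphi [phi1 phi2 phi3] [d phid]]]]]; exists Del, d; split.
  exists [set z : env Neq [:: s0] | exists x : env Neq (map HS Gam),
     cls (home_env x) = z s0 vz /\ phi N (home_env x) (home_env (henv d : env Neq _))]; split.
  - apply/definableP; apply: dprop_ex; apply: dprop_and.
      by apply: cls_app; dt.
    apply: (home_app (u := fun _ => henv d)) => //; first by dt.
    by apply: dtup_const => _; exact: rng_henv.
  - have [z zP] := phi3 d.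
    apply: (@sub_finite_set _ _ ((fun i => env_sing (cls (z i))) @` `I_k)); last exact/finite_image/finite_II.
    move=> y [x [xy]]; rewrite henvK => /zP[i ik Ei]; exists i => //.
    by rewrite -[y]env_singE -xy; congr env_sing; apply/esym/clsP.
  - by exists (henv a); rewrite !henvK.
move=> _ [_ [s [v ->]] <-].
apply/definableP.
apply: (@dprop_ext _ _ _ (fun _ : unit => Neq) _ _ (fun _ (y : env Neq [:: HS s]) =>
  exists (x : env Neq (map HS Gam)), exists (u : env Neq (map HS Del)),
   [/\ cls (home_env x) = env_sing (cls a) s0 vz, phi N (home_env x) (home_env u) &
       u (HS s) (var_map HS v) = y (HS s) vz])).
  move=> _ y; split=> [[x [u [xa phiu uy]]]|->].
    have ua : home_env u = d.
      by apply: phi1 phiu _; apply: phi2 phid; apply/clsP; rewrite xa.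
    by rewrite -[y]env_singE -uy /= -ua.
  by exists (henv a), (henv d); rewrite !henvK henvE.
apply: dprop_ex; apply: dprop_ex; apply: dprop_and3.
- apply: (cls_app (u := fun _ => env_sing (cls a))); first by dt.
  by apply: dtup_const => _; rewrite rng_sing.
- by apply: home_app => //; dt.
- by apply: (dprop_eqv (t := fun _ z => envl z) (u := fun _ z => envr (envr z))); dt.
Qed.

End Sort.

Lemma home_imaginary (e : elt Neq) : (exists s, projT1 e = HS s) ->
  exists (Del : seq S) (d : env N Del),
    acl (M := Neq) (@home S L N @` rng d) e /\ @home S L N @` rng d `<=` dcl (M := Neq) [set e].
Proof.
move=> [s]; case: e => t x /= e; subst t.
exists [:: s], (env_sing (x : N s)).
have He : @home S L N @` rng (env_sing (x : N s)) = [set existT Neq (HS s) x].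
  by rewrite rng_sing image_set1.
have D : definable (M := Neq) [set existT Neq (HS s) x] [set env_sing (F := Neq) x].
  apply/definableP; apply: (dprop_eq (t := fun _ z => z) (u := fun _ _ => env_sing (F := Neq) x)); first by dt.
  by apply: dtup_const => _; rewrite rng_sing.
by rewrite He; split=> [|_ ->//]; exists [set env_sing (F := Neq) x]; split.
Qed.

End Imaginaries.
(** * Definable sets over tuples *)

Section Over.
Variables (S : Type) (L : language S).
Implicit Types (M N : structure L) (Gam Del : seq S).

Lemma definable_split M (C : set (elt M)) G1 Gam (u : env M G1) (X : set (env M Gam)) :
  definable (C `|` rng u) X ->
  exists Th (P : forall N, env N Gam -> env N G1 -> env N Th -> Prop) m,
    [/\ udef3 P, rng m `<=` C & X = [set x | P M x u m]].
Proof.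
move=> /definable_fibre[Th [P [w [dP /split_params[Th' [m [h [mC ->]]]] ->]]]].
exists Th', (fun N x y z => P N x (pull h (env_cat y z))), m; split=> //.
by apply: (udef2_app dP); dt.
Qed.

Lemma empty_params M Th (m : env M Th) : rng m `<=` set0 -> Th = [::].
Proof. by case: Th m => // s Th m /(_ _ (rng_env m vz)). Qed.

Lemma definable_tuple M G1 Gam (u : env M G1) (X : set (env M Gam)) : definable (rng u) X ->
  exists2 P : forall N, env N Gam -> env N G1 -> Prop, udef2 P & X = [set x | P M x u].
Proof.
rewrite -[rng u]set0U => /definable_split[Th [P [m [dP m0 ->]]]].
have T0 := empty_params m0; subst Th.
pose P' N (x : env N Gam) (y : env N G1) := exists z : env N [::], P N x y z.
exists P'; first by apply: dprop_ex; apply: (udef3_app dP); dt.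
apply/seteqP; split=> x; first by exists m.
by move=> [z] /=; rewrite (env_nilP z m).
Qed.

Lemma definable_closed M Gam (X : set (env M Gam)) : definable set0 X ->
  exists2 P : forall N, env N Gam -> Prop, udef P & X = P M.
Proof.
move=> dX; have [|P dP ->] := @definable_tuple M [::] Gam env_nil X.
  by apply: definable_sub dX => x.
exists (fun N x => exists z, P N x z).
  by apply: dprop_ex; apply: (udef2_app dP); dt.
apply/seteqP; split=> x; first by exists env_nil.
by move=> [z] /=; rewrite (env_nilP z env_nil).
Qed.

Lemma definable_cover M Gam (E : forall N, env N Gam -> env N Gam -> Prop) k (z : nat -> env M Gam)
  (C : set (elt M)) : udef2 E -> (forall i, i < k -> rng (z i) `<=` C) ->
  definable C [set x | exists2 i, i < k & E M x (z i)].
Proof.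
move=> dE zC; apply/definableP; elim: k zC => [|k IH] zC.
  by apply: dprop_ext (dprop_False _ _) => i y; split=> // -[].
apply: (@dprop_ext _ _ _ _ _ _ (fun _ y => (exists2 i, i < k & E M y (z i)) \/ E M y (z k))).
  move=> _ y; split=> [[[i ik yi]|yk]|[i]]; first by exists i => //; exact: ltnW.
    by exists k.
  by rewrite ltnS leq_eqVlt => /predU1P[->|ik yi]; [right|left; exists i].
apply: dprop_or; first by apply: IH => i ik; apply: zC; exact: ltnW.
apply: (udef2_app dE); first exact: dtup_id.
by apply: dtup_const => _; exact: zC.
Qed.

Lemma eq_udef Gam : udef2 (fun N (x y : env N Gam) => x = y).
Proof. by apply: dprop_eq; dt. Qed.

Lemma definable_finite M Gam (C : set (elt M)) (D : set (env M Gam)) :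
  finite_set D -> (forall x, D x -> rng x `<=` C) -> definable C D.
Proof.
move=> Df DC; have [[x0 Dx0]|nD] := pselect (exists x, D x); last first.
  apply/definableP; apply: dprop_ext (dprop_False _ _) => _ x.
  by split=> // Dx; apply: nD; exists x.
have [k [z zP]] := finite_atmost (inhabits x0) Df.
pose z' i := if pselect (D (z i)) then z i else x0.
have Dz' i : D (z' i) by rewrite /z'; case: pselect.
have := @definable_cover M Gam (fun N x y => x = y) k z' C (eq_udef Gam) (fun i _ => DC _ (Dz' i)).
have -> // : [set x | exists2 i, i < k & x = z' i] = D.
apply/seteqP; split=> [x [i _ ->]//|x Dx].
by have [i ik e] := zP _ Dx; exists i => //; rewrite /z' -e; case: pselect.
Qed.

Lemma sub_acl M (A : set (elt M)) : A `<=` acl A.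
Proof.
move=> [s x] Ax; exists [set env_sing x]; split=> //=.
apply: definable_finite; first exact: finite_set1.
by move=> _ ->; rewrite rng_sing => _ ->.
Qed.

Lemma acl_tuple M (C : set (elt M)) Gam (w : env M Gam) : rng w `<=` acl C ->
  exists X : set (env M Gam), [/\ definable C X, finite_set X & X w].
Proof.
elim: Gam w => [|s Gam IH] w wC.
  exists setT; split=> //.
    by apply/definableP; apply: dprop_ext (dprop_not (dprop_False _ _)) => _ x; split=> // _ [].
  by apply: sub_finite_set (finite_set1 env_nil) => x _; exact: env_nilP.
have [X0 [dX0 fX0 X0w]] : exists X0 : set (env M [:: s]),
    [/\ definable C X0, finite_set X0 & X0 (env_sing (w s vz))] := wC _ (rng_env w vz).
have [|X1 [dX1 fX1 X1w]] := IH (fun s v => w s (vs v)).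
  by move=> _ [t [v ->]]; exact/wC/rng_env.
pose X := [set x : env M ([:: s] ++ Gam) | X0 (envl x) /\ X1 (envr x)].
exists X; split.
- move/definableP in dX0; move/definableP in dX1; apply/definableP.
  apply: dprop_and; first by apply: (dprop_sub dX0); dt.
  by apply: (dprop_sub dX1); dt.
- apply: (@sub_finite_set _ _ ((fun xy => env_cat xy.1 xy.2) @` (X0 `*` X1))).
    by move=> x [X0x X1x]; exists (envl x, envr x) => //; exact: env_catK.
  by apply: finite_image; exact: finite_setX.
- by split=> //=; move: X0w; rewrite -(env_singE (envl (w : env M ([:: s] ++ Gam)))).
Qed.

Lemma dcl_tuple M (C : set (elt M)) Gam (w : env M Gam) : rng w `<=` dcl C ->
  definable C [set w].
Proof.
elim: Gam w => [|s Gam IH] w wC.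
  have -> : [set w] = setT by apply/seteqP; split=> // x _; exact: env_nilP.
  by apply/definableP; apply: dprop_ext (dprop_not (dprop_False _ _)) => _ x; split=> // _ [].
have dX0 : definable C [set env_sing (w s vz)] := wC _ (rng_env w vz).
have dX1 : definable C [set (fun s v => w s (vs v)) : env M Gam].
  by apply: IH => _ [t [v ->]]; exact/wC/rng_env.
move/definableP in dX0; move/definableP in dX1; apply/definableP.
apply: (@dprop_ext _ _ _ _ _ _ (fun _ (x : env M ([:: s] ++ Gam)) =>
  envl x = env_sing (w s vz) /\ envr x = (fun s v => w s (vs v)))).
  move=> _ x; split=> [[xl xr]|->]; last first.
    by split=> //; rewrite -[LHS]env_singE.
  by rewrite -[x]env_catK xl xr; apply: env_ext; apply: var_cons_ind.
apply: dprop_and; first by apply: (dprop_sub (P := fun _ z => z = env_sing (w s vz)) dX0); dt.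
by apply: (dprop_sub (P := fun _ z => z = _) dX1); dt.
Qed.

Lemma dcl_dcl M (C D : set (elt M)) : C `<=` dcl D -> dcl C `<=` dcl D.
Proof.
move=> CD [s x] /definable_fibre[Th [P [w [dP wC /= XE]]]].
have dw : definable D [set w] by apply: dcl_tuple => y /wC/CD.
move/definableP in dw; apply/definableP => /=.
apply: (@dprop_ext _ _ _ _ _ _ (fun _ y => exists w' : env M Th, w' = w /\ P M y w')).
  by move=> _ y; rewrite -[X in _ <-> X]/([set env_sing x] y) XE; split=> [[_ [-> //]]|Py]; exists w.
apply: dprop_ex; apply: dprop_and; first by apply: (dprop_sub (P := fun _ z => z = w) dw); dt.
by apply: (udef2_app dP); dt.
Qed.

Lemma sub_dcl M (C : set (elt M)) : C `<=` dcl C.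
Proof.
move=> [s x] Cx; apply: definable_finite; first exact: finite_set1.
by move=> _ ->; rewrite rng_sing => _ ->.
Qed.

Lemma finite_existT (F : S -> Type) s (Y : set (F s)) :
  finite_set [set existT F s y | y in Y] -> finite_set Y.
Proof.
have [[y0 Yy0]|nY] := pselect (exists y, Y y); last first.
  by move=> _; apply: (@sub_finite_set _ _ set0) => // y Yy; case: nY; exists y.
pose g (x : elt F) : F s := if pselect (exists y, x = existT F s y) is left e then projT1 (cid e) else y0.
move=> /(finite_image g); apply: sub_finite_set => y Yy; exists (existT F s y); first by exists y.
rewrite /g; case: pselect => [e|[]]; last by exists y.
by case: cid => y' /= /esym e'; exact: (eq_existT e').
Qed.

Lemma finite_orbit_tuple M (H : set (forall s, M s -> M s)) Gam (w : env M Gam) :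
  (forall x, rng w x -> finite_set [set elt_map f x | f in H]) ->
  finite_set [set env_map f w | f in H].
Proof.
elim: Gam w => [|s Gam IH] w wf.
  by apply: sub_finite_set (finite_set1 env_nil) => x _; exact: env_nilP.
have f0 : finite_set [set f s (w s vz) | f in H].
  apply: finite_existT; apply: sub_finite_set (wf _ (rng_env w vz)) => _ [_ [f Hf <-] <-].
  by exists f.
have f1 : finite_set [set env_map f (fun s v => w s (vs v)) | f in H].
  by apply: IH => x [t [v ->]]; apply: wf; exact: rng_env.
apply: (@sub_finite_set _ _ ((fun xy => env_cons xy.1 xy.2) @`
   ([set f s (w s vz) | f in H] `*` [set env_map f (fun s v => w s (vs v)) | f in H]))).
  move=> _ [f Hf <-]; exists (f s (w s vz), env_map f (fun s v => w s (vs v))); first by split; exists f.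
  by apply: env_ext; apply: var_cons_ind.
by apply: finite_image; exact: finite_setX.
Qed.

End Over.

(** * Codes and orbits in a saturated model *)

Section Orbits.
Variables (S : Type) (L : language S) (M : structure L).
Hypotheses (M_sat : saturated M) (M_hom : homogeneous M).
Implicit Types (Gam Del : seq S).
Variables (Gam0 : seq S) (E : forall N : structure L, env N Gam0 -> env N Gam0 -> Prop).
Arguments E : clear implicits.
Hypotheses (dE : udef2 E) (Eeq : equivalence (E M)).

(** The stabilizer of the imaginary [a / E]. *)
Definition stab (a : env M Gam0) : set (forall s, M s -> M s) :=
  [set f | automorphism f /\ E M a (env_map f a)].

(** The real part of the algebraic closure of the imaginary [a / E]: in a saturated
    homogeneous structure, algebraic means having a finite orbit. *)
Definition racl (a : env M Gam0) : set (elt M) :=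
  [set x | finite_set [set elt_map f x | f in stab a]].

Lemma E_aut f x y : automorphism f -> E M x y -> E M (env_map f x) (env_map f y).
Proof. by move=> fa; exact: (proj1 (udef2_elementary x y dE (aut_elementary fa))). Qed.

Lemma stab_id a : stab a (fun s x => x).
Proof. by have [Er _ _] := Eeq; split; [exact: aut_id|exact: Er]. Qed.

Lemma stab_comp a f g : stab a f -> stab a g -> stab a (fun s x => f s (g s x)).
Proof.
have [_ _ Et] := Eeq; move=> [fa fE] [ga gE]; split; first exact: aut_comp.
by apply: Et fE _; rewrite -env_map_comp; exact: E_aut.
Qed.

Lemma stab_inv a f : stab a f -> exists2 g, stab a g &
  (forall s x, g s (f s x) = x) /\ (forall s x, f s (g s x) = x).
Proof.
have [_ Es _] := Eeq; move=> [/aut_inv[g [ga gf fg]] fE]; exists g => //; split=> //.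
have := E_aut ga fE; rewrite env_map_comp.
have -> : env_map (fun s y => g s (f s y)) a = a by apply: env_ext => s v; exact: gf.
exact: Es.
Qed.

(** Compactness gives one formula witnessing that [eta] is determined by the class
    of [a], and one witnessing that this class is algebraic over [eta]. *)
Lemma orbit_ucoded Del (a : env M Gam0) (eta : env M Del) k :
  (forall f, stab a f -> env_map f eta = eta) ->
  atmost (E M) k [set x | exists2 f, aut_over (rng eta) f & x = env_map f a] ->
  ucoded E a.
Proof.
have [Er Es Et] := Eeq; move=> eta_fix [z zP].
have [|||chi1 [dchi1 chi1a chi1P]] := @isolate _ _ _ M_sat M_hom set0 _ (env_cat a eta)
    [set u | E M a (envl u) -> envr u = eta].
- exact: small_finite.
- apply/definableP; apply: dprop_imp.
    apply: (udef2_app dE (t := fun _ _ => a)); last by dt.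
    by apply: dtup_const.
  apply: dprop_eq; first by dt.
  exact: dtup_const.
- by move=> f [fa _]; rewrite /= env_map_cat envlK envrK => aE; apply: eta_fix.
have [P1 dP1 chi1E] := definable_closed dchi1; subst chi1.
have [|||chi2 [dchi2 chi2a chi2P]] := @isolate _ _ _ M_sat M_hom (rng eta) _ a
    [set x | exists2 i, i < k & E M x (z i)].
- exact: small_rng.
- exact: definable_cover.
- by move=> f fa; apply: zP; exists f.
have [P2 dP2 chi2E] := definable_tuple dchi2; subst chi2.
pose R (N : structure L) (x : env N Gam0) (y : env N Del) := exists x', E N x x' /\ P1 N (env_cat x' y).
pose G (N : structure L) (x : env N Gam0) (y : env N Del) := exists x', E N x x' /\ P2 N x' y.
have dR : udef2 R.
  apply: dprop_ex; apply: dprop_and; first by apply: (udef2_app dE); dt.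
  by apply: (udef_app dP1); dt.
have dG : udef2 G.
  apply: dprop_ex; apply: dprop_and; first by apply: (udef2_app dE); dt.
  by apply: (udef2_app dP2); dt.
have RE x x' y : E M x x' -> R M x y -> R M x' y.
  by move=> xx' [w [xw w1]]; exists w; split=> //; apply: Et xw; exact: Es.
have GE x x' y : E M x x' -> G M x y -> G M x' y.
  by move=> xx' [w [xw w1]]; exists w; split=> //; apply: Et xw; exact: Es.
have Ra y : R M a y -> y = eta.
  by move=> [x' [ax' x'y]]; have := chi1P _ x'y; rewrite /= envlK envrK; apply.
have Raeta : R M a eta by exists a; split; [exact: Er|exact: chi1a].
exists Del, k, (fun (N : structure L) (x : env N Gam0) (y : env N Del) => [/\ R N x y, forall y', R N x y' -> y' = y,
  G N x y & atmost (E N) k (fun x' => G N x' y)]); split.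
- apply: (@dprop_ext _ _ _ _ _ _ (fun (N : structure L) (r : env N (Gam0 ++ Del)) => (R N (envl r) (envr r) /\
    (forall y', R N (envl r) y' -> y' = envr r)) /\
    (G N (envl r) (envr r) /\ atmost (E N) k (fun x' => G N x' (envr r))))).
    by move=> N r; split=> [[[? ?] [? ?]]|[]].
  apply: dprop_and; apply: dprop_and.
  + by apply: (udef2_app dR); dt.
  + apply: dprop_all; apply: dprop_imp; first by apply: (udef2_app dR); dt.
    by apply: dprop_eq; dt.
  + by apply: (udef2_app dG); dt.
  + apply: dprop_atmost => //; first by move=> N; exact: tuple_inhabited.
    by apply: (udef2_app dG); dt.
- split=> [x y y' [Ry _ _ _] [_ uy' _ _]|x x' y xx' [Ry uy Gy at_y]|y]; first exact: uy'.
    split=> //; [exact: RE Ry| |exact: GE Gy].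
    by move=> y' /(RE _ _ _ (Es _ _ xx'))/uy.
  have [[x [_ _ _]]|nx] := pselect (exists x, [/\ R M x y, forall y', R M x y' -> y' = y,
    G M x y & atmost (E M) k (fun x' => G M x' y)]).
    by apply: atmost_sub => x' [].
  by exists (fun=> a) => x xP; case: nx; exists x.
exists eta; split=> //.
- by exists a; split; [exact: Er|exact: chi2a].
- exists z => x [x' [xx' /chi2P[i ik Ei]]]; exists i => //; exact: Et Ei.
Qed.

Section Fixed.
Variable a : env M Gam0.

Lemma racl_tuple Gam (m : env M Gam) : rng m `<=` racl a ->
  finite_set [set env_map f m | f in stab a].
Proof. by move=> mA; apply: finite_orbit_tuple => x /mA. Qed.

Lemma aut_over_stab f : aut_over (rng a) f -> stab a f.
Proof.
have [Er _ _] := Eeq; move=> fa; split; first exact: fa.1.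
by rewrite (aut_over_env fa).
Qed.

(* An element with finitely many conjugates over the class of [a] is algebraic
   over [a]. *)
Lemma small_racl : small L (racl a).
Proof.
apply: small_sub (small_acl (small_rng _ a)) => -[s x] xf.
have f0 : finite_set [set f s x | f in stab a].
  by apply: finite_existT; apply: sub_finite_set xf => _ [_ [f Hf <-] <-]; exists f.
have [k kP] := finite_atmost (inhabits x) f0.
apply: (finite_orbit_acl M_sat M_hom (k := k)); first exact: small_rng.
by apply: atmost_sub kP => _ [f /aut_over_stab fa ->]; exists f.
Qed.

(** A finite set definable over a tuple with finitely many conjugates has finitely
    many conjugates, all finite. *)
Lemma racl_acl : racl a = acl (racl a).
Proof.
apply/seteqP; split; first exact: sub_acl.
move=> [s x] [X [/definable_fibre[Th [P [m [dP mA ->]]]] Xf Xx]] /=.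
pose O := [set env_map f m | f in stab a].
have Of : finite_set O by exact: racl_tuple.
pose Y (m' : env M Th) := [set existT M s (y s vz) | y in [set y : env M [:: s] | P M y m']].
apply: (@sub_finite_set _ _ (\bigcup_(m' in O) Y m')).
  move=> _ [f Hf <-]; exists (env_map f m); first by exists f.
  exists (env_map f (env_sing x)) => //=.
  exact: (proj1 (udef2_elementary _ _ dP (aut_elementary Hf.1)) Xx).
apply: bigcup_finite => // _ [f Hf <-]; apply: finite_image.
have [g gH [gf fg]] := stab_inv Hf.
apply: (@sub_finite_set _ _ ((fun y => env_map f y) @` [set y | P M y m])); last exact: finite_image.
move=> y Py; exists (env_map g y); last by apply: env_ext => t v; exact: fg.
apply/(udef2_elementary _ _ dP (aut_elementary Hf.1)).
by rewrite env_map_comp; have -> : env_map (fun s y => f s (g s y)) y = y by apply: env_ext => t v; exact: fg.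
Qed.

(** Outside [racl a] orbits stay infinite over [racl a]: by compactness only a
    finite tuple of [racl a] matters, and it has finitely many conjugates. *)
Lemma racl_infinite d : ~ racl a d ->
  ~ finite_set [set elt_map f d | f in [set f | aut_over (racl a) f /\ stab a f]].
Proof.
case: d => s x nx fin; apply: nx; rewrite /racl /=.
have f0 : finite_set [set f s x | f in [set f | aut_over (racl a) f /\ stab a f]].
  by apply: finite_existT; apply: sub_finite_set fin => _ [_ [f Hf <-] <-]; exists f.
have [k [z zP]] := finite_atmost (inhabits x) f0.
have [|||chi [dchi chia chiP]] := @isolate _ _ _ M_sat M_hom (racl a) _ (env_cat a (env_sing x))
    [set u | E M a (envl u) -> exists2 i, i < k & envr u = env_sing (z i)].
- exact: small_racl.
- apply/definableP; apply: dprop_imp.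
    apply: (udef2_app dE (t := fun _ _ => a)); last by dt.
    by apply: dtup_const.
  have := @definable_cover _ _ M _ (fun N x y => x = y) k (fun i => env_sing (z i)) setT (@eq_udef _ _ _) (fun _ _ _ _ => I).
  by move=> /definableP dc; apply: (dprop_sub dc (t := fun _ r => envr r)); dt.
- move=> f fa; rewrite /= env_map_cat env_map_sing envlK envrK => aE.
  have [|i ik e] := zP (f s x); last by exists i => //; rewrite e.
  by exists f => //; split=> //; split=> //; exact: fa.1.
move: dchi => /definable_fibre[Th [P [m [dP mA chiE]]]]; subst chi.
have Of : finite_set [set env_map f m | f in stab a] by exact: racl_tuple.
have /choice[h hP] (m' : env M Th) : exists h, [set env_map f m | f in stab a] m' ->
    stab a h /\ env_map h m = m'.
  have [[f Hf fm]|n] := pselect ([set env_map f m | f in stab a] m'); first by exists f.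
  by exists (fun s x => x).
apply: (@sub_finite_set _ _ (\bigcup_(m' in [set env_map f m | f in stab a])
   ((fun i => existT M s (h m' s (z i))) @` `I_k))); last first.
  by apply: bigcup_finite => // m' _; apply: finite_image; exact: finite_II.
move=> _ [f Hf <-]; exists (env_map f m); first by exists f.
have [hH hm] : stab a (h (env_map f m)) /\ env_map (h (env_map f m)) m = env_map f m.
  by apply: hP; exists f.
set h0 := h (env_map f m) in hH hm *.
have [g gH [gh hg]] := stab_inv hH.
have [i ik /(congr1 (fun y => y s vz)) /= e] : exists2 i, i < k & env_sing (g s (f s x)) = env_sing (z i).
  pose gf := fun s x => g s (f s x).
  have gfH : stab a gf by exact: stab_comp.
  have gfm : env_map gf m = m.
    by rewrite -[LHS]/(env_map g (env_map f m)) -hm; apply: env_ext => t v; exact: gh.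
  have Pg := proj1 (udef2_elementary (env_cat a (env_sing x)) m dP (aut_elementary gfH.1)) chia.
  rewrite gfm in Pg.
  have := chiP _ Pg; rewrite /= env_map_cat env_map_sing envlK envrK; apply; exact: gfH.2.
by exists i => //=; rewrite -e hg.
Qed.

End Fixed.
End Orbits.
(** * A structure inside a model of the smaller theory *)

Section TwoStructures.
Variables (S : Type) (Lt L : language S) (i : sublanguage Lt L) (Tt : theory Lt).
Hypotheses (Tt_QE : eliminates_quantifiers Tt) (Tt_EI : eliminates_imaginaries Tt).
Variables (M : structure L) (Mt : structure Lt).
Hypotheses (M_sat : saturated M) (M_hom : homogeneous M) (Mt_Tt : models Mt Tt).
Variable iota : forall s, reduct i M s -> Mt s.
Arguments iota : clear implicits.
Hypothesis iota_sub : embedding iota.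
Hypothesis aut_ext : forall sigma : (forall s, M s -> M s), automorphism sigma ->
  exists2 tau : (forall s, Mt s -> Mt s), automorphism tau &
    forall s (x : M s), tau s (iota s x) = iota s (sigma s x).
Implicit Types (Gam Del Th : seq S).

Definition io Gam (x : env M Gam) : env Mt Gam := env_map iota x.
Arguments io {Gam} x s _.

Lemma io_inj Gam (x y : env M Gam) : io x = io y -> x = y.
Proof.
have [ii _ _] := iota_sub; move=> e; apply: env_ext => s v; apply: (ii s).
by move: e => /(congr1 (fun f => f s v)).
Qed.

Lemma io_cat Gam Del (x : env M Gam) (y : env M Del) : io (env_cat x y) = env_cat (io x) (io y).
Proof. exact: env_map_cat. Qed.

Lemma io_sing s (x : M s) : io (env_sing x) = env_sing (iota s x).
Proof. exact: env_map_sing. Qed.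

Lemma rng_io Gam (x : env M Gam) : rng (io x) = elt_map iota @` rng x.
Proof. exact: (@rng_map S M Mt iota). Qed.

Lemma io_lift Gam (B : set (elt M)) (w : env Mt Gam) : rng w `<=` elt_map iota @` B ->
  exists2 m : env M Gam, rng m `<=` B & w = io m.
Proof.
move=> wB.
have ex s (v : var Gam s) : exists y : M s, B (existT M s y) /\ w s v = iota s y.
  have [[t y] By e] := wB _ (rng_env w v).
  have ets := congr1 (@projT1 _ _) e; simpl in ets; subst t.
  by exists y; split=> //; rewrite (eq_existT e).
exists (fun s v => projT1 (cid (ex s v))).
  by move=> _ [s [v ->]]; case: cid => y [].
by apply: env_ext => s v; rewrite /io /env_map; case: cid => y [].
Qed.

(** By quantifier elimination, relations definable in the large structure have
    definable traces on [M]; a quantifier-free formula defines both. *)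
Lemma trace Gam Th (Q : forall N : structure Lt, env N Gam -> env N Th -> Prop) : udef2 Q ->
  exists psi : formula Lt (Gam ++ Th), [/\ qfree psi,
    forall x w, sat (M := Mt) psi (env_cat x w) <-> Q Mt x w &
    forall x w, sat (M := M) (Defs.lift i psi) (env_cat x w) <-> Q Mt (io x) (io w)].
Proof.
move=> /(udef_form (inhabits Mt))[phi phiE].
have [psi [qpsi [imp1 imp2]]] := Tt_QE phi.
have psiE z : sat (M := Mt) psi z <-> sat (M := Mt) phi z.
  by split; [exact: (imp2 Mt Mt_Tt z)|exact: (imp1 Mt Mt_Tt z)].
exists psi; split=> [//|x w|x w]; first by rewrite psiE phiE envlK envrK.
rewrite sat_lift (sat_qfree (M := reduct i M) _ iota_sub qpsi).
rewrite -[env_map _ _]/(io _) psiE phiE io_cat envlK envrK //.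
Qed.

Lemma trace_udef2 Gam Th (Q : forall N : structure Lt, env N Gam -> env N Th -> Prop) : udef2 Q ->
  exists2 P : forall N : structure L, env N Gam -> env N Th -> Prop, udef2 P &
    forall x w, P M x w <-> Q Mt (io x) (io w).
Proof.
move=> /trace[psi [_ _ E]]; exists (fun N x w => sat (M := N) (Defs.lift i psi) (env_cat x w)) => //.
exact: form_udef2.
Qed.

Lemma trace_udef3 G1 G2 G3 (Q : forall N : structure Lt, env N G1 -> env N G2 -> env N G3 -> Prop) :
  udef3 Q -> exists2 P : forall N : structure L, env N G1 -> env N G2 -> env N G3 -> Prop, udef3 P &
    forall x y z, P M x y z <-> Q Mt (io x) (io y) (io z).
Proof.
move=> dQ; have [P dP E] := trace_udef2 (Q := fun N x (r : env N (G2 ++ G3)) => Q N x (envl r) (envr r)) dQ.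
exists (fun N x y z => P N x (env_cat y z)); first by apply: (udef2_app dP); dt.
by move=> x y z; rewrite E io_cat envlK envrK.
Qed.

Lemma extension (f : forall s, M s -> M s) : automorphism f ->
  exists2 g : forall s, Mt s -> Mt s, automorphism g &
    forall Gam (x : env M Gam), env_map g (io x) = io (env_map f x).
Proof.
move=> /aut_ext[g ga gf]; exists g => // Gam x.
by apply: env_ext => s v; exact: gf.
Qed.

Lemma io_fixes (g : forall s, Mt s -> Mt s) Gam (x : env M Gam) :
  (forall y, rng x y -> fixes g (elt_map iota y)) <-> env_map g (io x) = io x.
Proof.
rewrite -fixes_env rng_io; split=> [H _ [y xy <-]|H y xy]; first exact: H.
by apply: H; exists y.
Qed.

Lemma io_aut_over (A : set (elt M)) (f : forall s, M s -> M s) (g : forall s, Mt s -> Mt s) :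
  aut_over A f -> automorphism g ->
  (forall Gam (x : env M Gam), env_map g (io x) = io (env_map f x)) ->
  aut_over (elt_map iota @` A) g.
Proof.
move=> [fa fA] ga gf; split=> // _ [[s x] Ax <-]; apply/fixesE.
have := gf _ (env_sing x); rewrite io_sing !env_map_sing io_sing.
by move=> /(congr1 (fun y => y s vz)) /= ->; have /fixesE-> := fA _ Ax.
Qed.

Lemma io_range (f : forall s, M s -> M s) (g : forall s, Mt s -> Mt s) :
  automorphism f -> (forall Gam (x : env M Gam), env_map g (io x) = io (env_map f x)) ->
  elt_map g @` range (elt_map iota) = range (elt_map iota).
Proof.
move=> fa gf.
have gfx s (x : M s) : g s (iota s x) = iota s (f s x).
  by have := gf _ (env_sing x); rewrite io_sing !env_map_sing io_sing => /(congr1 (fun y => y s vz)).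
have [f' [_ _ ff']] := aut_inv fa.
apply/seteqP; split=> [_ [_ [[s x] _ <-] <-]|_ [[s x] _ <-]].
  by exists (existT M s (f s x)) => //; rewrite /elt_map /= gfx.
exists (elt_map iota (existT M s (f' s x))); first by exists (existT M s (f' s x)).
by rewrite /elt_map /= gfx ff'.
Qed.

Hypothesis internal : internalizes_codes iota.

(** The tuples of [M] internalizing the coordinates of [b] are concatenated. *)
Lemma internal_tuple Th (b : env Mt Th) : rng b `<=` dcl (range (elt_map iota)) ->
  exists Gam (eta : env M Gam), forall f g, automorphism f -> automorphism g ->
    (forall Gam (x : env M Gam), env_map g (io x) = io (env_map f x)) ->
    env_map g b = b <-> env_map f eta = eta.
Proof.
elim: Th b => [|s Th IH] b bM.
  exists [::], env_nil => f g _ _ _; split=> _; exact: env_nilP.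
have [|Gam [eta etaP]] := IH (fun s v => b s (vs v)).
  by move=> _ [t [v ->]]; exact/bM/rng_env.
have [Gam0 [eta0 eta0P]] := internal (bM _ (rng_env b vz)).
exists (Gam0 ++ Gam), (env_cat eta0 eta) => f g fa ga gf.
have e0 : g s (b s vz) = b s vz <-> env_map f eta0 = eta0.
  rewrite -fixesE (eta0P g ga (io_range fa gf)) io_fixes gf.
  by split=> [/io_inj|->].
have e1 := etaP f g fa ga gf.
rewrite env_map_cat; split=> [gb|fe].
  congr env_cat; first by apply/e0; move: gb => /(congr1 (fun y => y s vz)).
  by apply/e1; apply: env_ext => t v; move: gb => /(congr1 (fun y => y t (vs v))).
have /e0 g0 : env_map f eta0 = eta0 by have := congr1 envl fe; rewrite !envlK.
have /e1 g1 : env_map f eta = eta by have := congr1 envr fe; rewrite !envrK.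
apply: env_ext; apply: var_cons_ind => // t v.
by move: g1 => /(congr1 (fun y => y t v)).
Qed.

Lemma code_aut Gam Th (X : set (env Mt Gam)) (b : env Mt Th) g : is_code X b -> automorphism g ->
  env_map g b = b <-> (forall x, X (env_map g x) <-> X x).
Proof.
move=> [R [XE Rinj]] ga.
have XgE x : X x <-> sat R (env_cat (env_map g x) (env_map g b)).
  by rewrite XE /= (aut_elementary ga R) env_map_cat.
split=> [gb x|H].
  by rewrite [X in _ <-> X]XgE gb XE.
have gsurj x : exists y : env Mt Gam, env_map g y = x.
  have [g' [_ _ gg']] := aut_inv ga.
  by exists (env_map g' x); apply: env_ext => t v; exact: gg'.
apply: contrapT => /nesym/Rinj; apply; rewrite -XE; apply/seteqP.
by split=> x; have [y <-] := gsurj x; [move=> /H/XgE|move=> /XgE/H].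
Qed.

(** The code is the only tuple that defines [X] by its formula. *)
Lemma code_dcl Gam Th (C : set (elt Mt)) (X : set (env Mt Gam)) (b : env Mt Th) :
  is_code X b -> definable C X -> rng b `<=` dcl C.
Proof.
move=> [R [XE Rinj]] dX _ [s [v ->]]; move/definableP in dX; apply/definableP.
apply: (@dprop_ext _ _ _ _ _ _ (fun _ y => exists b', (forall x, X x <-> sat R (env_cat x b')) /\
    b' s v = y s vz)).
  move=> _ y; split=> [[b' [bE e]]|->]; last by exists b; split=> // x; rewrite XE.
  have [bb'|/Rinj[]] := pselect (b = b').
    by rewrite /= -[y]env_singE -e bb'.
  by rewrite -XE; apply/seteqP; split=> x /bE.
apply: dprop_ex; apply: dprop_and.
  apply: dprop_all; apply: dprop_iff; first by apply: (dprop_sub dX (t := fun _ r => envl r)); dt.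
  by apply: (udef2_app (form_udef2 R)); dt.
by apply: (dprop_eqv (t := fun _ r => envl r) (u := fun _ r => envr r)); dt.
Qed.

(** Elimination of imaginaries codes the image of [D] in the large structure, and
    this code, being definable over [M], is internalized. *)
Lemma finite_code Gam (D : set (env M Gam)) : finite_set D ->
  exists Del (eta : env M Del), forall f, automorphism f ->
    env_map f eta = eta <-> (forall x, D (env_map f x) <-> D x).
Proof.
move=> Df; pose iD := [set io x | x in D].
have dD : definable (range (elt_map iota)) iD.
  apply: definable_finite; first exact: finite_image.
  by move=> _ [x _ <-]; rewrite rng_io => _ [y _ <-]; exists y.
have [Th [b codeb]] : coded iD by apply: (Tt_EI Mt_Tt); apply: definable_sub dD.
have [Del [eta etaP]] := internal_tuple (code_dcl codeb dD).
exists Del, eta => f fa; have [g ga gf] := extension fa.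
rewrite -(etaP f g fa ga gf) (code_aut codeb ga); split=> H x; last first.
  split=> [[y Dy e]|[y Dy <-]]; last by exists (env_map f y); rewrite ?gf //; apply/H.
  have [f' [_ _ ff']] := aut_inv fa.
  have fy : env_map f (env_map f' y) = y by apply: env_ext => t v; exact: ff'.
  exists (env_map f' y); first by apply/H; rewrite fy.
  have [[gi _ _] _] := ga; apply: env_ext => t v; apply: (gi t).
  have e2 : env_map g (io (env_map f' y)) = env_map g x by rewrite gf fy.
  exact: (congr1 (fun z => z t v) e2).
have := H (io x); rewrite gf => Hx; split=> Dx.
  have [|y Dy /io_inj <-//] := proj1 Hx _; by exists (env_map f x).
have [|y Dy /io_inj <-//] := proj2 Hx _; by exists x.
Qed.

End TwoStructures.
(** * The analysis of one dominant coordinate *)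

Lemma atmost_preimage T U (f : T -> U) n (P : U -> Prop) : inhabited T -> injective f ->
  atmost eq n P -> atmost eq n (fun x => P (f x)).
Proof.
move=> [t] fi [z zP].
exists (fun j => if pselect (exists x, f x = z j) is left e then projT1 (cid e) else t) => x /zP[j jn e].
exists j => //; case: pselect => [e'|[]]; last by exists x.
by case: cid => y /= yz; apply: fi; rewrite yz.
Qed.

Lemma atmost_strict T n (P Q : T -> Prop) : (forall x, Q x -> P x) -> (exists2 x, P x & ~ Q x) ->
  atmost eq n P -> atmost eq n.-1 Q.
Proof.
move=> QP [x0 Px0 nQx0] [z zP]; have [i0 i0n e0] := zP _ Px0.
case: n i0n zP => // n i0n zP /=.
exists (fun j => if j < i0 then z j else z j.+1) => x Qx.
have [j jn e] := zP _ (QP _ Qx).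
have [ji|ij|ji] := ltngtP j i0.
- by exists j; rewrite ?ji //; apply: leq_trans ji _; rewrite -ltnS.
- case: j ij jn e => // j ij jn e; exists j => //.
  by rewrite ltnNge -ltnS ij.
- by case: nQx0; rewrite e0 -ji -e.
Qed.

Section Analysis.
Variables (S : Type) (Lt L : language S) (i : sublanguage Lt L) (Tt : theory Lt).
Hypotheses (Tt_QE : eliminates_quantifiers Tt) (Tt_EI : eliminates_imaginaries Tt).
Variables (M : structure L) (Mt : structure Lt).
Hypotheses (M_sat : saturated M) (M_hom : homogeneous M) (Mt_Tt : models Mt Tt).
Variable iota : forall s, reduct i M s -> Mt s.
Arguments iota : clear implicits.
Hypothesis iota_sub : embedding iota.
Hypothesis aut_ext : forall sigma : (forall s, M s -> M s), automorphism sigma ->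
  exists2 tau : (forall s, Mt s -> Mt s), automorphism tau &
    forall s (x : M s), tau s (iota s x) = iota s (sigma s x).
Implicit Types (Gam Th : seq S).

Variables (Gam0 : seq S) (E : forall N : structure L, env N Gam0 -> env N Gam0 -> Prop).
Arguments E : clear implicits.
Hypotheses (dE : udef2 E) (Eeq : equivalence (E M)).
Variables (a : env M Gam0) (s0 : S) (v0 : var Gam0 s0).
Arguments a : clear implicits.

Variables (Del : seq S) (k : nat) (phi : forall N : structure L, env N Gam0 -> env N Del -> Prop).
Arguments phi : clear implicits.
Hypotheses (dphi : udef2 phi)
  (phi_code : coding (fun x y => E M x y /\ x s0 v0 = y s0 v0) k (phi M))
  (phi_a : exists d, phi M a d).

Hypotheses (internal : internalizes_codes iota)
  (unary : forall X : set (env M [:: s0]), definable setT X -> coded X)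
  (bounded : forall c : M s0, relative_algebraic_boundedness iota (existT M s0 c)).

Let A : set (elt M) := racl E a.
Let c0 : env M [:: s0] := env_sing (a s0 v0).

Variable p : set (pformula Mt [:: s0]).
Hypotheses (pT : is_type setT p) (p_inv : Defs.invariant (elt_map iota @` A) p)
  (p_fin : fin_sat (@plift S Lt L i M [:: s0] @` Defs.restrict iota p `|` tp A c0)).

Local Notation io := (@io S Lt L i M Mt iota _).

Let extension := extension aut_ext.
Let W := forall s, M s -> M s.

(** The partial function attached to the class of [u]: it sends the [v0]
    coordinate of an element of the class to the tuple attached to the finer
    class of that element. *)
Definition fib (N : structure L) (u : env N Gam0) (c : env N [:: s0]) (d : env N Del) : Prop :=
  exists x : env N Gam0, E N u x /\ (x s0 v0 = c s0 vz /\ phi N x d).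
Arguments fib : clear implicits.

Lemma fib_udef : udef3 fib.
Proof.
apply: dprop_ex; apply: dprop_and; first by apply: (udef2_app dE); dt.
apply: dprop_and; last by apply: (udef2_app dphi); dt.
by apply: (dprop_eqv (t := fun _ r => envl r) (u := fun _ r => envl (envr (envr r)))); dt.
Qed.

Lemma fib_fun u c d d' : fib M u c d -> fib M u c d' -> d = d'.
Proof.
have [Er Es Et] := Eeq; have [p1 p2 p3] := phi_code.
move=> [x [ux [xc xd]]] [x' [ux' [xc' xd']]].
apply: (p1 _ _ _ xd); apply: (p2 _ _ _ _ xd'); split; last by rewrite xc xc'.
by apply: Et ux; exact: Es.
Qed.

Lemma fib_class u u' c d : E M u u' -> fib M u c d -> fib M u' c d.
Proof.
have [Er Es Et] := Eeq; move=> uu' [x [ux xcd]]; exists x; split=> //.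
by apply: Et ux; exact: Es.
Qed.

Lemma fib_finite c d : atmost (E M) k (fun u => fib M u c d).
Proof.
have [Er Es Et] := Eeq; have [p1 p2 p3] := phi_code.
have [z zP] := p3 d; exists z => u [x [ux [_ xd]]].
by have [j jk [Ej _]] := zP _ xd; exists j => //; exact: Et Ej.
Qed.

Lemma fib_aut f u c d : automorphism f -> fib M u c d -> fib M (env_map f u) (env_map f c) (env_map f d).
Proof. by move=> fa; exact: (proj1 (udef3_elementary _ _ _ fib_udef (aut_elementary fa))). Qed.

Lemma small_A : small L A.
Proof. exact: small_racl. Qed.

(** By unary elimination of imaginaries the domain of the function is definable
    over [A], hence invariant under the automorphisms over [A]. *)
Lemma domain_invariant f c : aut_over A f ->
  (exists d, fib M a c d) -> exists d, fib M a (env_map f c) d.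
Proof.
move=> fA; pose X := [set c | exists d, fib M a c d].
have dX : definable setT X.
  apply/definableP; apply: dprop_ex; apply: (udef3_app fib_udef (t := fun _ _ => a)); last by dt.
    exact: (dtup_const (C := fun=> setT)).
  by dt.
have [Th [b [R [XE Rinj]]]] := unary dX.
have Xaut g x : stab E a g -> X x -> X (env_map g x).
  move=> [ga gE] [d ad]; exists (env_map g d).
  have [_ Es _] := Eeq; apply: fib_class (fib_aut ga ad); exact: Es.
have bfix g : stab E a g -> env_map g b = b.
  move=> gH; have [g' gH' [_ gg']] := stab_inv dE Eeq gH.
  apply: contrapT => /nesym/Rinj; apply; rewrite -XE; apply/seteqP; split=> x.
    move=> Xx; have e : env_map g (env_map g' x) = x by apply: env_ext => s v; exact: gg'.
    rewrite -e; change (sat R (env_cat (env_map g (env_map g' x)) (env_map g b))).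
    by rewrite -env_map_cat -(aut_elementary gH.1 R); have := Xaut _ _ gH' Xx; rewrite {1}XE.
  move=> Rx; have e : env_map g (env_map g' x) = x by apply: env_ext => s v; exact: gg'.
  rewrite -e; apply: Xaut => //; rewrite XE; apply/(aut_elementary gH.1 R).
  by rewrite env_map_cat e.
have bA : rng b `<=` A.
  move=> _ [s [v ->]]; apply: (@sub_finite_set _ _ [set existT M s (b s v)]); last exact: finite_set1.
  move=> _ [g gH <-]; rewrite /elt_map /=; congr existT.
  exact: (congr1 (fun y => y s v) (bfix g gH)).
have : definable A X.
  rewrite XE; apply/definableP; apply: (udef2_app (form_udef2 R) (u := fun _ _ => b)); first by dt.
  by apply: (dtup_const (C := fun=> A)).
by move=> dAX; apply: (proj2 (definable_aut c dAX fA)).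
Qed.

(** Realizations of [p] restricted to [C] that are conjugate to [c0] over [A]; being
    conjugate expresses, for the small set [A], having the same type. *)
Definition gen (C : set (elt M)) (c : env M [:: s0]) : Prop :=
  (forall Th (Q : forall N : structure Lt, env N [:: s0] -> env N Th -> Prop) (m : env M Th),
     udef2 Q -> rng m `<=` C -> proves p [set x | Q Mt x (io m)] -> Q Mt (io c) (io m)) /\
  exists2 f, aut_over A f & env_map f c0 = c.

Lemma gen_sub C C' c : C `<=` C' -> gen C' c -> gen C c.
Proof. by move=> CC' [H1 H2]; split=> // Th Q m dQ mC; apply: H1 => // x /mC/CC'. Qed.

(** The same points as the common points of a family of sets, to which
    compactness applies. *)
Let conditions C : set (set (env M [:: s0])) :=
  [set X | (exists Th (Q : forall N : structure Lt, env N [:: s0] -> env N Th -> Prop) (m : env M Th),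
      [/\ udef2 Q, rng m `<=` C, proves p [set x | Q Mt x (io m)] & X = [set c | Q Mt (io c) (io m)]]) \/
    definable A X /\ X c0].

Lemma conditions_gen C c : (forall X, conditions C X -> X c) -> gen C c.
Proof.
move=> cP; split=> [Th Q m dQ mC pQ|].
  by apply: (cP [set c | Q Mt (io c) (io m)]); left; exists Th, Q, m.
have [X dX Xc0|f fA fc] := @conjugate _ _ _ M_hom A _ c0 c small_A; last by exists f.
by apply: cP; right.
Qed.

Lemma gen_conditions C c X : gen C c -> conditions C X -> X c.
Proof.
move=> [c1 [f fA fc]] [[Th [Q [m [dQ mC pQ ->]]]]|[dX Xc0]]; first exact: (c1 _ _ _ dQ mC pQ).
rewrite -fc; exact: (proj2 (definable_aut c0 dX fA) Xc0).
Qed.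

Lemma conditions_definable C X : A `<=` C -> conditions C X -> definable C X.
Proof.
move=> sAC [[Th [Q [m [dQ mC pQ ->]]]]|[dX _]]; last exact: (definable_sub sAC dX).
have [P dP PE] := trace_udef2 Tt_QE Mt_Tt iota_sub dQ.
apply/definable_fibre; exists Th, P, m; split=> //.
by apply/seteqP; split=> x; rewrite /= PE.
Qed.

Lemma conditions_finmeet C Y : finmeet (conditions C) Y -> Y !=set0.
Proof.
pose Sig := @plift S Lt L i M [:: s0] @` Defs.restrict iota p `|` tp A c0.
move=> fY; suff [G [Gf Gp GY]] : exists G, [/\ finite_set G, G `<=` Sig & \bigcap_(phi in G) psat phi `<=` Y].
  by have [x xP] := p_fin Gf Gp; exists x; apply: GY => th /xP.
elim: fY => [|X Z cX _ [G [Gf Gp GZ]]]; first by exists set0; split.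
have [th Sth thX] : exists2 th, Sig th & psat th `<=` X.
  case: cX => [[Th [Q [m [dQ mC pQ ->]]]]|[[th [thA ->]] thc]]; last by exists th => //; right.
  have [psi [qpsi psiMt psiM]] := trace Tt_QE Mt_Tt iota_sub dQ.
  exists (PFormula (M := M) (Defs.lift i psi) m); last by move=> c; rewrite /psat /= psiM.
  left; exists (PFormula (M := reduct i M) psi m) => //; split=> //=.
  apply: (type_proves pT); apply: proves_sub pQ => x /= Qx.
  by rewrite /psat /=; apply/psiMt.
exists ([set th] `|` G); split.
- by rewrite finite_setU; split=> //; exact: finite_set1.
- by move=> q [->|/Gp].
by move=> x xG; split; [apply: thX; apply: xG; left|apply: GZ => psi Gpsi; apply: xG; right].
Qed.

Lemma gen_exists C : small L C -> exists c, gen C c.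
Proof.
move=> sC; have [|||c cP] := @saturation _ _ M M_sat (C `|` A) _ (conditions (C `|` A)).
- exact: smallU sC small_A.
- by move=> X; apply: conditions_definable => x; right.
- exact: conditions_finmeet.
by exists c; apply: gen_sub (conditions_gen cP) => x; left.
Qed.

Lemma proves_definable Th (Q : forall N : structure Lt, env N [:: s0] -> env N Th -> Prop) (w : env Mt Th) :
  udef2 Q -> proves p [set x | Q Mt x w] \/ proves p [set x | ~ Q Mt x w].
Proof.
by move=> dQ; apply: (proves_dec pT); exact: udef2_definable.
Qed.

Lemma gen_proves Th (Q : forall N : structure Lt, env N [:: s0] -> env N Th -> Prop) (m : env M Th) c :
  udef2 Q -> gen (rng m) c -> Q Mt (io c) (io m) -> proves p [set x | Q Mt x (io m)].
Proof.
move=> dQ [c1 _] Qc; have [//|pn] := proves_definable (io m) dQ.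
by have := c1 _ (fun N x w => ~ Q N x w) m (dprop_not dQ) (fun _ => id) pn.
Qed.

Lemma proves_aut Th (Q : forall N : structure Lt, env N [:: s0] -> env N Th -> Prop) (w : env Mt Th) g :
  udef2 Q -> aut_over (elt_map iota @` A) g ->
  proves p [set x | Q Mt x (env_map g w)] <-> proves p [set x | Q Mt x w].
Proof.
move=> /(udef_form (inhabits Mt))[th thE] gA.
have thX (w' : env Mt Th) : psat (PFormula th w') = [set x : env Mt [:: s0] | Q Mt x w'].
  by apply/seteqP; split=> x; rewrite /psat /= thE envlK envrK.
have tp (w' : env Mt Th) : proves p [set x | Q Mt x w'] <-> p (PFormula th w').
  rewrite -thX; split; first exact: type_proves.
  by move=> pth; exists (PFormula th w').
rewrite !tp; exact: (p_inv gA (PFormula th w)).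
Qed.

Lemma gen_aut C c f : aut_over A f -> gen C c -> gen (elt_map f @` C) (env_map f c).
Proof.
move=> fA [c1 [h hA hc]]; split; last first.
  by exists (fun s x => f s (h s x)); [exact: aut_over_comp|rewrite -hc].
have [f' [f'A f'f ff']] := aut_over_inv fA.
have [g ga gf] := extension fA.1.
move=> Th Q m dQ mC pQ.
have mE : m = env_map f (env_map f' m) by apply: env_ext => s v; rewrite /env_map ff'.
have m'C : rng (env_map f' m) `<=` C.
  move=> _ [s [v ->]]; have [[t x] Cx e] := mC _ (rng_env m v).
  by rewrite /env_map -[existT _ _ _]/(elt_map f' (existT M s (m s v))) -e /elt_map /= f'f.
have gA := io_aut_over fA ga gf.
have H := c1 Th Q _ dQ m'C.
rewrite mE -!gf; apply: (proj1 (udef2_elementary _ _ dQ (aut_elementary ga))); apply: H.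
apply/(proves_aut _ dQ gA); move: pQ; rewrite {1}mE -gf; exact.
Qed.

Lemma dom_gen c : gen set0 c -> exists d, fib M a c d.
Proof.
move=> [_ [f fA <-]]; apply: domain_invariant => //.
have [d ad] := phi_a; exists d, a; split; first by have [Er _ _] := Eeq.
by [].
Qed.

Lemma atmost_udef n Th (psi : forall N : structure Lt, env N Del -> env N [:: s0] -> env N Th -> Prop) :
  udef3 psi -> udef2 (fun N x w => atmost eq n (fun y => psi N y x w)).
Proof.
move=> dpsi; apply: (@dprop_atmost _ _ _ id _ _ _ (fun N => @eq (env N Del)) n
  (fun N r y => psi N y (envl r) (envr r))).
- by move=> N; exact: tuple_inhabited.
- exact: eq_udef.
by apply: (udef3_app dpsi); dt.
Qed.

(** [psi] encloses the values at generic points of the function attached to the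
    class of [u] in finite sets definable in the large structure. *)
Definition covers n Th (m : env M Th)
    (psi : forall N : structure Lt, env N Del -> env N [:: s0] -> env N Th -> Prop) (u : env M Gam0) : Prop :=
  [/\ udef3 psi, proves p [set x | atmost eq n (fun y => psi Mt y x (io m))] &
    exists2 C, small L C & forall c, gen C c ->
      exists2 d, fib M u c d & psi Mt (io d) (io c) (io m)].

(** The values of the function at a generic point are algebraic by relative
    boundedness, and by compactness one formula serves for all of them. *)
Lemma covers_exist : exists n Th (m : env M Th) psi, covers n m psi a.
Proof.
have sAa : small L (A `|` rng a) by apply: smallU; [exact: small_A|exact: small_rng].
have [M' [j [je AB sB]]] := lowenheim_skolem sAa.
set B := range (elt_map j) in AB sB.
(* A common point of [conditions B] and [avoid] would have its value outside all
   the finite sets definable over [B] and the point. *)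
pose avoid := [set X | exists n Th (m : env M Th)
   (psi : forall N : structure Lt, env N Del -> env N [:: s0] -> env N Th -> Prop),
   [/\ udef3 psi, rng m `<=` B, proves p [set x | atmost eq n (fun y => psi Mt y x (io m))] &
     X = [set c | forall d, fib M a c d -> ~ psi Mt (io d) (io c) (io m)]]].
have AsB : A `<=` B by move=> x Ax; apply: AB; left.
have aB : rng a `<=` B by move=> x ax; apply: AB; right.
have nocommon c : ~ forall X, (conditions B `|` avoid) X -> X c.
  move=> cP; have cB : gen B c by apply: conditions_gen => X cX; apply: cP; left.
  have [d ad] : exists d, fib M a c d by apply: dom_gen; exact: gen_sub cB.
  have dB : rng (io d) `<=` acl (elt_map iota @` (B `|` rng c)).
    rewrite rng_io => _ [_ [s [v ->]] <-]; rewrite -(env_singE c) rng_sing.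
    apply: (bounded je); rewrite -/B -rng_sing env_singE; apply/definableP.
    apply: (@dprop_ext _ _ _ _ _ _ (fun _ y => exists d', fib M a c d' /\ d' s v = y s vz)).
      move=> _ y; split=> [[d' [ad' e]]|->]; last by exists d.
      by rewrite -[y]env_singE -e -(fib_fun ad ad').
    apply: dprop_ex; apply: dprop_and.
      apply: (udef3_app fib_udef (t := fun _ _ => a) (u := fun _ _ => c)); last by dt.
        by apply: (dtup_const (C := fun=> B `|` rng c)) => _ x /aB; left.
      by apply: (dtup_const (C := fun=> B `|` rng c)) => _ x; right.
    by apply: (dprop_eqv (t := fun _ r => envl r) (u := fun _ r => envr r)); dt.
  have [X [dX fX Xd]] := acl_tuple dB.
  rewrite image_setU -rng_io in dX.
  have [Th [psi [m' [dpsi mB XE]]]] := definable_split dX.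
  have [m mB' mE] := io_lift mB; subst m'.
  rewrite XE in Xd fX.
  have [n nP] := finite_atmost (tuple_inhabited Mt Del) fX.
  have pn : proves p [set x | atmost eq n (fun y => psi Mt y x (io m))].
    exact: (gen_proves (atmost_udef n dpsi) (gen_sub mB' cB) nP).
  have := cP [set c | forall d, fib M a c d -> ~ psi Mt (io d) (io c) (io m)].
  by apply; [right; exists n, Th, m, psi|exact: ad|exact: Xd].
have [Y fY Y0] : exists2 Y, finmeet (conditions B `|` avoid) Y & forall c, ~ Y c.
  apply: contrapT => nY; have [||c cP] := @saturation _ _ M M_sat B _ (conditions B `|` avoid) sB.
  - move=> X [|[n [Th [m [psi [dpsi mB pn ->]]]]]]; first exact: conditions_definable.
    have [P dP PE] := trace_udef3 Tt_QE Mt_Tt iota_sub dpsi.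
    apply/definableP; apply: (@dprop_ext _ _ _ _ _ _ (fun _ c => forall d, fib M a c d -> ~ P M d c m)).
      by move=> _ c; split=> H d /H; rewrite PE.
    apply: dprop_all; apply: dprop_imp.
      apply: (udef3_app fib_udef (t := fun _ _ => a)); last by dt.
        exact: (dtup_const (C := fun=> B)).
      by dt.
    apply: dprop_not; apply: (udef3_app dP (w := fun _ _ => m)); [by dt|by dt|].
    exact: (dtup_const (C := fun=> B)).
  - move=> Y fY; apply: contrapT => Y0; apply: nY; exists Y => // c Yc.
    by apply: Y0; exists c.
  exact: nocommon cP.
suff [n [Th [m [psi [dpsi mB pn psiP]]]]] : exists n Th (m : env M Th)
   (psi : forall N : structure Lt, env N Del -> env N [:: s0] -> env N Th -> Prop),
   [/\ udef3 psi, rng m `<=` B, proves p [set x | atmost eq n (fun y => psi Mt y x (io m))] &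
     forall c, gen B c -> Y c \/ exists2 d, fib M a c d & psi Mt (io d) (io c) (io m)].
  exists n, Th, m, psi; split=> //; exists B => // c /psiP[/Y0|] //.
have [d0] := tuple_inhabited Mt Del.
elim: fY {Y0} => [|X Z FX _ [n [Th [m [psi [dpsi mB pn psiP]]]]]].
  exists 0, [::], env_nil, (fun _ _ _ _ => False); split.
  - exact: dprop_False.
  - by move=> x [s [v]]; case: (var_nilP v).
  - by apply: proves_sub (proves_setT pT) => x _; exists (fun=> d0).
  - by left.
case: FX => [cX|[n' [Th' [m' [psi' [dpsi' mB' pn' ->]]]]]].
  exists n, Th, m, psi; split=> // c cB; have [Zc|] := psiP c cB; last by right.
  by left; split=> //; exact: gen_conditions cX.
exists (n + n'), (Th ++ Th'), (env_cat m m'),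
  (fun N y x w => psi N y x (envl w) \/ psi' N y x (envr w)).
have dpp : udef3 (fun (N : structure Lt) (y : env N Del) (x : env N [:: s0]) (w : env N (Th ++ Th')) =>
    psi N y x (envl w) \/ psi' N y x (envr w)).
  by apply: dprop_or; [apply: (udef3_app dpsi)|apply: (udef3_app dpsi')]; dt.
split=> //; first exact/rng_cat.
  have dn := atmost_udef n dpsi; have dn' := atmost_udef n' dpsi'.
  apply: proves_sub (proves_and pT _ _ pn pn').
  - by move=> x [H H'] /=; rewrite !io_cat envlK envrK; exact: atmost_or.
  - exact: (udef2_definable dn (fun _ _ => I)).
  - exact: (udef2_definable dn' (fun _ _ => I)).
move=> c cB; rewrite io_cat !envlK !envrK; have [Zc|[d ad dpsi'']] := psiP c cB; last first.
  by right; exists d => //; left.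
have [nX|] := pselect (forall d, fib M a c d -> ~ psi' Mt (io d) (io c) (io m')); first by left.
move=> /existsNP[d /not_implyP[ad /contrapT dd]]; right; exists d => //; by right.
Qed.

Lemma covers_aut n Th (m : env M Th) psi u f : aut_over A f ->
  covers n m psi u -> covers n (env_map f m) psi (env_map f u).
Proof.
move=> fA [dpsi pn [C sC Cgen]]; have [g ga gf] := extension fA.1.
have gA := io_aut_over fA ga gf.
split=> //; first by rewrite -gf; apply/(proves_aut _ (atmost_udef n dpsi) gA).
have [f' [f'A f'f ff']] := aut_over_inv fA.
exists (elt_map f @` C); first exact: small_image.
move=> c cC; have c'C : gen C (env_map f' c).
  apply: gen_sub (gen_aut f'A cC) => -[s x] Cx; exists (existT M s (f s x)); first by exists (existT M s x).
  by rewrite /elt_map /= f'f.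
have cE : env_map f (env_map f' c) = c by apply: env_ext => s v; exact: ff'.
have [d ud psid] := Cgen _ c'C; exists (env_map f d); first by rewrite -cE; exact: fib_aut fA.1 ud.
have := proj1 (udef3_elementary _ _ _ dpsi (aut_elementary ga)) psid.
by rewrite !gf cE.
Qed.

Lemma covers_cap n n' Th (m : env M Th) psi Th' (m' : env M Th') psi' n'' u :
  covers n m psi u -> covers n' m' psi' u ->
  proves p [set x | atmost eq n'' (fun y => psi Mt y x (io m) /\ psi' Mt y x (io m'))] ->
  covers n'' (env_cat m m') (fun N y x w => psi N y x (envl w) /\ psi' N y x (envr w)) u.
Proof.
move=> [dpsi pn [C sC Cgen]] [dpsi' pn' [C' sC' Cgen']] pn''; split.
- by apply: dprop_and; [apply: (udef3_app dpsi)|apply: (udef3_app dpsi')]; dt.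
- by rewrite io_cat envlK envrK.
exists (C `|` C'); first exact: smallU.
move=> c cCC; have [d ud psid] : exists2 d, fib M u c d & psi Mt (io d) (io c) (io m).
  by apply: Cgen; apply: gen_sub cCC => x; left.
have [d' ud' psid'] : exists2 d, fib M u c d & psi' Mt (io d) (io c) (io m').
  by apply: Cgen'; apply: gen_sub cCC => x; right.
exists d => //; rewrite io_cat envlK envrK; split=> //.
by rewrite (fib_fun ud ud').
Qed.

Definition least n Th (m : env M Th) psi : Prop :=
  covers n m psi a /\
  forall n' Th' (m' : env M Th') psi', covers n' m' psi' a -> n <= n'.

Lemma least_exists : exists n Th (m : env M Th) psi, least n m psi.
Proof.
have [n0 [Th0 [m0 [psi0 c0']]]] := covers_exist.
have ex : exists n, `[< exists Th (m : env M Th) psi, covers n m psi a >].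
  by exists n0; apply/asboolP; exists Th0, m0, psi0.
have [n /asboolP[Th [m [psi nP]]] nmin] := ex_minnP ex.
exists n, Th, m, psi; split=> // n' Th' m' psi' c'; apply: nmin; apply/asboolP.
by exists Th', m', psi'.
Qed.

Lemma covers_pos n Th (m : env M Th) psi : covers n m psi a -> 0 < n.
Proof.
case: n => // -[dpsi p0 [C sC Cgen]].
have [c cC] := gen_exists (smallU sC (small_rng _ m)).
have [d ad psid] : exists2 d, fib M a c d & psi Mt (io d) (io c) (io m).
  by apply: Cgen; apply: gen_sub cC => x; left.
have : atmost eq 0 (fun y => psi Mt y (io c) (io m)).
  by apply: cC.1 (atmost_udef 0 dpsi) _ p0 => x; right.
by move=> /atmost0-/(_ (tuple_inhabited _ _))/(_ (io d)).
Qed.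

(** Intersecting with another cover of the same class cannot lower the least
    number of values, so the least cover is contained in it. *)
Lemma least_sub n n' Th (m : env M Th) psi Th' (m' : env M Th') psi' :
  least n m psi -> covers n' m' psi' a ->
  proves p [set x | forall y, psi Mt y x (io m) -> psi' Mt y x (io m')].
Proof.
move=> [cov nmin] cov'; have npos := covers_pos cov.
have [dpsi pn _] := cov; have [dpsi' pn' _] := cov'.
pose Q (N : structure Lt) (x : env N [:: s0]) (w : env N (Th ++ Th')) :=
  forall y : env N Del, psi N y x (envl w) -> psi' N y x (envr w).
have dQ : udef2 Q.
  apply: dprop_all; apply: dprop_imp; first by apply: (udef3_app dpsi); dt.
  by apply: (udef3_app dpsi'); dt.
have := proves_definable (io (env_cat m m')) dQ; rewrite /Q io_cat envlK envrK => -[//|pnQ].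
suff /nmin : covers n.-1 (env_cat m m') (fun N y x w => psi N y x (envl w) /\ psi' N y x (envr w)) a.
  by rewrite -ltnS prednK // ltnn.
apply: covers_cap cov cov' _; apply: proves_sub (proves_and pT _ _ pn pnQ).
- move=> x [/= xn /existsNP[y /not_implyP[py npy]]].
  by apply: atmost_strict xn; [move=> z []|exists y => // -[]].
- exact: (udef2_definable (atmost_udef n dpsi) (fun _ _ => I)).
- have := @udef2_definable _ _ Mt setT _ _ (fun N x w => ~ Q N x w) (io (env_cat m m')) (dprop_not dQ).
  by rewrite /Q io_cat envlK envrK; apply.
Qed.

Lemma least_eq n Th (m : env M Th) psi Th' (m' : env M Th') psi' :
  least n m psi -> covers n m' psi' a ->
  proves p [set x | forall y, psi Mt y x (io m) <-> psi' Mt y x (io m')].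
Proof.
move=> lea cov'; have lea' : least n m' psi' by split=> //; exact: lea.2.
have p1 := least_sub lea cov'; have p2 := least_sub lea' lea.1.
have [dpsi _ _] := lea.1; have [dpsi' _ _] := cov'.
have D G1 (w1 : env M G1) th1 G2 (w2 : env M G2) th2 : udef3 th1 -> udef3 th2 ->
    definable setT [set x : env Mt [:: s0] | forall y : env Mt Del, th1 Mt y x (io w1) -> th2 Mt y x (io w2)].
  move=> d1 d2; apply/definable_fibre.
  exists (G1 ++ G2), (fun (N : structure Lt) (x : env N [:: s0]) (w : env N (G1 ++ G2)) =>
      forall y : env N Del, th1 N y x (envl w) -> th2 N y x (envr w)),
    (io (env_cat w1 w2)); split=> //; last by rewrite io_cat envlK envrK.
  apply: dprop_all; apply: dprop_imp; first by apply: (udef3_app d1); dt.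
  by apply: (udef3_app d2); dt.
apply: proves_sub (proves_and pT _ _ p1 p2); last 2 first.
- exact: D.
- exact: D.
by move=> x [H1 H2] y; split; [exact: H1|exact: H2].
Qed.

Hypothesis p_germ : forall (Del' : seq S) (r : pformula Mt (s0 :: Del')),
  is_function r -> proves p (Defs.domain r) ->
  forall (Th : seq S) (b : env Mt Th), is_code (psat r) b ->
  exists (I : Type) (le : I -> I -> Prop) (eps : I -> elt Mt),
    [/\ directed_order le,
        forall k, dcl (elt_map iota @` A `|` rng b) (eps k) &
        forall sigma, aut_over (elt_map iota @` A) sigma ->
          (same_germ p r (pmap_params sigma r) <->
           exists k0, forall k, le k0 k -> fixes sigma (eps k))].

(** The code of the fibres of a least cover is a function whose germ is fixed by
    the automorphisms over [A] fixing the class of [a].  Its germ is governed by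
    tuples of [M] almost all of which lie in [A]: otherwise one automorphism
    would move all those outside [A].  So the germ is fixed by all automorphisms
    over [A]. *)
Lemma germ_fixed n Th (m : env M Th) psi f : least n m psi -> aut_over A f ->
  proves p [set x | forall y, psi Mt y x (io m) <-> psi Mt y x (io (env_map f m))].
Proof.
move=> lea; have [[dpsi _ _] _] := lea.
have [c cm] := gen_exists (small_rng _ m).
have [Ts [b0 [R [WE Rinj]]]] : coded [set y | psi Mt y (io c) (io m)].
  apply: (Tt_EI Mt_Tt); apply/definableP.
  apply: (udef3_app dpsi (u := fun _ _ => io c) (w := fun _ _ => io m)); first by dt.
    by apply: (dtup_const (C := fun=> setT)).
  by apply: (dtup_const (C := fun=> setT)).
(* [rel x y w]: the tuple [y] codes by [R] the fibre at [x].  The formula [R] codes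
   the fibre at one generic point, hence at all of them. *)
pose rel (N : structure Lt) (x : env N [:: s0]) (y : env N Ts) (w : env N Th) :=
  (forall z, psi N z x w <-> sat R (env_cat z y)) /\
  forall y', (forall z, sat R (env_cat z y') <-> sat R (env_cat z y)) -> y' = y.
have drel : udef3 rel.
  apply: dprop_and.
    apply: dprop_all; apply: dprop_iff; first by apply: (udef3_app dpsi); dt.
    by apply: (udef2_app (form_udef2 R)); dt.
  apply: dprop_all; apply: dprop_imp; last by apply: dprop_eq; dt.
  by apply: dprop_all; apply: dprop_iff; apply: (udef2_app (form_udef2 R)); dt.
have rel_fun x y y' w : rel Mt x y w -> rel Mt x y' w -> y = y'.
  by move=> [ry uy] [ry' uy']; apply: uy' => z; rewrite -ry -ry'.
have drel2 : udef2 (fun N (u : env N ([:: s0] ++ Ts)) w => rel N (envl u) (envr u) w).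
  by apply: (udef3_app drel); dt.
have [phir phirE] := udef_form (inhabits Mt) drel2.
pose r : pformula Mt (s0 :: Ts) := @PFormula S Lt Mt (s0 :: Ts) Th phir (io m).
have rE g (x : env Mt [:: s0]) (y : env Mt Ts) :
    psat (pmap_params g r) (env_cat x y) <-> rel Mt x y (env_map g (io m)).
  rewrite -[psat _ _]/(sat phir (env_cat (env_cat x y) (env_map g (io m)))).
  by rewrite phirE !envlK !envrK.
have rE1 (x : env Mt [:: s0]) (y : env Mt Ts) : psat r (env_cat x y) <-> rel Mt x y (io m).
  rewrite -[psat _ _]/(sat phir (env_cat (env_cat x y) (io m))).
  by rewrite phirE !envlK !envrK.
have pdom : proves p [set x | exists y, rel Mt x y (io m)].
  apply: (@gen_proves _ (fun N x w => exists y, rel N x y w) m c) => //.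
    by apply: dprop_ex; apply: (udef3_app drel); dt.
  exists b0; split=> [z|y' y'E]; first by move: WE => /(congr1 (fun X => X z)) /= ->.
  apply: contrapT => /nesym/Rinj; apply; apply/seteqP.
  by split=> z /y'E.
have rfun : is_function r.
  by move=> x y y' /(rE1 (env_sing x)) ry /(rE1 (env_sing x)) ry'; exact: rel_fun ry ry'.
have rdom : proves p (Defs.domain r).
  by apply: proves_sub pdom => x [y xy]; exists y; move/rE1: xy; rewrite -{1}(env_singE x).
have [Tb [b codeb]] : coded (psat r) by apply: (Tt_EI Mt_Tt); exists r.
have [I [le [eps [dir eps_dcl eps_fix]]]] := p_germ rfun rdom codeb.
have b_dcl : rng b `<=` dcl (rng (io m)) by apply: (code_dcl codeb); exists r; split=> // x.
have eps_M l : dcl (range (elt_map iota)) (eps l).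
  apply: (@dcl_dcl _ _ _ (elt_map iota @` A `|` rng b)) => // x [[y _ <-]|/b_dcl].
    by apply: sub_dcl; exists y.
  by apply: definable_sub; rewrite rng_io => _ [y _ <-]; exists y.
(* For automorphisms coming from [M], fixing the germ of [r] means that the type
   says that [r] agrees with its image. *)
have germP h g : aut_over A h -> automorphism g ->
    (forall Gam (x : env M Gam), env_map g (io x) = io (env_map h x)) ->
    (exists l0, forall l, le l0 l -> fixes g (eps l)) <->
    proves p [set x | exists y, rel Mt x y (io m) /\ rel Mt x y (io (env_map h m))].
  move=> hA ga gh; rewrite -(eps_fix g (io_aut_over hA ga gh)) (same_germP _ _ pT).
  have -> // : [set x : env Mt [:: s0] | exists y, psat r (env_cat x y) /\ psat (pmap_params g r) (env_cat x y)] =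
    [set x | exists y, rel Mt x y (io m) /\ rel Mt x y (io (env_map h m))].
  by apply/seteqP; split=> x [y [/rE1 H1 H2]]; exists y; split=> //; move: H2; rewrite ?rE ?rE1 gh.
pose B := [set x : elt M | forall h, aut_over (A `|` rng m) h -> fixes h x].
have sAm : small L (A `|` rng m) by apply: smallU; [exact: small_A|exact: small_rng].
have sB : small L B.
  apply: small_sub (small_acl sAm) => -[s x] xB.
  apply: (finite_orbit_acl M_sat M_hom (k := 1) sAm); exists (fun=> x) => _ [h hA ->].
  by exists 0 => //; apply/fixesE; exact: xB.
(* The tuple internalizing [eps l] is fixed by the automorphisms over [A] and [m],
   so it lies in the small set [B], whatever the size of the index set. *)
have /choice[eta etaP] (l : I) : exists eta : {Gam : seq S & env M Gam},
    rng (projT2 eta) `<=` B /\ forall h g, automorphism h -> automorphism g ->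
      (forall Gam (x : env M Gam), env_map g (io x) = io (env_map h x)) ->
      fixes g (eps l) <-> env_map h (projT2 eta) = projT2 eta.
  have [Gam [eta etaP]] := internal (eps_M l).
  have etaE h g : automorphism h -> automorphism g ->
      (forall Gam (x : env M Gam), env_map g (io x) = io (env_map h x)) ->
      fixes g (eps l) <-> env_map h eta = eta.
    move=> ha ga gh; rewrite (etaP g ga (io_range ha gh)) (io_fixes _ _ eta) gh.
    by split=> [/(io_inj iota_sub)|->].
  exists (existT _ Gam eta); split=> //= x xeta h hA.
  have [g ga gh] := extension hA.1.
  suff : fixes g (eps l) by move=> /(etaE h g hA.1 ga gh) /fixes_env; apply.
  have gm : env_map g (io m) = io m.
    by rewrite gh (aut_over_env hA) // => y ym; right.
  have gb : env_map g b = b.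
    apply/(code_aut codeb ga) => z; rewrite /psat /=.
    by rewrite [X in _ <-> X](aut_elementary ga phir) env_map_cat gm.
  have gAb : aut_over (elt_map iota @` A `|` rng b) g.
    split=> // y [Ay|]; last exact: (proj2 (fixes_env g b) gb).
    have hA' : aut_over A h by split=> [|z Az]; [exact: hA.1|apply: hA.2; left].
    exact: (io_aut_over hA' ga gh).2.
  move: (eps_dcl l); case: (eps l) => s y dy.
  by have /= := definable_aut (env_sing y) dy gAb; rewrite env_map_sing => -[_ /(_ erefl)] /(congr1 (fun z => z s vz)) /= e; apply/fixesE.
(* The elements of [B] outside [A] have infinite orbits under [H], so a limit of
   members of [H] moves all of them. *)
pose H := [set h : W | aut_over A h /\ stab E a h].
pose C := A `|` B `|` rng a.
have sC : small L C by apply: smallU; [apply: smallU => //; exact: small_A|exact: small_rng].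
have [|||||||tau [ta tauP tau_move]] := @move_all _ _ _ M_sat M_hom H C [set x | B x /\ ~ A x].
- by move=> h [[]].
- by split; [split=> [|x _]; [exact: aut_id|case: x]|exact: (stab_id Eeq)].
- by move=> h h' [hA hH] [h'A h'H]; split; [exact: aut_over_comp|exact: stab_comp].
- move=> h [hA hH]; have [h' h'H [h'h hh']] := stab_inv dE Eeq hH; exists h' => //.
  split=> //; split=> [|[s x] Ax]; first exact: h'H.1.
  by apply/fixesE; rewrite -[in LHS](proj1 (fixesE _ _) (hA.2 _ Ax)).
- exact: sC.
- by move=> x [Bx _]; left; right.
- by move=> x [_ nAx]; exact: racl_infinite.
have tauA : aut_over A tau.
  split=> // -[s x] Ax; apply/fixesE.
  have := tauP _ _ (env_sing x) (env_sing x) (fun N u v => u s vz = v s vz); apply.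
  - by rewrite rng_sing => _ ->; left; left.
  - by rewrite rng_sing => _ ->; left; left.
  - by apply: (dprop_eqv (t := fun _ r => envl r) (u := fun _ r => envr r)); dt.
  - by move=> h [hA _]; apply/fixesE; exact: hA.2.
have tauE : E M a (env_map tau a).
  apply: (tauP _ _ a a (fun N u v => E N v u)).
  - by move=> x ax; right.
  - by move=> x ax; right.
  - by apply: (udef2_app dE); dt.
  - by move=> h [_ []].
have [g ga gtau] := extension ta.
have [l0 l0P] : exists l0, forall l, le l0 l -> fixes g (eps l).
  apply/(germP tau g tauA ga gtau).
  have cov : covers n (env_map tau m) psi a.
    have [dp pn [C' sC' C'P]] := covers_aut tauA lea.1.
    split=> //; exists C' => // x /C'P[d ud xd]; exists d => //.
    by apply: fib_class ud; have [_ Es _] := Eeq; exact: Es.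
  have := least_eq lea cov; move=> peq.
  apply: proves_sub (proves_and pT _ _ pdom peq).
  - by move=> x [[y [xy uy]] /= weq]; exists y; split=> //; split=> // z; rewrite -weq.
  - by apply: (udef2_definable (Q := fun N x w => exists y, rel N x y w)) => //; apply: dprop_ex; apply: (udef3_app drel); dt.
  - have := @udef2_definable _ _ Mt setT _ _ (fun N x (w : env N (Th ++ Th)) =>
      forall y, psi N y x (envl w) <-> psi N y x (envr w)) (io (env_cat m (env_map tau m))).
    rewrite io_cat envlK envrK; apply=> //.
    by apply: dprop_all; apply: dprop_iff; apply: (udef3_app dpsi); dt.
have etaA l : le l0 l -> rng (projT2 (eta l)) `<=` A.
  move=> ll; have [etaB etaF] := etaP l => x xeta.
  apply: contrapT => nAx; apply: (tau_move x); first by split=> //; exact: etaB.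
  have /(etaF tau g ta ga gtau) := l0P l ll.
  by move=> /fixes_env; apply.
move=> fA; have [g' ga' gf] := extension fA.1.
have : exists l0, forall l, le l0 l -> fixes g' (eps l).
  exists l0 => l ll; have [_ etaF] := etaP l; apply/(etaF f g' fA.1 ga' gf).
  by apply: aut_over_env fA _; exact: etaA.
move=> /(germP f g' fA ga' gf); apply: proves_sub => x [y [[H1 _] [H2 _]]] z.
by rewrite H1 H2.
Qed.

(** At a generic point the functions attached to all these conjugates take values
    in one finite set, and a value determines the class up to finitely many
    choices. *)
Theorem conjugates_finite :
  exists N, atmost (E M) N [set x | exists2 f, aut_over A f & x = env_map f a].
Proof.
have [Er Es Et] := Eeq.
have [n [Th [m [psi lea]]]] := least_exists; have [dpsi pn [C sC CP]] := lea.1.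
exists (n * k); apply: atmost_pairwise => // u uP.
have /choice[fC fCP] (j : nat) : exists fC : W * set (elt M), small L fC.2 /\ (j <= n * k ->
    aut_over A fC.1 /\ forall c, gen fC.2 c ->
      exists2 d, fib M (u j) c d & psi Mt (io d) (io c) (io (env_map fC.1 m))).
  have [jn|nj] := boolP (j <= n * k); last first.
    by exists ((fun s x => x), set0); split=> //; exact: small_finite.
  have [f fA uf] := uP j jn; have [_ _ [C' sC' C'P]] := covers_aut fA lea.1.
  by exists (f, C'); split=> // _; split=> // c; rewrite uf; exact: C'P.
pose D := \bigcup_(j in [set: nat]) ((fC j).2 `|` rng (env_map (fC j).1 m)).
have sD : small L (D `|` rng m).
  apply: smallU; last exact: small_rng.
  apply: small_bigcup => [|j _]; first exact: small_nat.
  by apply: smallU; [exact: (fCP j).1|exact: small_rng].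
have [c cD] := gen_exists sD.
have cn : atmost eq n (fun d : env M Del => psi Mt (io d) (io c) (io m)).
  apply: (atmost_preimage (f := fun d : env M Del => io d) (P := fun y => psi Mt y (io c) (io m))).
  - exact: tuple_inhabited.
  - by move=> x y /(io_inj iota_sub).
  - by apply: (cD.1 _ _ m (atmost_udef n dpsi)) => // x xm; right.
have H : atmost (E M) (n * k) (fun v => exists2 d, psi Mt (io d) (io c) (io m) & fib M v c d).
  apply: (atmost_bind (E' := eq) (Q := fun d v => fib M v c d)) => //.
    by move=> d d' -> .
  by move=> d; exact: fib_finite.
apply: (pigeonhole _ H) => [x y z xz yz|j jn]; first by apply: Et xz _; exact: Es.
have [sC' /(_ jn)[fA /(_ c)[|d ud psid]]] := fCP j.
  by apply: gen_sub cD => x Cx; left; exists j => //; left.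
exists d => //.
have peq := germ_fixed lea fA.
have deq : udef2 (fun (N : structure Lt) (x : env N [:: s0]) (w : env N (Th ++ Th)) =>
    forall y, psi N y x (envl w) <-> psi N y x (envr w)).
  by apply: dprop_all; apply: dprop_iff; apply: (udef3_app dpsi); dt.
have := cD.1 _ _ (env_cat m (env_map (fC j).1 m)) deq.
rewrite io_cat envlK envrK => /(_ _ peq)-> //.
by apply/rng_cat; split=> x xm; [right|left; exists j => //; right].
Qed.

(** The finite set of conjugates of a tuple of [A] over which the class of [a]
    is algebraic has a code in [M]; that code is determined by the class, and
    conversely the class is algebraic over it. *)
Theorem coordinate_step : ucoded E a.
Proof.
have [Er Es Et] := Eeq; have [N [z zP]] := conjugates_finite.
have [|||chi [/definable_fibre[Th [P [m [dP mA ->]]]] chia chiP]] :=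
    @isolate _ _ _ M_sat M_hom A _ a [set x | exists2 j, j < N & E M x (z j)].
- exact: small_A.
- exact: definable_cover.
- by move=> f fA; apply: zP; exists f.
pose D := [set env_map h m | h in stab E a].
have Df : finite_set D by exact: racl_tuple.
have [Del' [eta etaP]] := finite_code Tt_EI Mt_Tt iota_sub aut_ext internal Df.
have [kD Dk] := finite_atmost (tuple_inhabited M Th) Df.
have Dstab f x : stab E a f -> D x -> D (env_map f x).
  by move=> fH [h hH <-]; exists (fun s x => f s (h s x)) => //; exact: stab_comp.
apply: (orbit_ucoded M_sat M_hom dE Eeq (eta := eta) (k := kD * N)).
  move=> f fH; apply/(etaP f fH.1) => x; split; last exact: Dstab.
  have [f' f'H [f'f _]] := stab_inv dE Eeq fH.
  move=> /(Dstab f' _ f'H); rewrite env_map_comp.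
  by have -> : env_map (fun s y => f' s (f s y)) x = x by apply: env_ext => t v; exact: f'f.
(* The bound [chiP] at [m] is carried by automorphisms to the conjugates of [m]. *)
have at1 m' : atmost (E M) N (fun t => D m' /\ P M t m').
  have [[h hH hm]|nD] := pselect (D m'); last by exists z => t [].
  have [h' h'H [h'h hh']] := stab_inv dE Eeq hH.
  exists (fun j => env_map h (z j)) => t [_ Pt].
  have Pt' : P M (env_map h' t) m.
    have := proj1 (udef2_elementary _ _ dP (aut_elementary h'H.1)) Pt; rewrite -hm env_map_comp.
    by have -> : env_map (fun s y => h' s (h s y)) m = m by apply: env_ext => u v; exact: h'h.
  have [j jN Ej] := chiP _ Pt'; exists j => //.
  have := E_aut dE hH.1 Ej; rewrite env_map_comp.
  by have -> : env_map (fun s y => h s (h' s y)) t = t by apply: env_ext => u v; exact: hh'.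
apply: atmost_sub (atmost_bind (inhabits a) Dk _ at1); last by move=> u u' ->.
move=> _ [f feta ->].
have Dfm : D (env_map f m).
  apply: (proj2 (proj1 (etaP f feta.1) _ m)); first exact: (aut_over_env feta).
  by exists (fun s x => x) => //; exact: (stab_id Eeq).
exists (env_map f m); last first.
  split; last exact: (proj1 (udef2_elementary a m dP (aut_elementary feta.1)) chia).
  exact: Dfm.
exact: Dfm.
Qed.

End Analysis.
(** * Elimination of imaginaries *)

Section Dominant.
Variables (S : Type) (L : language S) (T : theory L).
Implicit Types (Gam : seq S).

Lemma dominant_cover Gam :
  exists Gam' (H : forall N : structure L, env N Gam' -> env N Gam -> Prop),
    [/\ udef2 H, forall t, var Gam' t -> dominant T t &
      forall N, models N T -> (forall x y y', H N x y -> H N x y' -> y = y') /\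
                              (forall y, exists x, H N x y)].
Proof.
elim: Gam => [|s Gam [Gam' [H [dH domH HP]]]].
  exists [::], (fun N x y => x = y); split; first exact: eq_udef.
    by move=> t v; case: (var_nilP v).
  by move=> N _; split=> [x y y' <- <-//|y]; exists y.
have [Gs [phi [domGs phiP]]] := @dominantP S L T s.
exists (Gs ++ Gam'), (fun (N : structure L) (x : env N (Gs ++ Gam')) (y : env N ([:: s] ++ Gam)) =>
  sat (Gam := [:: s] ++ Gs) phi (env_cat (envl y) (envl x)) /\ H N (envr x) (envr y)); split.
- apply: dprop_and; last by apply: (udef2_app dH); dt.
  by apply: (udef2_app (form_udef2 (G1 := [:: s]) (G2 := Gs) phi)); dt.
- by move=> t; move: t; apply: var_cat_ind.
move=> N N_T; have [phi1 phi2] := phiP N N_T; have [H1 H2] := HP N N_T.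
split=> [x y y' [py Hy] [py' Hy']|y].
  have er : envr (y : env N ([:: s] ++ Gam)) = envr (y' : env N ([:: s] ++ Gam)) by exact: H1 Hy Hy'.
  have el : envl (y : env N ([:: s] ++ Gam)) = envl (y' : env N ([:: s] ++ Gam)).
    by rewrite -[LHS]env_singE -[RHS]env_singE; congr env_sing; exact: phi1 py py'.
  by rewrite -(@env_catK _ _ [:: s] Gam y) el er env_catK.
have [x0 x0P] := phi2 (envl (y : env N ([:: s] ++ Gam)) s vz).
have [x1 x1P] := H2 (envr (y : env N ([:: s] ++ Gam))).
by exists (env_cat x0 x1); rewrite envlK envrK.
Qed.

(** Codes for the classes of the pullback of [E] along a definable partial
    surjection are codes for the classes of [E]; the tuples outside the domain of
    the surjection are put in one more class. *)
Lemma ucoded_pullback (M : structure L) Gam Gam' (H : forall N : structure L, env N Gam' -> env N Gam -> Prop)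
  (E : forall N : structure L, env N Gam -> env N Gam -> Prop) : udef2 H -> udef2 E ->
  (forall x y y', H M x y -> H M x y' -> y = y') -> (forall y, exists x, H M x y) ->
  equivalence (E M) ->
  (forall E' : forall N : structure L, env N Gam' -> env N Gam' -> Prop,
     udef2 E' -> equivalence (E' M) -> forall a', ucoded E' (a' : env M Gam')) ->
  forall a : env M Gam, ucoded E a.
Proof.
move=> dH dE Hfun Hsurj [Er Es Et] cod a.
pose E' (N : structure L) (x' y' : env N Gam') :=
  (exists x, exists y, H N x' x /\ (H N y' y /\ E N x y)) \/
  (~ (exists x, H N x' x) /\ ~ (exists y, H N y' y)).
have dE' : udef2 E'.
  apply: dprop_or; last first.
    by apply: dprop_and; apply: dprop_not; apply: dprop_ex; apply: (udef2_app dH); dt.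
  apply: dprop_ex; apply: dprop_ex; apply: dprop_and; first by apply: (udef2_app dH); dt.
  by apply: dprop_and; [apply: (udef2_app dH)|apply: (udef2_app dE)]; dt.
have HE x' x y' y : H M x' x -> H M y' y -> E' M x' y' <-> E M x y.
  move=> Hx Hy; split=> [[[x1 [y1 [Hx1 [Hy1 e]]]]|[[]]]|e]; last by left; exists x, y.
    by rewrite (Hfun _ _ _ Hx Hx1) (Hfun _ _ _ Hy Hy1).
  by exists x.
have E'eq : equivalence (E' M).
  split=> [x|x y|x y z].
  - have [[y Hy]|] := pselect (exists y, H M x y); last by right.
    exact/(HE _ _ _ _ Hy Hy).
  - move=> [[x1 [y1 [Hx [Hy e]]]]|[nx ny]]; last by right.
    by left; exists y1, x1; split=> //; split=> //; exact: Es.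
  move=> [[x1 [y1 [Hx [Hy e]]]]|[nx ny]] [[y2 [z2 [Hy2 [Hz e2]]]]|[ny' nz]].
  - left; exists x1, z2; split=> //; split=> //; apply: Et e _.
    by rewrite (Hfun _ _ _ Hy Hy2).
  - by case: ny'; exists y1.
  - by case: ny; exists y2.
  - by right.
have [a' Ha] := Hsurj a.
have [Del [k [phi [dphi [p1 p2 p3] [d phid]]]]] := cod E' dE' E'eq a'.
exists Del, k, (fun N x y => exists x', H N x' x /\ phi N x' y); split; last by exists d, a'.
  by apply: dprop_ex; apply: dprop_and; [apply: (udef2_app dH)|apply: (udef2_app dphi)]; dt.
split=> [x y y' [x1 [Hx1 xy1]] [x2 [Hx2 xy2]]|x1 x2 y e [x1' [Hx1 xy]]|y].
- by apply: p1 xy2; apply: p2 xy1; apply/(HE _ _ _ _ Hx1 Hx2); exact: Er.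
- have [x2' Hx2] := Hsurj x2; exists x2'; split=> //.
  by apply: p2 xy; apply/(HE _ _ _ _ Hx1 Hx2).
have [z' zP] := p3 y.
have /choice[z zH] (j : nat) : exists z, (exists x, H M (z' j) x) -> H M (z' j) z.
  by have [[x Hx]|n] := pselect (exists x, H M (z' j) x); [exists x|exists a].
exists z => x [x' [Hx /zP[j jk e]]]; exists j => //.
have Hz : H M (z' j) (z j).
  by apply: zH; case: e => [[x1 [y1 [_ [Hy _]]]]|[[]]]; [exists y1|exists x].
exact/(HE _ _ _ _ Hx Hz).
Qed.

End Dominant.

(** The list [V] contains the coordinates that may vary inside a class; by
    refining [E] one of them is frozen, and the list gets shorter. *)
Lemma ucoded_dominant (S : Type) (Lt L : language S) (i : sublanguage Lt L)
  (Tt : theory Lt) (Tt_QE : eliminates_quantifiers Tt) (Tt_EI : eliminates_imaginaries Tt)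
  (T : theory L) (M : structure L) (M_sat : saturated M) (M_hom : homogeneous M)
  (Mt : structure Lt) (Mt_Tt : models Mt Tt)
  (iota : forall s, reduct i M s -> Mt s) (iota_sub : embedding iota)
  (aut_ext : forall sigma : (forall s, M s -> M s), automorphism sigma ->
     exists2 tau : (forall s, Mt s -> Mt s), automorphism tau &
       forall s (x : M s), tau s (iota s x) = iota s (sigma s x))
  (conditions : forall A : set (elt M), A = acl A ->
     forall s, dominant T s -> forall c : M s,
     [/\ relative_algebraic_boundedness iota (existT M s c),
         internalizes_codes iota,
         unary_EI T M &
         invariant_types iota A c])
  (Gam : seq S) (dom : forall t, var Gam t -> dominant T t)
  (V : seq {s & var Gam s}) (E : forall N : structure L, env N Gam -> env N Gam -> Prop) :
  udef2 E -> equivalence (E M) ->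
  (forall x y : env M Gam, E M x y -> forall s (v : var Gam s),
     ~ List.In (existT _ s v) V -> x s v = y s v) ->
  forall a : env M Gam, ucoded E a.
Proof.
elim: V E => [|[s0 v0] V IH] E dE Eeq EV a.
  exists Gam, 1, (fun N x y => x = y); split; [exact: eq_udef| |by exists a].
  split=> [x y y' <- //|x x' y /EV xx' <-|y].
    by apply: env_ext => s v; apply/esym/xx'.
  by exists (fun=> y) => x ->; exists 0 => //; case: Eeq.
have [Er Es Et] := Eeq.
pose E' (N : structure L) (x y : env N Gam) := E N x y /\ x s0 v0 = y s0 v0.
have dE' : udef2 E'.
  apply: dprop_and; first by apply: (udef2_app dE); dt.
  by apply: (dprop_eqv (t := fun _ r => envl r) (u := fun _ r => envr r)); dt.
have E'eq : equivalence (E' M).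
  split=> [x|x y [xy e]|x y z [xy e] [yz e']]; split=> //; first exact: Es.
    exact: Et xy yz.
  by rewrite e.
have E'V x y : E' M x y -> forall s (v : var Gam s), ~ List.In (existT _ s v) V -> x s v = y s v.
  move=> [xy e] s v nV; have [ev|nv] := pselect (existT (var Gam) s v = existT (var Gam) s0 v0).
    have es := congr1 (@projT1 _ _) ev; simpl in es; subst s.
    by rewrite (eq_existT ev).
  by apply: EV => // -[/esym|].
have [Del [k [phi [dphi cod phia]]]] := IH E' dE' E'eq E'V a.
have rA := racl_acl dE Eeq a.
have [_ internal unary [p [pT p_inv p_fin p_germ]]] := conditions _ rA s0 (dom _ v0) (a s0 v0).
apply: (coordinate_step Tt_QE Tt_EI M_sat M_hom Mt_Tt iota_sub aut_ext dE Eeq dphi cod phia internal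
  _ _ pT p_inv p_fin p_germ).
- by move=> X dX; apply: (unary s0 (dom _ v0)).
- by move=> c; have [] := conditions _ rA s0 (dom _ v0) c.
Qed.

Lemma all_positions S (Gam : seq S) : exists V : seq {s & var Gam s}, forall s (v : var Gam s),
  List.In (existT _ s v) V.
Proof.
elim: Gam => [|t Gam [V VP]]; first by exists [::] => s v; case: (var_nilP v).
exists (existT _ t vz :: [seq existT (var (t :: Gam)) (projT1 x) (vs (projT2 x)) | x <- V]) => s v.
move: s v; apply: var_cons_ind => [|s v]; first by left.
right; elim: V {VP} (VP s v) => //= x V IH [->|/IH]; by [left|right].
Qed.

Theorem proposition2p13 (S : Type) (Lt L : language S) (i : sublanguage Lt L)
  (Tt : theory Lt) (Tt_complete : complete Tt)
  (Tt_QE : eliminates_quantifiers Tt) (Tt_EI : eliminates_imaginaries Tt)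
  (T : theory L) (T_complete : complete T)
  (T_univ : contains_universal_part i T Tt)
  (M : structure L) (M_T : models M T)
  (M_sat : saturated M) (M_hom : homogeneous M)
  (Mt : structure Lt) (Mt_Tt : models Mt Tt)
  (iota : forall s, reduct i M s -> Mt s) (iota_sub : embedding iota)
  (aut_ext : forall sigma : (forall s, M s -> M s), automorphism sigma ->
     exists2 tau : (forall s, Mt s -> Mt s), automorphism tau &
       forall s (x : M s), tau s (iota s x) = iota s (sigma s x))
  (conditions : forall A : set (elt M), A = acl A ->
     forall s, dominant T s -> forall c : M s,
     [/\ relative_algebraic_boundedness iota (existT M s c),
         internalizes_codes iota,
         unary_EI T M &
         invariant_types iota A c]) :
  EI_UFI T.
Proof.
have codM (Gam : seq S) (E : forall N : structure L, env N Gam -> env N Gam -> Prop) :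
    udef2 E -> equivalence (E M) -> forall a : env M Gam, ucoded E a.
  move=> dE Eeq; have [Gam' [H [dH domH /(_ M M_T)[Hfun Hsurj]]]] := dominant_cover T Gam.
  apply: (ucoded_pullback dH dE Hfun Hsurj Eeq) => E' dE' E'eq.
  have [V VP] := all_positions Gam'.
  by apply: (ucoded_dominant Tt_QE Tt_EI M_sat M_hom Mt_Tt iota_sub aut_ext conditions domH (V := V)).
move=> N N_T [[s|Gam E HE] x]; first by apply: home_imaginary; exists s.
pose Er (N' : structure L) (u v : env N' Gam) := sat E (env_cat u v).
have dEr : udef2 Er by exact: form_udef2.
have ErM : equivalence (Er M).
  have := @sentence_transfer _ _ T M N T_complete M_T N_T (fun N' _ => equivalence (Er N')).
  by apply; [exact: equivalence_udef|exact: HE].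
case: x => P [a Pa]; subst P.
apply: ucoded_imaginary.
exact: (ucoded_transfer T_complete M_T N_T M_sat a dEr (codM Gam Er dEr ErM)).
Qed.
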